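(* As $\omega\to-\lambda_0(\Omega)^-$, the mass of the action ground state approaches zero at the rate $$\|\phi_{\Omega,\omega}\|_{L^2}^2\sim|\omega+\lambda_0(\Omega)|^{\frac{2}{p-1}};$$ that is, there exist constants $\delta,c,C>0$ such that for every $\omega\in(-\lambda_0(\Omega)-\delta,-\lambda_0(\Omega))$ and every action ground state $\phi_{\Omega,\omega}\in\mathcal{A}_{\Omega,\omega}$, $c\,|\omega+\lambda_0(\Omega)|^{\frac{2}{p-1}}\le\|\phi_{\Omega,\omega}\|_{L^2}^2\le C\,|\omega+\lambda_0(\Omega)|^{\frac{2}{p-1}}$.
   Context: Let $d\ge 2$, let $1<p<\infty$ if $d=2$ and $1<p<\frac{d+2}{d-2}$ if $d\ge 3$. Let $V:\mathbb{R}^d\to\mathbb{R}$ satisfy $V\ge 0$ and $\lim_{|\mathbf{x}|\to\infty}V(\mathbf{x})=\infty$. Let $\Omega_{\max}:=\sup\{\gamma\ge 0:\lim_{|\mathbf{x}|\to\infty}(V(\mathbf{x})-\frac{\gamma^2}{2}(x_1^2+x_2^2))=\infty\}$, assume $\Omega_{\max}>0$, and fix $0<\Omega<\Omega_{\max}$. Let $L_z=i(x_2\partial_{x_1}-x_1\partial_{x_2})$. Let $X$ be the space of complex-valued $\phi\in H^1(\mathbb{R}^d)$ with $\int_{\mathbb{R}^d}V|\phi|^2\,d\mathbf{x}<\infty$, with norm $\|\phi\|_X^2=\int_{\mathbb{R}^d}\big(|\nabla\phi|^2+(1+V)|\phi|^2\big)d\mathbf{x}$. For $\phi\in X$ the quantity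 $\int_{\mathbb{R}^d}\overline{\phi}L_z\phi\,d\mathbf{x}$ is well defined and real. Define the action $S_{\Omega,\omega}(\phi)=\frac12\|\nabla\phi\|_{L^2}^2+\int_{\mathbb{R}^d}V|\phi|^2\,d\mathbf{x}+\frac{2}{p+1}\|\phi\|_{L^{p+1}}^{p+1}-\Omega\int_{\mathbb{R}^d}\overline{\phi}L_z\phi\,d\mathbf{x}+\omega\|\phi\|_{L^2}^2$. Let $\lambda_0(\Omega)=\inf_{0\ne\phi\in X}\frac{\int_{\mathbb{R}^d}(\frac12|\nabla\phi|^2+V|\phi|^2-\Omega\overline{\phi}L_z\phi)d\mathbf{x}}{\|\phi\|_{L^2}^2}$, the smallest eigenvalue of $R=-\frac12\Delta+V-\Omega L_z$. For $\omega<-\lambda_0(\Omega)$, the set of action ground states is $\mathcal{A}_{\Omega,\omega}:=\arg\min_{\phi\in X}S_{\Omega,\omega}(\phi)$, which is known to be nonempty with $\min_X S_{\Omega,\omega}<0$; its elements solve $-\frac12\Delta\phi+V\phi+|\phi|^{p-1}\phi-\Omega L_z\phi+\omega\phi=0$. *)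

(* Defs.v *)
From HB Require Import structures.
From mathcomp Require Import all_boot all_order all_algebra.
From mathcomp Require Import all_classical all_reals all_analysis.
From mathcomp Require Import complex.

Set Implicit Arguments.
Unset Strict Implicit.
Unset Printing Implicit Defensive.
Import Order.TTheory GRing.Theory Num.Theory.
Import numFieldNormedType.Exports.

Local Open Scope classical_set_scope.
Local Open Scope ring_scope.
Local Open Scope complex_scope.

(* R^n is 'rV[R]_n with the sigma-algebra generated by the coordinate maps (for
   T := R, the Borel sigma-algebra of R^n), as the library does for tuples. *)

Definition measure_rV_display : measure_display -> measure_display.
Proof. exact. Qed.

Section measurable_rV.
Context {d : measure_display} {T : measurableType d} (n : nat).

Let coors (i : 'I_n) (x : 'rV[T]_n) : T := x ord0 i.

Let rV_set0 : g_sigma_preimage coors set0.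
Proof. exact: sigma_algebra0. Qed.

Let rV_setC A : g_sigma_preimage coors A -> g_sigma_preimage coors (~` A).
Proof. exact: sigma_algebraC. Qed.

Let rV_bigcup (F : (set 'rV[T]_n)^nat) :
  (forall i, g_sigma_preimage coors (F i)) ->
  g_sigma_preimage coors (\bigcup_i (F i)).
Proof. exact: sigma_algebra_bigcup. Qed.

HB.instance Definition _ := @isMeasurable.Build (measure_rV_display d)
  'rV[T]_n (g_sigma_preimage coors) rV_set0 rV_setC rV_bigcup.

End measurable_rV.

Section measurable_rV_theory.
Context {d : measure_display} {T : measurableType d}.

Lemma measurable_coord n (i : 'I_n) :
  measurable_fun [set: 'rV[T]_n] (fun x => x ord0 i).
Proof.
move=> _ Y mY; rewrite setTI; apply: sub_sigma_algebra => /=.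
rewrite -bigcup_seq/=; exists i => /=; first by rewrite mem_index_enum.
by exists Y => //; rewrite setTI.
Qed.

Lemma measurable_fun_rVP d' (S : measurableType d') n (f : S -> 'rV[T]_n) :
  measurable_fun [set: S] f <->
  forall i, measurable_fun [set: S] (fun s => f s ord0 i).
Proof.
split=> [mf i|mf].
  exact: (measurableT_comp (measurable_coord i) mf).
move=> _ A mA; rewrite setTI.
suff : measurable `<=` [set B : set 'rV[T]_n | measurable (f @^-1` B)].
  exact.
apply: smallest_sub.
  split => /=.
  - by rewrite preimage_set0.
  - by move=> B mB; rewrite setTD preimage_setC; exact: measurableC.
  - by move=> F mF; rewrite preimage_bigcup; exact: bigcupT_measurable.
rewrite -bigcup_seq/= => B [i _ [Y mY <-]] /=.
by have := mf i measurableT Y mY; rewrite !setTI.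
Qed.

End measurable_rV_theory.

Section lebesgue_rV.
Context {R : realType}.

Definition cons_rV n (z : R * 'rV[R]_n) : 'rV[R]_n.+1 :=
  \row_i oapp (fun j => z.2 ord0 j) z.1 (unlift ord0 i).

Definition uncons_rV n (x : 'rV[R]_n.+1) : R * 'rV[R]_n :=
  (x ord0 ord0, \row_j x ord0 (lift ord0 j)).

Lemma cons_rVK n : cancel (@cons_rV n) (@uncons_rV n).
Proof.
case=> t x; rewrite /uncons_rV /cons_rV !mxE unlift_none /=; congr pair.
by apply/rowP => j; rewrite !mxE liftK.
Qed.

Lemma uncons_rVK n : cancel (@uncons_rV n) (@cons_rV n).
Proof.
move=> x; apply/rowP => i; rewrite !mxE.
by case: unliftP => [j|] -> /=; rewrite ?mxE.
Qed.

Lemma measurable_cons_rV n :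
  measurable_fun [set: R * 'rV[R]_n] (@cons_rV n).
Proof.
apply/measurable_fun_rVP => i.
under eq_fun do rewrite mxE.
case: unliftP => [j|] _ /=; last exact: measurable_fst.
exact: (measurableT_comp (measurable_coord j) measurable_snd).
Qed.

Lemma measurable_uncons_rV n :
  measurable_fun [set: 'rV[R]_n.+1] (@uncons_rV n).
Proof.
apply: measurable_fun_pair => /=; first exact: measurable_coord.
apply/measurable_fun_rVP => i; under eq_fun do rewrite mxE.
exact: measurable_coord.
Qed.

Section lebesgue_cons.
Context {n : nat} (mu : {sigma_finite_measure set 'rV[R]_n -> \bar R}).

Definition lebesgue_cons : set 'rV[R]_n.+1 -> \bar R :=
  pushforward (@lebesgue_measure R \x mu)%E (@cons_rV n).

Let lebesgue_cons0 : lebesgue_cons set0 = 0%E.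
Proof. by rewrite /lebesgue_cons /pushforward preimage_set0 measure0. Qed.

Let lebesgue_cons_ge0 A : (0 <= lebesgue_cons A)%E.
Proof. by rewrite /lebesgue_cons /pushforward. Qed.

Let lebesgue_cons_sigma_additive : semi_sigma_additive lebesgue_cons.
Proof.
move=> F mF tF mUF; rewrite /lebesgue_cons /pushforward preimage_bigcup.
apply: measure_semi_sigma_additive.
- move=> k; rewrite -[X in measurable X]setTI.
  exact: measurable_cons_rV (mF k).
- apply/trivIsetP => /= i j _ _ ij; rewrite -preimage_setI.
  by move/trivIsetP : tF => /(_ _ _ _ _ ij) ->//; rewrite preimage_set0.
- rewrite -preimage_bigcup -[X in measurable X]setTI.
  exact: measurable_cons_rV mUF.
Qed.

HB.instance Definition _ := isMeasure.Build _ _ _ lebesgue_cons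
  lebesgue_cons0 lebesgue_cons_ge0 lebesgue_cons_sigma_additive.

Let lebesgue_cons_sigma_finite : sigma_finite setT lebesgue_cons.
Proof.
have /sigma_finiteP[F [TF ndF Foo]] := sigma_finiteT (@lebesgue_measure R).
have /sigma_finiteP[G [TG ndG Goo]] := sigma_finiteT mu.
exists (fun k => @uncons_rV n @^-1` (F k `*` G k)).
  rewrite -preimage_bigcup -[LHS](preimage_setT (@uncons_rV n)).
  congr (_ @^-1` _); rewrite -setXTT TF TG predeqE => -[x y]; split.
    move=> [/= [k _ Fx] [l _ Gy]]; exists (maxn k l) => //; split.
    - by move: x Fx; exact/subsetPset/ndF/leq_maxl.
    - by move: y Gy; exact/subsetPset/ndG/leq_maxr.
  by move=> [k _ []/= ? ?]; split; exists k.
move=> k; have [mF Fk] := Foo k; have [mG Gk] := Goo k; split.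
  rewrite -[X in measurable X]setTI.
  by apply: measurable_uncons_rV => //; exact: measurableX.
rewrite /lebesgue_cons /pushforward -comp_preimage.
rewrite (_ : _ \o _ = id); last by apply/funext => z /=; rewrite cons_rVK.
by rewrite preimage_id product_measure1E// lte_mul_pinfty// ge0_fin_numE.
Qed.

HB.instance Definition _ := Measure_isSigmaFinite.Build _ _ _ lebesgue_cons
  lebesgue_cons_sigma_finite.

End lebesgue_cons.

(* n-dimensional Lebesgue measure on the Borel sets of R^n, by iterated products;
   the value on boxes is lebesgue_rV_box below. *)
Fixpoint lebesgue_rV n : {sigma_finite_measure set 'rV[R]_n -> \bar R} :=
  match n with
  | 0 => \d_(0 : 'rV[R]_0)
  | n'.+1 => lebesgue_cons (lebesgue_rV n')
  end.

Lemma lebesgue_rV_box n (A : 'I_n -> set R) : (forall i, measurable (A i)) ->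
  lebesgue_rV n [set x | forall i, A i (x ord0 i)] =
  (\prod_(i < n) lebesgue_measure (A i))%E.
Proof.
elim: n A => [|n IH] A mA.
  rewrite big_ord0 /= diracE mem_set //= => -[].
  by [].
pose B (i : 'I_n) := A (lift ord0 i).
have mB : measurable [set x : 'rV[R]_n | forall i, B i (x ord0 i)].
  have -> : [set x : 'rV[R]_n | forall i, B i (x ord0 i)] =
      \bigcap_(i in [set: 'I_n]) ((fun x : 'rV[R]_n => x ord0 i) @^-1` B i).
    by apply/seteqP; split=> x /= Bx i; [move=> _; exact: Bx|exact: Bx].
  apply: fin_bigcap_measurable => // i _.
  by rewrite -[X in measurable X]setTI; apply: measurable_coord => //; exact: mA.
rewrite big_ord_recl -[in RHS](IH B); last by move=> i; exact: mA.
have <- := product_measure1E (@lebesgue_measure R) (lebesgue_rV n) (mA ord0) mB.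
rewrite /= /lebesgue_cons /pushforward; congr (_ _).
apply/seteqP; split => [[t x] /= Ai|[t x] [/= At Ax] i].
  split => [|i] /=; first by have := Ai ord0; rewrite mxE unlift_none.
  by have := Ai (lift ord0 i); rewrite mxE liftK.
by rewrite mxE; case: unliftP => [j|] -> //=; exact: Ax.
Qed.

End lebesgue_rV.

Section function_spaces.
Context {R : realType} {d : nat}.
Local Notation E := 'rV[R]_d.
Local Notation mu := (@lebesgue_rV R d).
Implicit Types (phi g : E -> R[i]) (eta : E -> R) (j : 'I_d).

(* Euclidean norm: the norm carried by 'rV[R]_d is the sup norm. *)
Definition enorm (x : E) : R := Num.sqrt (\sum_(j < d) x ord0 j ^+ 2).

Definition cvg_pinfty_at_infinity (f : E -> R) : Prop :=
  forall A : R, exists r : R, forall x, r <= enorm x -> A <= f x.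

Local Notation cmod := ComplexField.Normc.normc.

Definition Cmeasurable phi : Prop :=
  measurable_fun [set: E] (fun x => complex.Re (phi x)) /\
  measurable_fun [set: E] (fun x => complex.Im (phi x)).

Definition Cintegral phi : R[i] :=
  (\int[mu]_x complex.Re (phi x)) +i* (\int[mu]_x complex.Im (phi x)).

Definition eLnorm (q : R) phi : \bar R :=
  Lnorm mu q%:E (fun x => (cmod (phi x))%:E).

(* fine sends +oo to 0. The norms used below are finite: q = 2 on L2, and, by
   the Sobolev embedding (p is subcritical), q = p + 1 on H1. *)
Definition Lqnorm (q : R) phi : R := fine (eLnorm q phi).

Definition L2 phi : Prop := Cmeasurable phi /\ (eLnorm 2 phi < +oo)%E.

Definition basis_rV j : E := delta_mx ord0 j.

Fixpoint Ck (k : nat) eta : Prop :=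
  match k with
  | 0 => continuous eta
  | k'.+1 => continuous eta /\ forall j,
      (forall x, derivable eta x (basis_rV j)) /\
      Ck k' (fun x => 'D_(basis_rV j) eta x)
  end.

(* Smooth real-valued functions with compact support; complex-valued ones give
   the same weak derivatives, by linearity. *)
Definition test_function eta : Prop :=
  (forall k, Ck k eta) /\ compact (closure [set x | eta x != 0]).

Definition weak_partial j phi g : Prop := forall eta, test_function eta ->
  Cintegral (fun x => phi x * ('D_(basis_rV j) eta x)%:C) =
  - Cintegral (fun x => g x * (eta x)%:C).

Definition H1 phi : Prop :=
  L2 phi /\ forall j, exists2 g, L2 g & weak_partial j phi g.

(* The weak derivative is unique up to a null set; wD picks a representative.
   Outside H1 the value may be the dummy 0. *)
Definition wD j phi : E -> R[i] :=
  xget (fun=> 0) [set g | L2 g /\ weak_partial j phi g].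

Definition grad_sqr phi (x : E) : R := \sum_(j < d) cmod (wD j phi x) ^+ 2.

End function_spaces.

Section rotating_NLS.
Context {R : realType} {d : nat} (hd : (1 < d)%N).
Local Notation E := 'rV[R]_d.
Local Notation mu := (@lebesgue_rV R d).
Local Notation cmod := ComplexField.Normc.normc.
Variables (p : R) (V : E -> R) (Omega : R).
Implicit Types (phi psi : E -> R[i]) (omega : R).

Definition axis1 : 'I_d := Ordinal (ltnW hd).
Definition axis2 : 'I_d := Ordinal hd.

(* +oo when V grows faster than quadratically. *)
Definition Omega_max : \bar R :=
  ereal_sup [set gamma%:E | gamma in
    [set gamma : R | 0 <= gamma /\ cvg_pinfty_at_infinity
      (fun x => V x - gamma ^+ 2 / 2 * (x ord0 axis1 ^+ 2 + x ord0 axis2 ^+ 2))]].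

(* 0 +i* 1 rather than 'i: the latter would denote the unspecified square root of
   -1 of a numClosedFieldType. *)
Definition Lz phi (x : E) : R[i] :=
  (0 +i* 1) * ((x ord0 axis2)%:C * wD axis1 phi x - (x ord0 axis1)%:C * wD axis2 phi x).

Definition Xspace : set (E -> R[i]) :=
  [set phi | H1 phi /\ (\int[mu]_x (V x * cmod (phi x) ^+ 2)%:E < +oo)%E].

Definition angular_momentum phi : R[i] :=
  Cintegral (fun x => conjc (phi x) * Lz phi x).

Definition action omega phi : R :=
  1 / 2 * (\int[mu]_x grad_sqr phi x)
  + (\int[mu]_x (V x * cmod (phi x) ^+ 2))
  + 2 / (p + 1) * Lqnorm (p + 1) phi `^ (p + 1)
  - Omega * complex.Re (angular_momentum phi)
  + omega * Lqnorm 2 phi ^+ 2.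

Definition linear_energy phi : R :=
  complex.Re (Cintegral (fun x =>
    (1 / 2 * grad_sqr phi x + V x * cmod (phi x) ^+ 2)%:C
    - Omega%:C * (conjc (phi x) * Lz phi x))).

(* Extended-real infimum: it is +oo, not 0, should Xspace contain no nonzero
   function. *)
Definition lambda0 : \bar R :=
  ereal_inf [set (linear_energy phi / Lqnorm 2 phi ^+ 2)%:E | phi in
    [set phi | Xspace phi /\ ~ {ae mu, forall x, phi x = 0}]].

Definition action_ground_states omega : set (E -> R[i]) :=
  [set phi | Xspace phi /\
    forall psi, Xspace psi -> action omega phi <= action omega psi].

End rotating_NLS.

(* Main.v *)
From HB Require Import structures.
Require Import Defs.
From mathcomp Require Import all_boot all_order all_algebra.
From mathcomp Require Import all_classical all_reals all_analysis.
From mathcomp Require Import measurable_realfun complex ring lra.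

(** Write Q for the quadratic energy, M for the mass, N for the integral of
|phi|^(p+1), l for the bottom of the spectrum of Q, and e = - omega - l > 0,
so that the action is S = (Q - l M) - e M + 2/(p+1) N, where Q - l M >= 0. Both
bounds come from testing the minimality of a ground state phi against explicit
competitors.

Upper bound ([mass_upper_bound]). The map s |-> S (s phi) is minimal at s = 1,
which gives N = e M - (Q - l M) <= e M. Completing the square ([rotation_young])
shows that Q dominates the integral of U |phi|^2, where U = V - ga^2/2 (x_1^2 +
x_2^2) tends to infinity for some ga > Omega. As Q <= (l + e) M, at least half
of the mass of phi lies in a fixed cube ([tail_le_energy]), and there
|phi|^2 <= tau^2 + tau^(1-p) |phi|^(p+1) for every tau > 0. With tau^2
comparable to M this reads M <= C tau^(1-p) e M, that is M <= C e^(2/(p-1)).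

Lower bound ([mass_lower_bound]). As S(phi) >= - e M, it suffices to find a
competitor whose action is at most - c e^(1 + 2/(p-1)). Take psi of unit mass
with Q(psi) < l + e/2. If N(psi) <= C, then the competitor t psi with
t^(p-1) = e / (4 C) has action at most - e t^2 / 4. What must be proved is that
C can be chosen independently of e: Q and M bound the gradient of psi, so this
is the subcritical Sobolev inequality [sobolev_subcritical].

The Sobolev inequality is derived from translations. A weak partial derivative
g of u satisfies u (x + s e_j) - u x = int_0^s g (x + t e_j) dt for almost every
x, hence the squared L2 distance between u and its translate by y is at most
C |y|^2 ([shift_estimate]). If |u| > 2 lambda at x, while {|u| > lambda} fills
at most half of the cube x + (0, r)^d, then u oscillates by lambda on the other
half; hence |{|u| > 2 lambda}| <= C r^2 / lambda^2 as soon as r^d is twice the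
measure of {|u| > lambda} ([level_step]). Iterating over lambda = 2^k yields a
decay of order lambda^(-s) for every s below the critical exponent
([level_decay]), and a dyadic summation gives the moment of order p + 1.

The identity for translates, like the almost everywhere uniqueness of weak
derivatives, follows from the fundamental lemma [sq_integrable_ae0], for which
products of one-variable bump functions suffice as test functions. *)

Set Implicit Arguments.
Unset Strict Implicit.
Unset Printing Implicit Defensive.
Import Order.TTheory GRing.Theory Num.Theory.
Import numFieldNormedType.Exports.

Local Open Scope classical_set_scope.
Local Open Scope ring_scope.

(** * Boxes, uniqueness of measures and translation invariance *)

Section integrability.
Context d (T : measurableType d) {R : realType} (mu : {measure set T -> \bar R}).

Lemma integrable_cst_indic (C : R) (A : set T) : measurable A -> (mu A < +oo)%E ->
  mu.-integrable [set: T] (fun x => (C * \1_A x)%:E).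
Proof.
move=> mA fA; under eq_fun do rewrite EFinM.
apply: integrableZl => //; apply/integrableP; split.
  by apply/measurable_EFinP; exact: measurable_indic.
under eq_integral do rewrite gee0_abs ?lee_fin//.
by rewrite integral_indic// setIT.
Qed.

Lemma le_integrable_real (f g : T -> R) : measurable_fun [set: T] f ->
  mu.-integrable [set: T] (EFin \o g) -> (forall x, `|f x| <= g x) ->
  mu.-integrable [set: T] (EFin \o f).
Proof.
move=> mf ig fg; apply: (le_integrable measurableT _ _ ig).
  exact/measurable_EFinP.
by move=> x _ /=; rewrite lee_fin (le_trans (fg x))// ler_norm.
Qed.

Lemma le_Rintegral_setT (f g : T -> R) : mu.-integrable [set: T] (EFin \o f) ->
  mu.-integrable [set: T] (EFin \o g) -> (forall x, f x <= g x) ->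
  \int[mu]_x f x <= \int[mu]_x g x.
Proof. by move=> *; apply: le_Rintegral. Qed.

End integrability.

Section boxes.
Context {R : realType} {d : nat}.
Local Notation E := 'rV[R]_d.
Local Notation mu := (@lebesgue_rV R d).

Definition obox (a b : 'I_d -> R) : set E :=
  [set x | forall i, `]a i, b i[%classic (x ord0 i)].

Definition oboxes : set (set E) := [set A | exists a b, A = obox a b].

Lemma rV_prod_measurable (A : 'I_d -> set R) : (forall i, measurable (A i)) ->
  measurable [set x : E | forall i, A i (x ord0 i)].
Proof.
move=> mA.
have -> : [set x : E | forall i, A i (x ord0 i)] =
    \bigcap_(i in [set: 'I_d]) ((fun x : E => x ord0 i) @^-1` A i).
  by apply/seteqP; split=> x /= Bx i; [move=> _; exact: Bx|exact: Bx].
apply: fin_bigcap_measurable => // i _.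
by rewrite -[X in measurable X]setTI; apply: measurable_coord => //; exact: mA.
Qed.

Lemma measurable_obox a b : measurable (obox a b).
Proof. by apply: (@rV_prod_measurable (fun i => `]a i, b i[%classic)). Qed.

Lemma oboxes_setI_closed : setI_closed oboxes.
Proof.
move=> _ _ [a [b ->]] [a' [b' ->]].
exists (fun i => Num.max (a i) (a' i)), (fun i => Num.min (b i) (b' i)).
apply/seteqP; split => [x [/= h1 h2] i|x /= h].
  have := h1 i; have := h2 i; rewrite /= !in_itv/= gt_max lt_min.
  by move=> /andP[-> ->] /andP[-> ->].
by split=> i; have := h i; rewrite /= !in_itv/= gt_max lt_min =>
  /andP[/andP[? ?] /andP[? ?]]; apply/andP.
Qed.

Definition cube (k : nat) : set E := obox (fun=> - k%:R) (fun=> k%:R).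

Lemma cube_oboxes k : oboxes (cube k).
Proof. by exists (fun=> - k%:R), (fun=> k%:R). Qed.

Lemma measurable_cube k : measurable (cube k).
Proof. exact: measurable_obox. Qed.

(** The cubes are the sets of finite measure that exhaust the space; they serve
both for uniqueness of measures and to localize the mass. *)
Lemma bigcup_cube : \bigcup_k cube k = [set: E].
Proof.
apply/seteqP; split => // x _.
exists (\max_(i < d) (Num.truncn `|x ord0 i|).+1)%N => // i /=.
have : `|x ord0 i| < (\max_(i < d) (Num.truncn `|x ord0 i|).+1)%:R.
  apply: lt_le_trans (truncnS_gt _) _.
  by rewrite ler_nat; exact: (leq_bigmax i).
by rewrite in_itv/= ltr_norml.
Qed.

(** Open boxes generate the sigma-algebra: the preimage of an open interval by
one coordinate is the union of the boxes that are bounded by k in the other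
coordinates. Boxes with open sides are chosen because their indicators are
pointwise limits of smooth functions. *)
Lemma measurable_rV_oboxes :
  @measurable _ 'rV[R]_d = <<s oboxes >>.
Proof.
apply/seteqP; split => A; last first.
  apply: smallest_sub; first exact: sigma_algebra_measurable.
  by move=> _ [a [b ->]]; exact: measurable_obox.
apply: smallest_sub; first exact: smallest_sigma_algebra.
rewrite -bigcup_seq => B [i _ [Y mY <-]]; rewrite setTI.
have sS := smallest_sigma_algebra [set: E] oboxes.
have [s0 sC sU] := sS.
suff : measurable `<=` [set Y : set R |
    <<s oboxes >> ((fun x : E => x ord0 i) @^-1` Y)] by exact.
rewrite [X in X `<=` _]RGenOpens.measurableE.
apply: smallest_sub.
  split => /=.
  - by rewrite preimage_set0.
  - by move=> Z hZ; rewrite setTD preimage_setC -setTD; exact: sC.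
  - by move=> F hF; rewrite preimage_bigcup; exact: sU.
move=> _ [a [b ->]] /=.
have -> : (fun x : E => x ord0 i) @^-1` `]a, b[ = \bigcup_k
   (obox (fun j => if j == i then a else - k%:R)
         (fun j => if j == i then b else k%:R)).
  apply/seteqP; split => [x xab|x [k _ /(_ i)]]; last by rewrite /= eqxx.
  have : [set: E] x by [].
  rewrite -bigcup_cube => -[k _ xk]; exists k => // j /=.
  by case: eqP => [->//|_]; exact: xk.
apply: sU => k; apply: sub_sigma_algebra.
by eexists; eexists; reflexivity.
Qed.

Lemma rV_measure_unique (m1 m2 : {measure set E -> \bar R}) :
  (forall a b, m1 (obox a b) = m2 (obox a b)) ->
  (forall k, m1 (cube k) < +oo)%E ->
  forall A, measurable A -> m1 A = m2 A.
Proof.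
move=> m12 fin A mA.
apply: (measure_unique oboxes cube) => //.
- exact: measurable_rV_oboxes.
- exact: oboxes_setI_closed.
- exact: cube_oboxes.
- exact: bigcup_cube.
- by move=> _ [a [b ->]]; exact: m12.
Qed.

Lemma lebesgue_rV_obox a b :
  mu (obox a b) = (\prod_(i < d) lebesgue_measure `]a i, b i[%classic)%E.
Proof. exact: (@lebesgue_rV_box R d (fun i => `]a i, b i[%classic)). Qed.

Lemma obox_fin a b : (mu (obox a b) < +oo)%E.
Proof.
rewrite lebesgue_rV_obox.
have : (\prod_(i < d) lebesgue_measure `]a i, b i[%classic)%E \is a fin_num.
  elim/big_ind: _ => //; first by move=> x y; exact: fin_numM.
  by move=> i _; rewrite lebesgue_measure_itv/=; case: ifP.
by rewrite ltey_eq => ->.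
Qed.

End boxes.

Section translation.
Context {R : realType} {d : nat}.
Local Notation E := 'rV[R]_d.
Local Notation mu := (@lebesgue_rV R d).

Lemma measurable_addrV :
  measurable_fun [set: E * E] (fun z : E * E => z.1 + z.2).
Proof.
apply/measurable_fun_rVP => i; under eq_fun do rewrite mxE.
apply: measurable_funD.
  exact: (measurableT_comp (measurable_coord i) measurable_fst).
exact: (measurableT_comp (measurable_coord i) measurable_snd).
Qed.

Lemma measurable_shift (y : E) : measurable_fun [set: E] (fun x => x + y).
Proof.
apply/measurable_fun_rVP => i; under eq_fun do rewrite mxE.
by apply: measurable_funD => //; exact: measurable_coord.
Qed.

(** A translate of a box is a box with the same side lengths, and boxes determine
the measure. *)
Lemma lebesgue_rV_shift (y : E) A : measurable A ->
  mu ((fun x => x + y) @^-1` A) = mu A.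
Proof.
move=> mA.
pose m : {measure set E -> \bar R} :=
  measure_function_pushforward__canonical__measure_function_Measure
    mu (measurable_shift y).
have E1 (a b : 'I_d -> R) : m (obox a b) = mu (obox a b).
  have -> : m (obox a b) =
      mu (obox (fun i => a i - y ord0 i) (fun i => b i - y ord0 i)).
    congr (mu _); apply/seteqP; split=> x /= h i; have := h i;
      by rewrite /= !in_itv/= mxE ltrBlDr ltrBrDr.
  rewrite !lebesgue_rV_obox; apply: eq_bigr => i _.
  rewrite !lebesgue_measure_itv/= !lte_fin ltrD2r.
  by case: ifP => // _; rewrite -!EFinB; congr EFin; ring.
apply: (rV_measure_unique (m1 := m)) => // k.
by rewrite E1; exact: obox_fin.
Qed.

Lemma ge0_integral_shift (y : E) (f : E -> \bar R) :
  measurable_fun [set: E] f -> (forall x, 0 <= f x)%E ->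
  (\int[mu]_x f (x + y)%R = \int[mu]_x f x)%E.
Proof.
move=> mf f0.
transitivity (\int[pushforward mu (fun x : E => x + y)%R]_x f x)%E.
  rewrite ge0_integral_pushforward//; last exact: measurable_shift.
apply: eq_measure_integral => [|? A mA _]; first exact: measurable_shift.
exact: lebesgue_rV_shift.
Qed.

End translation.

(** * Smooth functions of one variable *)

Section smooth1.
Context {R : realType}.
Implicit Types f g : R -> R.

(** A recursive predicate rather than a statement on iterated derivatives: closure
under sums, products and affine changes of variable is then a plain induction. *)
Fixpoint smoothn (n : nat) f : Prop :=
  match n with
  | 0 => continuous f
  | n'.+1 => exists2 f' : R -> R,
      (forall x : R, is_derive x 1 f (f' x)) & smoothn n' f'
  end.

Definition smooth f := forall n, smoothn n f.

Lemma is_derive1_continuous f f' : (forall x : R, is_derive x 1 f (f' x)) ->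
  continuous f.
Proof.
move=> df x; apply: differentiable_continuous.
by apply/derivable1_diffP; have [] := df x.
Qed.

Lemma smoothnS n f : smoothn n.+1 f -> smoothn n f.
Proof.
elim: n f => [f [f' df _]|n IH f [f' df sf']]; first exact: is_derive1_continuous df.
by exists f' => //; exact: IH.
Qed.

Lemma smooth_continuous f : smooth f -> continuous f.
Proof. by move=> /(_ 0%N). Qed.

Lemma smooth_derive f : smooth f -> exists2 f' : R -> R,
  (forall x : R, is_derive x 1 f (f' x)) & smooth f'.
Proof.
move=> sf; have [f' df _] := sf 1%N; exists f' => // n.
have [g dg sg] := sf n.+1.
suff -> : f' = g by [].
by apply/funext => x; rewrite -(@derive_val _ _ _ _ _ _ _ (df x)) -(@derive_val _ _ _ _ _ _ _ (dg x)).
Qed.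

Lemma smoothnD n f g : smoothn n f -> smoothn n g -> smoothn n (fun x => f x + g x).
Proof.
elim: n f g => [f g cf cg x|n IH f g [f' df sf] [g' dg sg]].
  by apply: cvgD; [exact: cf|exact: cg].
exists (fun x => f' x + g' x); last exact: IH.
by move=> x; have := is_deriveD (df x) (dg x).
Qed.

Lemma smoothnM n f g : smoothn n f -> smoothn n g -> smoothn n (fun x => f x * g x).
Proof.
elim: n f g => [f g cf cg x|n IH f g].
  by apply: cvgM; [exact: cf|exact: cg].
move=> sf sg; have [f' df sf'] := sf; have [g' dg sg'] := sg.
exists (fun x => f x * g' x + g x * f' x).
  by move=> x; have := is_deriveM (df x) (dg x).
by apply: smoothnD; apply: IH => //; exact: smoothnS.
Qed.

Lemma smoothn_cst n (c : R) : smoothn n (fun=> c).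
Proof.
elim: n c => [c x|n IH c]; first exact: cvg_cst.
by exists (fun=> 0) => // x; exact: is_derive_cst.
Qed.

Lemma is_derive1_affine f (f' a b x : R) : is_derive (a * x + b) 1 f f' ->
  is_derive x 1 (fun t => f (a * t + b)) (a * f').
Proof.
move=> df.
have dg : is_derive x 1 (fun t => a * t + b) a.
  by apply: is_derive_eq; rewrite /GRing.scale/= addr0 mulr1.
rewrite mulrC; exact: (@is_derive1_comp _ f (fun t => a * t + b) x f' a).
Qed.

Lemma smoothn_affine n f (a b : R) : smoothn n f ->
  smoothn n (fun t => f (a * t + b)).
Proof.
elim: n f => [f cf|n IH f [f' df sf']] /=.
  move=> x; apply: (@continuous_comp _ _ _ (fun t => a * t + b) f); last exact: cf.
  by apply: cvgD; [apply: cvgMr; exact: cvg_id|exact: cvg_cst].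
exists (fun t => a * f' (a * t + b)).
  by move=> x; exact: is_derive1_affine.
by apply: smoothnM; [exact: smoothn_cst|exact: IH].
Qed.

(** This gives differentiability of flat functions at the origin, where they are
glued to the zero function. *)
Lemma is_derive1_quadratic f (x C : R) :
  (forall h, `|f (x + h) - f x| <= C * h ^+ 2) -> is_derive x 1 f 0.
Proof.
move=> fC.
suff cv : h^-1 *: (f (h *: 1 + x) - f x) @[h --> 0^'] --> (0 : R).
  by split; [apply/cvg_ex; exists 0|apply/cvg_lim].
apply/cvgr0Pnorm_le => e e0; near=> h.
rewrite /GRing.scale/= mulr1 normrM normfV.
have h0 : h != 0 by near: h; exact: nbhs_dnbhs_neq.
rewrite ler_pdivrMl ?normr_gt0//.
rewrite [h + x]addrC; apply: le_trans (fC h) _.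
rewrite -real_normK ?num_real// expr2 mulrA [leRHS]mulrC ler_wpM2r//.
have : `|h| <= e / (`|C| + 1).
  near: h; apply: dnbhs0_le.
  by rewrite divr_gt0// ltr_wpDl.
rewrite ler_pdivlMr ?ltr_wpDl//; apply: le_trans.
rewrite mulrC ler_wpM2l//.
by rewrite (le_trans (ler_norm _))// lerDl.
Unshelve. all: by end_near. Qed.

(** The functions t^(-k) exp(-1/t) extended by zero. The family over all k is
closed under differentiation up to linear combinations. *)
Definition flat (k : nat) (t : R) : R :=
  if t <= 0 then 0 else t^-1 ^+ k * expR (- t^-1).

(** Apply 1 + z <= exp z to z = y / k and take the k-th power. *)
Lemma expRN_bound (k : nat) (y : R) : 0 < y ->
  y ^+ k * expR (- y) <= k%:R ^+ k.
Proof.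
move=> y0; case: k => [|k].
  by rewrite !expr0 mul1r -[leRHS]expR0 ler_expR oppr_le0 ltW.
rewrite expRN ler_pdivrMr ?expR_gt0//.
have -> : expR y = expR (y / k.+1%:R) ^+ k.+1.
  by rewrite -expRM_natr mulfVK.
rewrite -exprMn ler_pXn2r ?nnegrE ?mulr_ge0 ?expR_ge0 ?(ltW y0)//.
rewrite -ler_pdivrMl// mulrC.
by apply: le_trans (expR_ge1Dx _); rewrite lerDr.
Qed.

Lemma flat_bound (k : nat) (t : R) : `|flat k t| <= k.+2%:R ^+ k.+2 * t ^+ 2.
Proof.
rewrite /flat; case: ifPn => [_|]; first by rewrite normr0 mulr_ge0 ?sqr_ge0.
rewrite -ltNge => t0.
rewrite ger0_norm ?mulr_ge0 ?expR_ge0 ?exprn_ge0 ?invr_ge0 ?(ltW t0)//.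
rewrite -ler_pdivrMr ?exprn_gt0//.
have := @expRN_bound k.+2 t^-1; rewrite invr_gt0 => /(_ t0); apply: le_trans.
by rewrite -[(t ^+ 2)^-1]exprVn -(addn2 k) exprD mulrAC.
Qed.

Lemma is_derive_flat (k : nat) (x : R) :
  is_derive x 1 (flat k) (flat k.+2 x - k%:R * flat k.+1 x).
Proof.
have [x0|x0|->] := ltgtP x 0.
- rewrite /flat (ltW x0) mulr0 subr0.
  apply: (@near_eq_is_derive _ _ _ (fun=> 0)).
    near=> t; case: ifPn => //; rewrite -ltNge => t0.
    suff : t < 0 by move/(lt_trans t0); rewrite ltxx.
    near: t; exact: lt_nbhsl.
- rewrite /flat !leNgt x0/=.
  apply: (@near_eq_is_derive _ _ _ (fun t : R => t^-1 ^+ k * expR (- t^-1))).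
    near=> t; have t0 : 0 < t by near: t; exact: lt_nbhsr.
    by rewrite leNgt t0.
  have dV : is_derive x 1 (fun t : R => t^-1) (- x ^- 2).
    have := @is_deriveV _ id x 1 1 (lt0r_neq0 x0) _.
    by move=> /(_ (is_derive_id _ _)); rewrite /GRing.scale/= mulr1.
  have dE : is_derive x 1 (fun t : R => expR (- t^-1)) (x ^- 2 * expR (- x^-1)).
    have := @is_derive1_comp _ expR (fun t : R => - t^-1) x (expR (- x^-1)) (x ^- 2).
    rewrite mulrC; apply.
    by have := is_deriveN dV; rewrite opprK.
  have dP : is_derive x 1 (fun t : R => t^-1 ^+ k) (- k%:R * x^-1 ^+ k.+1).
    have -> : (fun t : R => t^-1 ^+ k) = (fun t : R => t^-1) ^+ k.
      by rewrite exprfctE.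
    apply: is_derive_eq; rewrite /GRing.scale/= -exprVn.
    case: k => [|k] /=; first by rewrite oppr0 !mul0r.
    by rewrite !exprS; ring.
  have h := is_deriveM dP dE.
  apply: (@is_derive_eq _ _ _ _ _ _ _ _ h); rewrite /GRing.scale/=.
  by rewrite -exprVn !exprS; ring.
- rewrite /flat lexx mulr0 subr0 -/(flat k).
  apply: (@is_derive1_quadratic _ _ (k.+2%:R ^+ k.+2)) => h.
  rewrite add0r /flat lexx/= !subr0.
  exact: flat_bound.
Unshelve. all: by end_near. Qed.

Lemma smooth_flat k : smooth (flat k).
Proof.
move=> n; elim: n k => [|n IH] k.
  exact: (is_derive1_continuous (is_derive_flat k)).
exists (fun x => flat k.+2 x - k%:R * flat k.+1 x); first exact: is_derive_flat.
have -> : (fun x => flat k.+2 x - k%:R * flat k.+1 x) =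
    (fun x => flat k.+2 x + (- k%:R) * flat k.+1 x).
  by apply/funext => x; rewrite mulNr.
apply: smoothnD; first exact: IH.
by apply: smoothnM; [exact: smoothn_cst|exact: IH].
Qed.

(** The parameter n tends to infinity: the functions increase to the indicator of
the interval (a, b), without ever being equal to 1. *)
Definition cutoff (a b : R) (n : nat) (t : R) : R :=
  flat 0 (n%:R * (t - a)) * flat 0 (n%:R * (b - t)).

Lemma flat0_ge0 t : 0 <= flat 0 t.
Proof. by rewrite /flat; case: ifP => // _; rewrite expr0 mul1r expR_ge0. Qed.

Lemma flat0_le1 t : flat 0 t <= 1.
Proof.
rewrite /flat; case: ifPn => // t0; rewrite expr0 mul1r -expR0 ler_expR.
by rewrite oppr_le0 invr_ge0 ltW// ltNge.
Qed.

Lemma cutoff_ge0 a b n t : 0 <= cutoff a b n t.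
Proof. by rewrite mulr_ge0// flat0_ge0. Qed.

Lemma cutoff_le1 a b n t : cutoff a b n t <= 1.
Proof. by rewrite mulr_ile1 ?flat0_ge0 ?flat0_le1. Qed.

Lemma cutoff_out a b n t : ~ `]a, b[%classic t -> cutoff a b n t = 0.
Proof.
rewrite /= in_itv/= => /negP; rewrite negb_and -!leNgt /cutoff /flat => /orP[ta|bt].
  by rewrite mulr_ge0_le0 ?subr_le0// mul0r.
by rewrite [n%:R * (b - t) <= 0]mulr_ge0_le0 ?subr_le0// mulr0.
Qed.

Lemma smooth_cutoff a b n : smooth (cutoff a b n).
Proof.
move=> m; apply: smoothnM.
- have -> : (fun t => flat 0 (n%:R * (t - a))) =
      (fun t => flat 0 (n%:R * t + - (n%:R * a))).
    by apply/funext => t; rewrite mulrBr.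
  by apply: smoothn_affine; exact: smooth_flat.
- have -> : (fun t => flat 0 (n%:R * (b - t))) =
      (fun t => flat 0 (- n%:R * t + n%:R * b)).
    by apply/funext => t; congr flat; ring.
  by apply: smoothn_affine; exact: smooth_flat.
Qed.

Lemma flat0_cvg t : 0 < t -> flat 0 (n%:R * t) @[n --> \oo] --> (1 : R).
Proof.
move=> t0.
have h : expR (- (n.+1%:R^-1 * t^-1)) @[n --> \oo] --> (1 : R).
  suff : expR (- (n.+1%:R^-1 * t^-1)) @[n --> \oo] --> expR (- (0 * t^-1)).
    by rewrite mul0r oppr0 expR0.
  apply: continuous_cvg; first exact: continuous_expR.
  by apply: cvgN; apply: cvgM; [exact: (@cvg_harmonic R)|exact: cvg_cst].
rewrite -cvg_shiftS; apply: cvg_trans h; apply: near_eq_cvg.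
near=> n; rewrite /flat/= leNgt mulr_gt0//= ?ltr0n// expr0 mul1r.
by rewrite invfM.
Unshelve. all: by end_near. Qed.

Lemma cutoff_cvg a b t : `]a, b[%classic t -> cutoff a b n t @[n --> \oo] --> (1 : R).
Proof.
rewrite /= in_itv/= => /andP[at_ tb]; rewrite -[X in _ --> X]mulr1.
by apply: cvgM; apply: flat0_cvg; rewrite subr_gt0.
Qed.

Definition bump_fun f := smooth f /\ exists a : R, forall t, a <= `|t| -> f t = 0.

Lemma cutoff_bump_fun a b n : bump_fun (cutoff a b n).
Proof.
split; first exact: smooth_cutoff.
exists (`|a| + `|b|) => t ht; apply: cutoff_out; rewrite /= in_itv/= => /andP[h1 h2].
have := ler_norm b; have := ler_norm (- a); rewrite normrN.
have := normr_ge0 a; have := normr_ge0 b.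
by case: (ger0P t) ht => *; lra.
Qed.

Lemma bump_fun_bounded f : bump_fun f -> exists2 C : R, 0 <= C & forall t, `|f t| <= C.
Proof.
move=> [sf [a fa]].
have cf : {within `[- `|a|, `|a|], continuous (fun t => `|f t|)}.
  apply: continuous_subspaceT => x; apply: cvg_norm; exact: (smooth_continuous sf).
have [|c _ fc] := EVT_max _ cf; first by rewrite ge0_cp.
exists `|f c| => // t; have [ta|ta] := leP a `|t|; first by rewrite fa ?normr0.
apply: fc; rewrite in_itv/= -ler_norml.
exact: le_trans (ltW ta) (ler_norm _).
Qed.

Lemma bump_fun_derive f : bump_fun f -> exists2 f' : R -> R,
  (forall x : R, is_derive x 1 f (f' x)) & bump_fun f'.
Proof.
move=> [sf [a fa]]; have [f' df sf'] := smooth_derive sf.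
exists f' => //; split => //; exists (`|a| + 1) => t ta.
have h : is_derive t 1 f 0.
  apply: (@near_eq_is_derive _ _ _ (fun _ : R => 0 : R)).
    near=> u; rewrite fa//.
    have : `|t - u| < 1 by near: u; exact: (nbhsx_ballx t 1 ltr01).
    have := ler_norm a; have := ler_distD u t 0; rewrite !subr0.
    by move: ta => *; lra.
by rewrite -(@derive_val _ _ _ _ _ _ _ (df t)) (@derive_val _ _ _ _ _ _ _ h).
Unshelve. all: by end_near. Qed.

End smooth1.

Section primitive.
Context {R : realType}.
Implicit Types f g : R -> R.
Local Notation leb := (@lebesgue_measure R).

Lemma lebesgue_segment_fin (a b : R) : (leb `[a, b]%classic < +oo)%E.
Proof. by rewrite lebesgue_measure_itv/=; case: ifP => // _; rewrite ltry. Qed.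

Lemma bump_fun_integrable f : bump_fun f -> leb.-integrable [set: R] (EFin \o f).
Proof.
move=> bf; have [C C0 fC] := bump_fun_bounded bf; have [sf [a fa]] := bf.
have mf : measurable_fun [set: R] f.
  exact: continuous_measurable_fun (smooth_continuous sf).
apply: (@le_integrable_real _ _ _ leb f (fun t => C * \1_(`[- `|a|, `|a|]) t) mf) => //.
  apply: integrable_cst_indic => //.
  exact: lebesgue_segment_fin.
move=> t; rewrite indicE; have [ta|ta] := boolP (t \in `[- `|a|, `|a|]%classic).
  by rewrite mulr1.
rewrite mulr0 fa ?normr0//.
move: ta; rewrite notin_setE/= in_itv/= => /negP; rewrite -ler_norml -ltNge.
by move=> /ltW; apply: le_trans; exact: ler_norm.
Qed.

(** The average zeta is H t - H (t - h) for a primitive H of f. It is again a bump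
function, and its derivative is a difference of two values of f: used as a test
function, it turns a weak derivative into a translation. *)
Lemma bump_fun_window f (h : R) : bump_fun f -> 0 < h ->
  exists zeta : R -> R, [/\ bump_fun zeta,
    forall t : R, is_derive t 1 zeta (f t - f (t - h)) &
    forall t, (\int[leb]_(s in `[0%R, h]) (f (t - s))%:E = (zeta t)%:E)%E].
Proof.
move=> bf h0; have [sf [a fa]] := bf.
have intf := bump_fun_integrable bf.
pose F (x : R) := \int[leb]_(t in `]-oo, x]) f t.
have dF (x : R) : is_derive x 1 F (f x).
  have [|||dF F'] := @continuous_FTC1 R f -oo%O x (x + 1) (ltr_pwDr ltr01 (lexx x)).
  - by apply: integrableS intf.
  - by rewrite ltNyr.
  - exact: (smooth_continuous sf).
  by split => //; rewrite -derive1E.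
pose zeta t := F t - F (t - h).
have dz (t : R) : is_derive t 1 zeta (f t - f (t - h)).
  have d2 : is_derive t 1 (fun u => F (1 * u + (- h))) (1 * f (t - h)).
    by apply: is_derive1_affine; rewrite mul1r; exact: dF.
  have := is_deriveB (dF t) d2; rewrite mul1r.
  by under [X in F - X]eq_fun do rewrite mul1r.
have sz : smooth zeta.
  case=> [|n]; first exact: is_derive1_continuous dz.
  exists (fun t => f t - f (t - h)) => //.
  have -> : (fun t => f t - f (t - h)) = (fun t => f t + (-1) * f (1 * t + (- h))).
    by apply/funext => t; rewrite mul1r mulN1r.
  apply: smoothnD => //; apply: smoothnM; first exact: smoothn_cst.
  exact: smoothn_affine.
have zE t : (\int[leb]_(s in `[0%R, h]) (f (t - s))%:E = (zeta t)%:E)%E.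
  have dG (s : R) : is_derive s 1 (fun u => - F (- 1 * u + t)) (f (t - s)).
    have := @is_derive1_affine _ F (f (t - s)) (- 1) t s.
    rewrite mulN1r addrC => /(_ (dF _)) d1.
    by have := is_deriveN d1; rewrite mulN1r opprK.
  rewrite (continuous_FTC2 (F := fun u => - F (- 1 * u + t)))//.
  - by rewrite -EFinB /zeta mulr0 add0r opprK mulN1r addrC [- h + t]addrC.
  - apply: continuous_subspaceT => x.
    have := @smoothn_affine _ 0 f (- 1) t (sf 0%N) x.
    by under eq_fun do rewrite mulN1r addrC.
  - split.
    + by move=> x _; have [] := dG x.
    + by apply: cvg_at_right_filter; exact: (is_derive1_continuous dG).
    + by apply: cvg_at_left_filter; exact: (is_derive1_continuous dG).
  - by move=> x _; rewrite derive1E (@derive_val _ _ _ _ _ _ _ (dG x)).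
exists zeta; split => //; split => //; exists (`|a| + h) => t th.
apply/EFin_inj; rewrite -zE; apply: integral0_eq => s /=.
rewrite in_itv/= => /andP[s0 sh]; rewrite fa//.
have := ler_distD s t 0; rewrite !subr0 (ger0_norm s0).
by have := ler_norm a; lra.
Qed.

End primitive.

(** * Products of one-variable functions as test functions *)

Section tensor.
Context {R : realType} {d : nat}.
Local Notation E := 'rV[R]_d.
Local Notation mu := (@lebesgue_rV R d).
Implicit Types (h : 'I_d -> R -> R) (j : 'I_d).

Definition tensor h (x : E) : R := \prod_(k < d) h k (x ord0 k).

(** Differentiation and averaging in direction j act on a product of one-variable
functions by changing its j-th factor. *)
Definition set_factor h j (g : R -> R) : 'I_d -> R -> R :=
  fun k => if k == j then g else h k.

Lemma tensor_set_factor h j g x :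
  tensor (set_factor h j g) x = (\prod_(k < d | k != j) h k (x ord0 k)) * g (x ord0 j).
Proof.
rewrite /tensor (bigD1 j)//= /set_factor eqxx mulrC; congr (_ * _).
by apply: eq_bigr => k /negbTE ->.
Qed.

Lemma set_factor_id h j : set_factor h j (h j) = h.
Proof. by apply/funext => k; rewrite /set_factor; case: eqP => [->|]. Qed.

Lemma tensorE h j x :
  tensor h x = (\prod_(k < d | k != j) h k (x ord0 k)) * h j (x ord0 j).
Proof. by rewrite -tensor_set_factor set_factor_id. Qed.

(** The difference quotient in direction j is that of the j-th factor, times the
product of the other factors. *)
Lemma is_derive_tensor h j (g : R -> R) :
  (forall t : R, is_derive t 1 (h j) (g t)) ->
  forall x : E, is_derive x (basis_rV j) (tensor h) (tensor (set_factor h j g) x).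
Proof.
move=> dh x.
have [dd dv] := dh (x ord0 j).
have cv : s^-1 *: (tensor h (s *: basis_rV j + x) - tensor h x) @[s --> 0^']
    --> tensor (set_factor h j g) x.
  have c1 : s^-1 *: (h j (s *: 1 + x ord0 j) - h j (x ord0 j)) @[s --> 0^']
      --> g (x ord0 j).
    by rewrite -dv; exact: dd.
  set P := \prod_(k < d | k != j) h k (x ord0 k).
  have c2 : P * (s^-1 *: (h j (s *: 1 + x ord0 j) - h j (x ord0 j))) @[s --> 0^']
      --> P * g (x ord0 j).
    by apply: cvgM; [exact: cvg_cst|exact: c1].
  rewrite tensor_set_factor; apply: cvg_trans c2; apply: near_eq_cvg.
  near=> s; rewrite /= (tensorE _ j x) (tensorE _ j (_ + _)).
  have -> : \prod_(k < d | k != j) h k ((s *: basis_rV j + x) ord0 k) =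
      P.
    by apply: eq_bigr => k /negbTE kj; rewrite !mxE eqxx/= kj mulr0 add0r.
  rewrite -/P !mxE !eqxx /= /GRing.scale/= mulr1; ring.
by split; [apply/cvg_ex; exists (tensor (set_factor h j g) x)|apply/cvg_lim].
Unshelve. all: by end_near. Qed.

Lemma continuous_tensor h : (forall k, continuous (h k)) -> continuous (tensor h).
Proof.
move=> ch; rewrite /tensor; elim: (index_enum _) => [|k s IH].
  rewrite (_ : (fun _ => _) = cst 1); first exact: cst_continuous.
  by apply/funext => x; rewrite big_nil.
rewrite (_ : (fun _ => _) =
    (fun x : E => h k (x ord0 k) * \prod_(l <- s) h l (x ord0 l))); last first.
  by apply/funext => x; rewrite big_cons.
move=> x; apply: (@cvgM _ _ (nbhs x) _ (fun y : E => h k (y ord0 k))); last exact: IH.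
by apply: continuous_cvg; [exact: ch|exact: coord_continuous].
Qed.

Lemma Ck_tensor n h : (forall k, smooth (h k)) -> Ck n (tensor h).
Proof.
elim: n h => [|n IH] h sh /=.
  by apply: continuous_tensor => k; exact: smooth_continuous.
split; first by apply: continuous_tensor => k; exact: smooth_continuous.
move=> j; have [g dg sg] := smooth_derive (sh j).
have D := is_derive_tensor dg; split.
  by move=> x; have [] := D x.
have -> : (fun x => 'D_(basis_rV j) (tensor h) x) = tensor (set_factor h j g).
  by apply/funext => x; rewrite (@derive_val _ _ _ _ _ _ _ (D x)).
by apply: IH => k; rewrite /set_factor; case: ifP.
Qed.

Lemma bump_fun_support h : (forall k, bump_fun (h k)) ->
  exists2 a : R, 0 <= a & forall k t, a <= `|t| -> h k t = 0.
Proof.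
move=> bh; have /choice[a ha] : forall k, exists a : R, forall t, a <= `|t| -> h k t = 0.
  by move=> k; have [] := bh k.
exists (\sum_k `|a k|); first exact: sumr_ge0.
move=> k t st; apply: ha; apply: le_trans st.
rewrite (bigD1 k)//=; apply: (le_trans (ler_norm _)); rewrite lerDl.
exact: sumr_ge0.
Qed.

Lemma tensor_test h : (forall k, bump_fun (h k)) -> test_function (tensor h).
Proof.
move=> bh; split; first by move=> n; apply: Ck_tensor => k; have [] := bh k.
have [a a0 ha] := bump_fun_support bh.
have cB : compact [set x : E | forall k : 'I_d, `[- a, a]%classic (x ord0 k)].
  by apply: (@rV_compact R d (fun=> `[- a, a]%classic)) => k; exact: segment_compact.
apply: (subclosed_compact _ cB); first exact: closed_closure.
rewrite [X in _ `<=` X](closure_id _).1; last first.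
  by apply: compact_closed cB; exact: norm_hausdorff.
apply: closure_subset => x /= /eqP hx k; apply: contrapT => nk; apply: hx.
rewrite (tensorE _ k) ha ?mulr0//.
by move: nk; rewrite /= in_itv/= => /negP; rewrite -ler_norml -ltNge => /ltW.
Qed.

Lemma measurable_tensor h : (forall k, continuous (h k)) ->
  measurable_fun [set: E] (tensor h).
Proof.
move=> ch; apply: measurable_prod => k _.
apply: measurableT_comp (measurable_coord k).
exact: continuous_measurable_fun.
Qed.

(** Domination by a multiple of the indicator of a cube is what makes products with
square integrable functions integrable. *)
Lemma tensor_bounded h : (forall k, bump_fun (h k)) ->
  exists C : R, exists n : nat, forall x, `|tensor h x| <= C * \1_(cube n) x.
Proof.
move=> bh; have [a a0 ha] := bump_fun_support bh.
have /choice[C hC] : forall k, exists C : R, forall t, `|h k t| <= C.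
  by move=> k; have [C _ ?] := bump_fun_bounded (bh k); exists C.
exists (\prod_k C k), (Num.truncn a).+1 => x; rewrite indicE.
have [xc|] := boolP (x \in _).
  by rewrite mulr1 normr_prod; apply: ler_prod => k _; rewrite normr_ge0 hC.
rewrite notin_setE mulr0 => /existsNP[k].
rewrite /= in_itv/= -ltr_norml => /negP; rewrite -leNgt => nk.
rewrite (tensorE _ k) ha ?mulr0 ?normr0//; apply: le_trans nk.
exact: ltW (truncnS_gt _).
Qed.

Definition sq_integrable (w : E -> R) :=
  measurable_fun [set: E] w /\
  mu.-integrable [set: E] (fun x => (w x ^+ 2)%:E).

Lemma cube_fin n : (mu (cube n) < +oo)%E.
Proof. exact: obox_fin. Qed.

Lemma sq_integrable_tensor h w : (forall k, bump_fun (h k)) -> sq_integrable w ->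
  mu.-integrable [set: E] (fun x => (w x * tensor h x)%:E).
Proof.
move=> bh [mw iw]; have [C [n hC]] := tensor_bounded bh.
have mt : measurable_fun [set: E] (tensor h).
  by apply: measurable_tensor => k; have [/smooth_continuous] := bh k.
apply: (le_integrable_real (g := fun x => w x ^+ 2 + C ^+ 2 * \1_(cube n) x)).
- exact: measurable_funM.
- rewrite [X in integrable _ _ X](_ : _ =
     (fun x => (w x ^+ 2)%R%:E + (C ^+ 2 * \1_(cube n) x)%R%:E)%E)//.
  apply: integrableD => //; apply: integrable_cst_indic; last exact: cube_fin.
  exact: measurable_cube.
- move=> x.
  have h1 : C ^+ 2 * \1_(cube n) x = (C * \1_(cube n) x) ^+ 2.
    by rewrite indicE; case: (_ \in _); rewrite ?mulr1// !mulr0 expr0n.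
  rewrite h1 normrM; have hx := hC x.
  have : `|tensor h x| ^+ 2 <= (C * \1_(cube n) x) ^+ 2.
    by rewrite lerXn2r ?nnegrE// (le_trans _ hx).
  rewrite -(real_normK (num_real (w x))).
  set A := `|w x|; set B := `|tensor h x|.
  have : 0 <= (A - B) ^+ 2 by exact: sqr_ge0.
  have : 0 <= A ^+ 2 by exact: sqr_ge0.
  have : 0 <= B ^+ 2 by exact: sqr_ge0.
  rewrite sqrrB; lra.
Qed.

End tensor.

(** * The fundamental lemma of the calculus of variations *)

Section density.
Local Open Scope ereal_scope.
Context d (T : measurableType d) {R : realType} (mu : {measure set T -> \bar R}).
Variables (D : set T) (g : T -> \bar R).
Hypotheses (mD : measurable D) (mg : measurable_fun D g) (g0 : forall x, 0 <= g x).

(** The restriction to D leaves a finite measure when g is integrable on D, as is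
needed to compare two such measures on boxes. *)
Definition density_on (A : set T) : \bar R := \int[mu]_(x in A `&` D) g x.

Let density_on0 : density_on set0 = 0.
Proof. by rewrite /density_on set0I integral_set0. Qed.

Let density_on_ge0 A : 0 <= density_on A.
Proof. by apply: integral_ge0. Qed.

Let density_on_sigma_additive : semi_sigma_additive density_on.
Proof.
move=> F mF tF mUF; rewrite /density_on setI_bigcupl.
rewrite ge0_integral_bigcup//.
- apply: is_cvg_ereal_nneg_natsum_cond => n _ _; exact: integral_ge0.
- by move=> k; exact: measurableI.
- apply: measurable_funS mg => //.
  by rewrite -setI_bigcupl; exact: subIsetr.
- exact: trivIset_setIr.
Qed.

HB.instance Definition _ := isMeasure.Build _ _ _ density_on
  density_on0 density_on_ge0 density_on_sigma_additive.

Definition density_measure : {measure set T -> \bar R} := density_on.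

End density.

Section fundamental.
Context {R : realType} {d : nat}.
Local Notation E := 'rV[R]_d.
Local Notation mu := (@lebesgue_rV R d).
Implicit Types (h : 'I_d -> R -> R) (w : E -> R).

Lemma sq_integrable_indic w A : sq_integrable w -> measurable A ->
  (mu A < +oo)%E -> mu.-integrable [set: E] (fun x => (w x ^+ 2 + 1 * \1_A x)%:E).
Proof.
move=> [mw iw] mA fA.
rewrite [X in integrable _ _ X](_ : _ =
  (fun x => (w x ^+ 2)%R%:E + (1 * \1_A x)%R%:E)%E)//.
by apply: integrableD => //; exact: integrable_cst_indic.
Qed.

(** This makes square integrable functions integrable on sets of finite
measure. *)
Lemma normr_le_sqrD1 (t : R) : `|t| <= t ^+ 2 + 1.
Proof.
rewrite -(real_normK (num_real t)); set A := `|t|.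
have : 0 <= (A - 1 / 2) ^+ 2 by exact: sqr_ge0.
by rewrite !expr2; lra.
Qed.

Lemma sq_integrable_locally w A : sq_integrable w -> measurable A ->
  (mu A < +oo)%E -> mu.-integrable A (EFin \o w).
Proof.
move=> sw mA fA; have [mw _] := sw.
apply: (le_integrable mA _ _ (integrableS measurableT mA _
  (sq_integrable_indic sw mA fA))) => //.
  by apply/measurable_EFinP; exact: measurable_funS mw.
move=> x Ax /=; rewrite lee_fin indicE mem_set// mulr1.
by rewrite (le_trans (normr_le_sqrD1 _))// ler_norm.
Qed.

(** The products of the cutoff functions of the sides converge to the indicator of
the box, and w^2 plus this indicator dominates. *)
Lemma integral_obox_eq0 w a b : sq_integrable w ->
  (forall h, (forall k, bump_fun (h k)) -> (forall k t, 0 <= h k t) ->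
     (\int[mu]_x (w x * tensor h x)%:E = 0)%E) ->
  (\int[mu]_(x in obox a b) (w x)%:E = 0)%E.
Proof.
move=> sw w0; have [mw iw] := sw.
pose h n k := cutoff (a k) (b k) n.
have bh n k : bump_fun (h n k) by exact: cutoff_bump_fun.
have mt n : measurable_fun [set: E] (tensor (h n)).
  by apply: measurable_tensor => k; have [/smooth_continuous] := bh n k.
have mo := measurable_obox a b.
have ho n x : ~ obox a b x -> tensor (h n) x = 0.
  by move=> /existsNP[k xk]; rewrite (tensorE _ k) /h cutoff_out ?mulr0.
have [] := @dominated_convergence _ E R mu _ measurableT
  (fun n x => (w x * tensor (h n) x)%:E) (fun x => (w x * \1_(obox a b) x)%:E)
  (fun x => (w x ^+ 2 + 1 * \1_(obox a b) x)%:E).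
- by move=> n; apply/measurable_EFinP; exact: measurable_funM.
- apply/measurable_EFinP; apply: measurable_funM => //; exact: measurable_indic.
- apply: aeW => x _; apply: cvg_EFin; first exact: nearW.
  apply: cvgM; first exact: cvg_cst.
  rewrite indicE; have [/set_mem xo|] := boolP (x \in _); last first.
    rewrite notin_setE => xo; under eq_fun do rewrite ho//.
    exact: cvg_cst.
  suff H s : \prod_(k <- s) h n k (x ord0 k) @[n --> \oo] --> (1 : R) by exact: H.
  elim: s => [|k s IH].
    rewrite (_ : (fun _ => _) = cst 1); first exact: cvg_cst.
    by apply/funext => n; rewrite big_nil.
  rewrite (_ : (fun _ => _) = (fun n => h n k (x ord0 k) *
      \prod_(l <- s) h n l (x ord0 l))); last by apply/funext => n; rewrite big_cons.
  rewrite -[X in _ --> X]mulr1; apply: cvgM => //.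
  by apply: cutoff_cvg; exact: xo.
- exact: sq_integrable_indic sw mo (obox_fin _ _).
- apply: aeW => x n _; rewrite lee_fin indicE.
  have [xo|] := boolP (x \in _); last first.
    by rewrite notin_setE => xo; rewrite ho// !mulr0 normr0 addr0 sqr_ge0.
  rewrite mulr1 (le_trans _ (normr_le_sqrD1 _))// normrM ler_piMr//.
  rewrite ger0_norm; last by apply: prodr_ge0 => k _; exact: cutoff_ge0.
  by apply: prodr_ile1 => k _; rewrite cutoff_ge0 cutoff_le1.
move=> _ _ cv.
have -> : (\int[mu]_(x in obox a b) (w x)%:E =
    \int[mu]_x (w x * \1_(obox a b) x)%:E)%E.
  rewrite integral_mkcond; apply: eq_integral => x _.
  rewrite patchE indicE; case: ifP => _; by rewrite ?mulr1 ?mulr0.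
apply: cvg_unique cv _ => //.
rewrite (_ : (fun _ => _) = cst 0%E); first exact: cvg_cst.
by apply/funext => n; rewrite /= w0// => k t; exact: cutoff_ge0.
Qed.

(** The integral of w vanishes on every box, so the positive and negative parts of
w define measures that agree on boxes, hence on all Borel subsets of a cube;
thus w = 0 almost everywhere on each cube. *)
Lemma sq_integrable_ae0 w : sq_integrable w ->
  (forall h, (forall k, bump_fun (h k)) -> (forall k t, 0 <= h k t) ->
     (\int[mu]_x (w x * tensor h x)%:E = 0)%E) ->
  {ae mu, forall x, w x = 0}.
Proof.
move=> sw w0; have [mw iw] := sw.
suff : {ae mu, forall x, forall n, cube n x -> (w x)%:E = 0%E}.
  apply: filterS => x hx; have : [set: E] x by [].
  by rewrite -bigcup_cube => -[n _ /hx[]].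
apply: ae_foralln => n; have mD := @measurable_cube R d n.
have iD := sq_integrable_locally sw mD (cube_fin n).
have mD' : measurable_fun (cube n) (EFin \o w).
  by apply/measurable_EFinP; exact: measurable_funS mw.
have f0 (f : E -> \bar R) : forall x, (0 <= f^\+ x)%E by exact: funepos_ge0.
have g0 (f : E -> \bar R) : forall x, (0 <= f^\- x)%E by exact: funeneg_ge0.
pose mp : {measure set E -> \bar R} :=
  density_measure mu mD
    (measurable_funepos mD') (f0 _).
pose mn : {measure set E -> \bar R} :=
  density_measure mu mD
    (measurable_funeneg mD') (g0 _).
have iS A : measurable A -> A `<=` cube n -> mu.-integrable A (EFin \o w).
  by move=> mA AD; exact: integrableS iD.
have E0 A : measurable A -> A `<=` cube n ->
    (\int[mu]_(x in A) (w x)%:E = 0)%E <->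
    (\int[mu]_(x in A) (EFin \o w)^\+ x = \int[mu]_(x in A) (EFin \o w)^\- x)%E.
  move=> mA AD.
  have fp := integrable_pos_fin_num mA (iS A mA AD).
  have fn := integrable_neg_fin_num mA (iS A mA AD).
  rewrite integralE; split => [|->]; last by rewrite subee.
  by rewrite -(fineK fp) -(fineK fn) -EFinB => -[/eqP]; rewrite subr_eq0 => /eqP ->.
have mpn A : measurable A -> mp A = mn A.
  apply: rV_measure_unique => [a b|k].
    rewrite /mp /mn /= /density_on; apply/E0.
    + by apply: measurableI => //; exact: measurable_obox.
    + by move=> x [].
    have : oboxes (obox a b `&` cube n).
      apply: oboxes_setI_closed; last exact: cube_oboxes.
      by exists a, b.
    by move=> [a' [b' ->]]; exact: integral_obox_eq0.
  rewrite /mp /= /density_on.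
  have mk : measurable (cube k `&` cube n : set E).
    by apply: measurableI => //; exact: measurable_cube.
  have := integrable_pos_fin_num mk (iS _ mk (@subIsetr _ _ _)).
  by rewrite ge0_fin_numE//; exact: integral_ge0.
apply: (integral_ae_eq mD iD) => // A AD mA.
rewrite integral0; apply/E0 => //.
by have := mpn A mA; rewrite /mp /mn /= /density_on (setIidl AD).
Qed.

End fundamental.

(** * Averages along a segment *)

Section window.
Context {R : realType} {d : nat}.
Local Notation E := 'rV[R]_d.
Local Notation mu := (@lebesgue_rV R d).
Local Notation leb := (@lebesgue_measure R).
Implicit Types (u g f T : E -> R).

Lemma integral_shift (y : E) (f : E -> \bar R) : measurable_fun [set: E] f ->
  (\int[mu]_x f (x + y)%R = \int[mu]_x f x)%E.
Proof.
move=> mf; rewrite [LHS]integralE [RHS]integralE; congr (_ - _)%E.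
- rewrite -(ge0_integral_shift y (measurable_funepos mf)); last first.
    by move=> x; exact: funepos_ge0.
  by apply: eq_integral => x _; rewrite !funeposE.
- rewrite -(ge0_integral_shift y (measurable_funeneg mf)); last first.
    by move=> x; exact: funeneg_ge0.
  by apply: eq_integral => x _; rewrite !funenegE.
Qed.

Lemma sq_integrable_shift u (y : E) : sq_integrable u ->
  sq_integrable (fun x => u (x + y)).
Proof.
move=> [mu_ iu]; split; first exact: measurableT_comp mu_ (measurable_shift y).
have mu2 : measurable_fun [set: E] (fun x => (u x ^+ 2)%:E).
  by apply/measurable_EFinP; exact: measurable_funX.
apply/integrableP; split.
  exact: (measurableT_comp mu2 (measurable_shift y)).
move/integrableP : iu => [_]; congr (_ < _)%E.
rewrite -(ge0_integral_shift y (f := fun x => `|(u x ^+ 2)%:E|%E))//.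
exact: measurableT_comp.
Qed.

Variable e : E.

Lemma measurable_line : measurable_fun [set: E * R] (fun z : E * R => z.1 + z.2 *: e).
Proof.
apply/measurable_fun_rVP => i; under eq_fun do rewrite !mxE.
apply: measurable_funD.
  exact: (measurableT_comp (measurable_coord i) measurable_fst).
apply: measurable_funM => //; exact: measurable_snd.
Qed.

(** Exchange the integrals, translate by t e, and exchange back. Moving the
average from f to T is the measure-theoretic form of the adjunction between
translation by t e and by - t e. *)
Lemma tonelli_window (f T : E -> R) (D : set R) : measurable D ->
  measurable_fun [set: E] f -> measurable_fun [set: E] T ->
  (forall x, 0 <= f x) -> (forall x, 0 <= T x) ->
  (\int[mu]_x \int[leb]_t (f (x + t *: e) * T x * \1_D t)%:E =
   \int[mu]_x \int[leb]_t (f x * T (x - t *: e) * \1_D t)%:E)%E.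
Proof.
move=> mD mf mT f0 T0.
have ml := measurable_line.
have ml' : measurable_fun [set: E * R] (fun z : E * R => z.1 - z.2 *: e).
  apply/measurable_fun_rVP => i; under eq_fun do rewrite !mxE -mulNr.
  apply: measurable_funD.
    exact: (measurableT_comp (measurable_coord i) measurable_fst).
  apply: measurable_funM => //; apply: measurableT_comp => //; exact: measurable_snd.
have mi : measurable_fun [set: E * R] (fun z : E * R => \1_D z.2 : R).
  by apply: measurableT_comp => //; exact: measurable_snd.
rewrite (fubini_tonelli (m1 := mu) (m2 := leb)
   (fun z : E * R => (f (z.1 + z.2 *: e) * T z.1 * \1_D z.2)%:E)); first last.
- by move=> z; rewrite lee_fin !mulr_ge0.
- apply/measurable_EFinP; apply: measurable_funM => //; apply: measurable_funM.
    exact: (measurableT_comp mf ml).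
  exact: (measurableT_comp mT measurable_fst).
rewrite (fubini_tonelli (m1 := mu) (m2 := leb)
   (fun z : E * R => (f z.1 * T (z.1 - z.2 *: e) * \1_D z.2)%:E)); first last.
- by move=> z; rewrite lee_fin !mulr_ge0.
- apply/measurable_EFinP; apply: measurable_funM => //; apply: measurable_funM.
    exact: (measurableT_comp mf measurable_fst).
  exact: (measurableT_comp mT ml').
apply: eq_integral => t _ /=.
rewrite -(ge0_integral_shift (t *: e)
   (f := fun x => (f x * T (x - t *: e) * \1_D t)%:E)).
- by apply: eq_integral => x _; rewrite addrK.
- apply/measurable_EFinP; apply: measurable_funM => //; apply: measurable_funM => //.
  exact: (measurableT_comp mT (measurable_shift _)).
- by move=> x; rewrite lee_fin !mulr_ge0.
Qed.

Variables (s : R) (s0 : 0 < s).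
Let D := `[0, s]%classic.

(** Written with an indicator over the whole line so that Fubini's theorem applies. *)
Definition window f x : \bar R := \int[leb]_t (f (x + t *: e) * \1_D t)%:E.

Let mD : measurable D. Proof. exact: measurable_itv. Qed.

Let mline x : measurable_fun [set: R] (fun t : R => x + t *: e).
Proof.
apply/measurable_fun_rVP => i; under eq_fun do rewrite !mxE.
by apply: measurable_funD => //; apply: measurable_funM.
Qed.

Lemma window_ge0 f x : (forall x, 0 <= f x) -> (0 <= window f x)%E.
Proof. by move=> f0; apply: integral_ge0 => t _; rewrite lee_fin mulr_ge0. Qed.

Lemma measurable_window f : measurable_fun [set: E] f -> (forall x, 0 <= f x) ->
  measurable_fun [set: E] (window f).
Proof.
move=> mf f0.
apply: (measurable_fun_fubini_tonelli_F (m2 := leb)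
   (fun z : E * R => (f (z.1 + z.2 *: e) * \1_D z.2)%:E)).
- apply/measurable_EFinP; apply: measurable_funM.
    exact: (measurableT_comp mf measurable_line).
  by apply: measurableT_comp => //; exact: measurable_snd.
- by move=> z; rewrite lee_fin mulr_ge0.
Qed.

Lemma leb_D : leb D = s%:E.
Proof. by rewrite /D lebesgue_measure_itv/= lte_fin s0 oppr0 addr0. Qed.

Lemma integral_window f T : measurable_fun [set: E] f -> measurable_fun [set: E] T ->
  (forall x, 0 <= f x) -> (forall x, 0 <= T x) ->
  (\int[mu]_x (window f x * (T x)%:E) =
   \int[mu]_x ((f x)%:E * \int[leb]_(t in D) (T (x - t *: e))%:E))%E.
Proof.
move=> mf mT f0 T0.
transitivity (\int[mu]_x \int[leb]_t (f (x + t *: e) * T x * \1_D t)%:E)%E.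
  apply: eq_integral => x _; rewrite /window -ge0_integralZr//.
  - by apply: eq_integral => t _; rewrite -EFinM; congr EFin; ring.
  - apply/measurable_EFinP; apply: measurable_funM => //.
    exact: (measurableT_comp mf (mline x)).
  - by move=> t _; rewrite lee_fin mulr_ge0.
  - by rewrite lee_fin.
rewrite tonelli_window//; apply: eq_integral => x _.
have mT' : measurable_fun [set: R] (fun t => T (x - t *: e)).
  apply: (measurableT_comp mT).
  apply/measurable_fun_rVP => i; under eq_fun do rewrite !mxE -mulNr.
  by apply: measurable_funD => //; apply: measurable_funM => //; exact: measurableT_comp.
rewrite -ge0_integralZl//.
- rewrite [RHS]integral_mkcond; apply: eq_integral => t _; rewrite patchE indicE.
  by case: ifP => _; rewrite ?mulr1 ?mulr0 ?EFinM.
- by apply: measurable_funTS; exact/measurable_EFinP.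
- by move=> t _; rewrite lee_fin.
- by rewrite lee_fin.
Qed.

Lemma integral_window1 f : measurable_fun [set: E] f -> (forall x, 0 <= f x) ->
  (\int[mu]_x window f x = s%:E * \int[mu]_x (f x)%:E)%E.
Proof.
move=> mf f0.
have := integral_window mf (measurable_cst (1 : R)) f0 (fun=> ler01).
under eq_integral do rewrite mule1.
move=> ->; rewrite -ge0_integralZl//; last 3 first.
- exact/measurable_EFinP.
- by move=> x _; rewrite lee_fin.
- by rewrite lee_fin ltW.
have I1 : (\int[leb]_(t in D) (1 : R)%:E = s%:E)%E.
  by have := integral_cst leb mD (1 : R)%:E; rewrite mul1e => ->; exact: leb_D.
by apply: eq_integral => x _; rewrite I1 muleC.
Qed.

(** Cauchy-Schwarz on [0, s], obtained by integrating 2 c f <= c^2 + f^2 and taking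
c = (window f x) / s. The second part lets finiteness be inherited from the
average of f^2. *)
Lemma window_sq f x : measurable_fun [set: E] f -> (forall x, 0 <= f x) ->
  ((fine (window f x) ^+ 2)%:E <= s%:E * window (fun y => f y ^+ 2)%R x)%E /\
  (window (fun y => f y ^+ 2)%R x < +oo -> window f x < +oo)%E.
Proof.
move=> mf f0.
have [K|] := ltP (window (fun y => f y ^+ 2)%R x) +oo%E; last first.
  rewrite leye_eq => /eqP ->; split => //.
  by rewrite gt0_muley ?lte_fin// leey.
pose F t := f (x + t *: e) * \1_D t.
have mF : measurable_fun [set: R] F.
  by apply: measurable_funM => //; exact: (measurableT_comp mf (mline x)).
have F0 t : 0 <= F t by rewrite mulr_ge0.
have F2 t : f (x + t *: e) ^+ 2 * \1_D t = F t ^+ 2.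
  by rewrite /F indicE; case: (_ \in _); rewrite ?mulr1// !mulr0 expr0n.
have mF2 : measurable_fun [set: R] (fun t => F t ^+ 2) by exact: measurable_funX.
have W2 : window (fun y => f y ^+ 2)%R x = (\int[leb]_t (F t ^+ 2)%:E)%E.
  by apply: eq_integral => t _; rewrite F2.
have bound (c : R) : 0 <= c ->
    ((2 * c)%:E * window f x <= (c ^+ 2 * s)%:E + window (fun y => f y ^+ 2)%R x)%E.
  move=> c0; rewrite W2.
  have -> : (c ^+ 2 * s)%:E = (\int[leb]_t (c ^+ 2 * \1_D t)%:E)%E.
    under eq_integral do rewrite EFinM.
    rewrite ge0_integralZl ?lee_fin ?sqr_ge0//; last first.
      by apply/measurable_EFinP; exact: measurable_indic.
    by rewrite integral_indic// setIT EFinM; congr (_ * _)%E; exact/esym/leb_D.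
  rewrite -ge0_integralD//; last 4 first.
  - by move=> t _; rewrite lee_fin mulr_ge0// sqr_ge0.
  - by apply/measurable_EFinP; apply: measurable_funM => //; exact: measurable_indic.
  - by move=> t _; rewrite lee_fin sqr_ge0.
  - exact/measurable_EFinP.
  rewrite /window -ge0_integralZl//; last 3 first.
  - exact/measurable_EFinP.
  - by move=> t _; rewrite lee_fin F0.
  - by rewrite lee_fin mulr_ge0.
  apply: ge0_le_integral => //.
  - by move=> t _; rewrite -EFinM lee_fin !mulr_ge0//; exact: F0.
  - by apply/measurable_EFinP; apply: measurable_funM => //.
  - apply/measurable_EFinP; apply: measurable_funD => //.
    by apply: measurable_funM => //; exact: measurable_indic.
  move=> t _; rewrite -EFinM -EFinD lee_fin -/(F t).
  have -> : F t = F t * \1_D t.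
    by rewrite /F indicE; case: (_ \in _); rewrite ?mulr1// !mulr0.
  rewrite indicE; case: (_ \in _); rewrite ?mulr1 ?mulr0 ?expr0n/= ?addr0//.
  have : 0 <= (c - F t) ^+ 2 by exact: sqr_ge0.
  by rewrite sqrrB; lra.
have Kfin : window (fun y => f y ^+ 2)%R x \is a fin_num.
  by rewrite ge0_fin_numE//; apply: window_ge0 => y; exact: sqr_ge0.
have Wfin : (window f x < +oo)%E.
  have := bound 1 ler01; rewrite -(fineK Kfin) -EFinD.
  have := window_ge0 x f0; case: (window f x) => [r||] _ //=; first by rewrite ltry.
  by rewrite gt0_muley ?lte_fin ?mulr1// leye_eq.
split => // ; move: bound.
have := window_ge0 x f0; case: (window f x) Wfin => // r _; rewrite lee_fin => r0 /=.
move/(_ (r / s)); rewrite divr_ge0 ?(ltW s0)// => /(_ isT).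
rewrite -(fineK Kfin) -!EFinM -EFinD !lee_fin.
have sn : s != 0 by rewrite gt_eqF.
rewrite -(ler_pM2l s0) => h; rewrite -[r ^+ 2]addr0.
have : s * (2 * (r / s) * r) = 2 * r ^+ 2 by field.
have : s * ((r / s) ^+ 2 * s + fine (window (fun y => f y ^+ 2)%R x)) =
  r ^+ 2 + s * fine (window (fun y => f y ^+ 2)%R x) by field.
by move=> h1 h2; move: h; rewrite h1 h2; lra.
Qed.

End window.

(** * Translation estimate for a weak partial derivative *)

Section translate.
Context {R : realType} {d : nat}.
Local Notation E := 'rV[R]_d.
Local Notation mu := (@lebesgue_rV R d).
Local Notation leb := (@lebesgue_measure R).
Implicit Types (u g f w : E -> R).

(** Weak differentiability tested against products of bump functions only. The
derivative h' of the j-th factor is a parameter, so that no choice of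
derivative appears. *)
Definition real_weak_partial (j : 'I_d) u g :=
  forall (h : 'I_d -> R -> R) (h' : R -> R), (forall k, bump_fun (h k)) ->
  (forall t : R, is_derive t 1 (h j) (h' t)) ->
  (\int[mu]_x (u x * tensor (set_factor h j h') x)%:E = - \int[mu]_x (g x * tensor h x)%:E)%E.

Lemma sq_integrable_le u f : sq_integrable u -> measurable_fun [set: E] f ->
  (forall x, f x ^+ 2 <= u x ^+ 2) -> sq_integrable f.
Proof.
move=> [mu_ iu] mf fu; split => //.
apply: (le_integrable_real _ iu); first exact: measurable_funX.
by move=> x; rewrite ger0_norm ?sqr_ge0.
Qed.

Lemma sq_integrableD u w : sq_integrable u -> sq_integrable w ->
  sq_integrable (fun x => u x + w x).
Proof.
move=> [mu_ iu] [mw iw]; split; first exact: measurable_funD.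
apply: (le_integrable_real (g := fun x => 2 * (u x ^+ 2) + 2 * (w x ^+ 2))).
- by apply: measurable_funX; exact: measurable_funD.
- rewrite [X in integrable _ _ X](_ : _ =
     (fun x => 2%:E * (u x ^+ 2)%R%:E + 2%:E * (w x ^+ 2)%R%:E)%E)//.
  by apply: integrableD => //; exact: integrableZl.
- move=> x; rewrite ger0_norm ?sqr_ge0//.
  have : 0 <= (u x - w x) ^+ 2 by exact: sqr_ge0.
  by rewrite sqrrB sqrrD; lra.
Qed.

Lemma sq_integrableZ u (c : R) : sq_integrable u -> sq_integrable (fun x => c * u x).
Proof.
move=> [mu_ iu]; split; first exact: measurable_funM.
under eq_fun do rewrite exprMn EFinM.
exact: integrableZl.
Qed.

Lemma sq_integrableB u w : sq_integrable u -> sq_integrable w ->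
  sq_integrable (fun x => u x - w x).
Proof.
move=> iu iw; under eq_fun do rewrite -mulN1r.
by apply: sq_integrableD => //; exact: sq_integrableZ.
Qed.

Variables (e : E) (s : R) (s0 : 0 < s).
Local Notation win := (window e s).

(** Average [window_sq] over x: the average of f^2 has integral s times that of
f^2. *)
Lemma fine_window_sq f : sq_integrable f -> (forall x, 0 <= f x) ->
  [/\ sq_integrable (fun x => fine (win f x)),
   (\int[mu]_x (fine (win f x) ^+ 2)%:E <= (s ^+ 2)%:E * \int[mu]_x (f x ^+ 2)%:E)%E &
   {ae mu, forall x, win f x = (fine (win f x))%:E}].
Proof.
move=> [mf if_] f0.
have mf2 : measurable_fun [set: E] (fun x => f x ^+ 2) by exact: measurable_funX.
have f20 x : 0 <= f x ^+ 2 by exact: sqr_ge0.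
have mW : measurable_fun [set: E] (win f) by exact: measurable_window.
have mW2 : measurable_fun [set: E] (win (fun x => f x ^+ 2)) by exact: measurable_window.
have mfW : measurable_fun [set: E] (fun x => fine (win f x)).
  exact: measurableT_comp.
have W20 x : (0 <= win (fun x => f x ^+ 2)%R x)%E by exact: window_ge0.
have le1 : (\int[mu]_x (fine (win f x) ^+ 2)%:E <=
    (s ^+ 2)%:E * \int[mu]_x (f x ^+ 2)%:E)%E.
  apply: (@le_trans _ _ (\int[mu]_x (s%:E * win (fun x => f x ^+ 2)%R x))%E).
    apply: ge0_le_integral => //.
    - by move=> x _; rewrite lee_fin sqr_ge0.
    - by apply/measurable_EFinP; exact: measurable_funX.
    - exact: measurable_funeM.
    - by move=> x _; have [] := window_sq e s0 x mf f0.
  rewrite ge0_integralZl ?lee_fin ?(ltW s0)//.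
  by rewrite (integral_window1 e s0)// muleA -EFinM expr2.
have fin2 : (\int[mu]_x (f x ^+ 2)%:E < +oo)%E.
  have /integrableP[_] := if_; congr (_ < _)%E.
  by apply: eq_integral => x _; rewrite gee0_abs ?lee_fin ?sqr_ge0.
split => //.
- split => //; apply/integrableP; split.
    by apply/measurable_EFinP; exact: measurable_funX.
  under eq_integral do rewrite gee0_abs ?lee_fin ?sqr_ge0//.
  apply: (le_lt_trans le1).
  rewrite -(@fineK _ (\int[mu]_x (f x ^+ 2)%:E)%E) -?EFinM ?ltry//.
  rewrite ge0_fin_numE//; apply: integral_ge0 => x _.
  by rewrite lee_fin sqr_ge0.
- have iW2 : mu.-integrable [set: E] (win (fun x => f x ^+ 2)).
    apply/integrableP; split => //.
    under eq_integral do rewrite gee0_abs//.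
    rewrite (integral_window1 e s0)//.
    rewrite -(@fineK _ (\int[mu]_x (f x ^+ 2)%:E)%E) -?EFinM ?ltry//.
    rewrite ge0_fin_numE//; apply: integral_ge0 => x _.
    by rewrite lee_fin sqr_ge0.
  have := integrable_ae measurableT iW2; apply: filterS => x /(_ I) W2fin.
  rewrite fineK// ge0_fin_numE; last exact: window_ge0.
  have [_] := window_sq e s0 x mf f0; apply.
  by rewrite -ge0_fin_numE.
Qed.

End translate.

Section shift_estimate.
Context {R : realType} {d : nat}.
Local Notation E := 'rV[R]_d.
Local Notation mu := (@lebesgue_rV R d).
Local Notation leb := (@lebesgue_measure R).
Implicit Types (u g f w : E -> R).
Variables (j : 'I_d) (s : R) (s0 : 0 < s).
Local Notation e := (@basis_rV R d j).
Local Notation win := (window e s).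

Lemma tensor_shift (h : 'I_d -> R -> R) (t : R) x :
  tensor h (x - t *: e) = tensor (set_factor h j (fun r => h j (r - t))) x.
Proof.
rewrite tensor_set_factor (tensorE _ j) !mxE !eqxx mulr1; congr (_ * _).
by apply: eq_bigr => k /negbTE kj; rewrite !mxE kj andbF mulr0 subr0.
Qed.

Lemma bump_fun_set_factor (h : 'I_d -> R -> R) (g : R -> R) :
  (forall k, bump_fun (h k)) -> bump_fun g -> forall k, bump_fun (set_factor h j g k).
Proof. by move=> bh bg k; rewrite /set_factor; case: ifP. Qed.

Lemma bump_fun_shift (f : R -> R) (t : R) : bump_fun f -> bump_fun (fun r => f (r - t)).
Proof.
move=> [sf [a fa]]; split.
  move=> n; have := @smoothn_affine _ n f 1 (- t) (sf n).
  by under eq_fun do rewrite mul1r.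
exists (a + `|t|) => r ar; apply: fa.
have := ler_distD t r 0; rewrite !subr0; lra.
Qed.

(** Move the average from f to the test function, where it acts on the j-th factor
only. *)
Lemma window_tensor f (h : 'I_d -> R -> R) (zeta : R -> R) :
  sq_integrable f -> (forall x, 0 <= f x) ->
  (forall k, bump_fun (h k)) -> (forall k t, 0 <= h k t) ->
  (forall t, (\int[leb]_(r in `[0%R, s]) (h j (t - r))%:E = (zeta t)%:E)%E) ->
  (\int[mu]_x (fine (win f x) * tensor h x)%:E =
   \int[mu]_x (f x * tensor (set_factor h j zeta) x)%:E)%E.
Proof.
move=> sf f0 bh h0 zE; have [mf _] := sf.
have [[mW _] _ aeW] := fine_window_sq e s0 sf f0.
have T0 x : 0 <= tensor h x by apply: prodr_ge0.
have mT : measurable_fun [set: E] (tensor h).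
  by apply: measurable_tensor => k; have [/smooth_continuous] := bh k.
transitivity (\int[mu]_x (win f x * (tensor h x)%:E))%E.
  apply: ae_eq_integral => //.
  - by apply/measurable_EFinP; exact: measurable_funM.
  - by apply: emeasurable_funM; [exact: measurable_window|exact/measurable_EFinP].
  - by apply: filterS aeW => x + _; rewrite EFinM => <-.
rewrite (integral_window e s)//; apply: eq_integral => x _.
rewrite EFinM; congr (_ * _)%E.
under eq_integral do rewrite tensor_shift tensor_set_factor EFinM.
rewrite ge0_integralZl//.
- by rewrite zE -EFinM tensor_set_factor.
- apply/measurable_EFinP/measurable_funTS.
  apply: (measurableT_comp (continuous_measurable_fun (smooth_continuous (bh j).1))).
  exact: measurable_funB.
- by move=> r _; rewrite lee_fin.
- by rewrite lee_fin; apply: prodr_ge0.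
Qed.

Lemma integralB_tensor u w (h : 'I_d -> R -> R) : sq_integrable u -> sq_integrable w ->
  (forall k, bump_fun (h k)) ->
  (\int[mu]_x ((u x - w x) * tensor h x)%:E =
   \int[mu]_x (u x * tensor h x)%:E - \int[mu]_x (w x * tensor h x)%:E)%E.
Proof.
move=> su sw bh; rewrite -integralB//.
- by apply: eq_integral => x _; rewrite mulrBl EFinB.
- exact: sq_integrable_tensor.
- exact: sq_integrable_tensor.
Qed.

Lemma integral_tensorB u (h : 'I_d -> R -> R) (f1 f2 : R -> R) : sq_integrable u ->
  (forall k, bump_fun (h k)) -> bump_fun f1 -> bump_fun f2 ->
  (\int[mu]_x (u x * tensor (set_factor h j (fun t => f1 t - f2 t)) x)%:E =
   \int[mu]_x (u x * tensor (set_factor h j f1) x)%:E -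
   \int[mu]_x (u x * tensor (set_factor h j f2) x)%:E)%E.
Proof.
move=> su bh b1 b2; rewrite -integralB//.
- by apply: eq_integral => x _; rewrite -EFinB !tensor_set_factor; congr EFin; ring.
- by apply: sq_integrable_tensor => //; exact: bump_fun_set_factor.
- by apply: sq_integrable_tensor => //; exact: bump_fun_set_factor.
Qed.

(** Let W x be the integral of g along the segment from x to x + s e_j. Tested
against a product of bump functions h, both u (x + s e_j) - u x and W give the
integral of g against the product whose j-th factor is averaged over [0, s]:
for the former, because that factor has derivative h t - h (t - s), up to the
sign of the integration by parts. So they agree almost everywhere, and the
bound is Cauchy-Schwarz for W. The positive and negative parts of g are averaged
separately, so that only integrals of nonnegative functions are exchanged. *)
Lemma shift_estimate u g : sq_integrable u -> sq_integrable g ->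
  real_weak_partial j u g ->
  (\int[mu]_x ((u (x + s *: e)%R - u x) ^+ 2)%:E <=
   (s ^+ 2)%:E * \int[mu]_x (g x ^+ 2)%:E)%E.
Proof.
move=> su sg wug; have [mg _] := sg.
pose gp x := Num.max (g x) 0; pose gn x := Num.max (- g x) 0.
have gE x : g x = gp x - gn x by rewrite /gp /gn /Order.max; case: (ltP (g x) 0); case: (ltP (- g x) 0) => *; lra.
have gp0 x : 0 <= gp x by rewrite /gp le_max lexx orbT.
have gn0 x : 0 <= gn x by rewrite /gn le_max lexx orbT.
have gpn x : gp x * gn x = 0.
  rewrite /gp /gn /Order.max; case: (ltP (g x) 0); case: (ltP (- g x) 0) => h1 h2;
    rewrite ?mulr0 ?mul0r//.
  by have -> : g x = 0 by [lra]; rewrite mul0r.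
have g2E x : g x ^+ 2 = gp x ^+ 2 + gn x ^+ 2.
  by rewrite gE sqrrB gpn mul0rn subr0.
have mgp : measurable_fun [set: E] gp by exact: measurable_maxr.
have mgn : measurable_fun [set: E] gn by apply: measurable_maxr => //; exact: measurableT_comp.
have sgp : sq_integrable gp.
  by apply: sq_integrable_le sg mgp _ => x; rewrite g2E lerDl sqr_ge0.
have sgn : sq_integrable gn.
  by apply: sq_integrable_le sg mgn _ => x; rewrite g2E lerDr sqr_ge0.
have [sWp leWp _] := fine_window_sq e s0 sgp gp0.
have [sWn leWn _] := fine_window_sq e s0 sgn gn0.
pose W x := fine (win gp x) - fine (win gn x).
have sW : sq_integrable W by exact: sq_integrableB.
have ss : sq_integrable (fun x => u (x + s *: e)) by exact: sq_integrable_shift.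
have sD : sq_integrable (fun x => u (x + s *: e) - u x) by exact: sq_integrableB.
have key : {ae mu, forall x, (u (x + s *: e) - u x) - W x = 0}.
  apply: sq_integrable_ae0; first exact: sq_integrableB.
  move=> h bh h0.
  have [zeta [bz dz zE]] := bump_fun_window (bh j) s0.
  rewrite integralB_tensor// integralB_tensor// integralB_tensor//.
  rewrite (window_tensor sgp gp0 bh h0 zE) (window_tensor sgn gn0 bh h0 zE).
  rewrite -(integralB_tensor sgp sgn (bump_fun_set_factor bh bz)).
  have -> : (\int[mu]_x ((gp x - gn x) * tensor (set_factor h j zeta) x)%:E =
      \int[mu]_x (g x * tensor (set_factor h j zeta) x)%:E)%E.
    by apply: eq_integral => x _; rewrite -gE.
  have -> : (\int[mu]_x (u (x + s *: e)%R * tensor h x)%:E =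
      \int[mu]_x (u x * tensor (set_factor h j (fun r => h j (r - s))) x)%:E)%E.
    have mf : measurable_fun [set: E] (fun x => (u x * tensor h (x - s *: e))%:E).
      apply/measurable_EFinP; apply: measurable_funM; first by case: su.
      have mT : measurable_fun [set: E] (tensor h).
        by apply: measurable_tensor => k; have [/smooth_continuous] := bh k.
      exact: (measurableT_comp mT (measurable_shift (- (s *: e)))).
    transitivity (\int[mu]_x (u x * tensor h (x - s *: e))%:E)%E.
      rewrite -(integral_shift (s *: e) mf).
      by apply: eq_integral => x _; rewrite addrK.
    by apply: eq_integral => x _; rewrite tensor_shift.
  have bs := bump_fun_shift s (bh j).
  have set_factorK (f : R -> R) : set_factor (set_factor h j zeta) j f = set_factor h j f.
    by apply/funext => k; rewrite /set_factor; case: eqP.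
  have := @wug (set_factor h j zeta) (fun t => h j t - h j (t - s)) (bump_fun_set_factor bh bz).
  rewrite {1}/set_factor eqxx set_factorK integral_tensorB// set_factor_id => /(_ dz).
  have fin (w : E -> R) (l : 'I_d -> R -> R) : sq_integrable w ->
      (forall k, bump_fun (l k)) -> (\int[mu]_x (w x * tensor l x)%:E)%E \is a fin_num.
    by move=> sw bl; apply: integrable_fin_num => //; exact: sq_integrable_tensor.
  have fA := fin u h su bh.
  have fB := fin u _ su (bump_fun_set_factor bh bs).
  have fC := fin g _ sg (bump_fun_set_factor bh bz).
  rewrite -(fineK fA) -(fineK fB) -(fineK fC) -!EFinB -EFinN => -[h1].
  by congr EFin; lra.
apply: (@le_trans _ _ (\int[mu]_x (W x ^+ 2)%:E)%E).
  rewrite le_eqVlt; apply/orP; left; apply/eqP.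
  apply: ae_eq_integral => //.
  - by apply/measurable_EFinP; apply: measurable_funX; case: sD.
  - by apply/measurable_EFinP; apply: measurable_funX; case: sW.
  - by apply: filterS key => x /subr0_eq -> _.
have sq_meas (w : E -> R) : sq_integrable w -> measurable_fun [set: E] (fun x => (w x ^+ 2)%:E).
  by move=> [mw _]; apply/measurable_EFinP; exact: measurable_funX.
apply: (@le_trans _ _ (\int[mu]_x ((fine (win gp x) ^+ 2)%:E + (fine (win gn x) ^+ 2)%:E))%E).
  apply: ge0_le_integral => //.
  - by move=> x _; rewrite lee_fin sqr_ge0.
  - exact: sq_meas.
  - by apply: emeasurable_funD; exact: sq_meas.
  - move=> x _; rewrite -EFinD lee_fin /W.
    have w1 : 0 <= fine (win gp x) by apply: fine_ge0; exact: window_ge0.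
    have w2 : 0 <= fine (win gn x) by apply: fine_ge0; exact: window_ge0.
    by have := mulr_ge0 w1 w2; rewrite sqrrB; lra.
rewrite ge0_integralD//; [|by move=> x _; rewrite lee_fin sqr_ge0|exact: sq_meas
  |by move=> x _; rewrite lee_fin sqr_ge0|exact: sq_meas].
apply: (le_trans (leeD leWp leWn)).
rewrite -ge0_muleDr; [|by apply: integral_ge0 => x _; rewrite lee_fin sqr_ge0..].
rewrite -ge0_integralD//; [|by move=> x _; rewrite lee_fin sqr_ge0|exact: sq_meas
  |by move=> x _; rewrite lee_fin sqr_ge0|exact: sq_meas].
rewrite le_eqVlt; apply/orP; left; apply/eqP; congr (_ * _)%E.
by apply: eq_integral => x _; rewrite g2E EFinD.
Qed.

End shift_estimate.

(** * Superlevel sets and the subcritical Sobolev inequality *)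

Section level_sets.
Context {R : realType} {d : nat}.
Local Notation E := 'rV[R]_d.
Local Notation mu := (@lebesgue_rV R d).
Implicit Types (u g f w : E -> R).

(** L2-Lipschitz dependence of f on translations, for vectors with positive
coordinates; this is the only information on the gradient that the Sobolev
inequality uses. *)
Definition shift_bound (C : R) f := forall (r : R) (y : E), 0 < r ->
  obox (fun=> 0) (fun=> r) y ->
  (\int[mu]_x ((f (x + y)%R - f x) ^+ 2)%:E <= (C * r ^+ 2)%:E)%E.

Lemma obox_volume (r : R) : 0 < r ->
  mu (obox (fun=> 0) (fun=> r)) = (r ^+ d)%:E.
Proof.
move=> r0; rewrite lebesgue_rV_obox.
under eq_bigr do rewrite lebesgue_measure_itv/= lte_fin r0 oppr0 addr0.
by rewrite prodEFin prodr_const card_ord.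
Qed.

Definition superlevel f (t : R) : set E := [set x | t < f x].

Lemma measurable_superlevel f (t : R) : measurable_fun [set: E] f ->
  measurable (superlevel f t).
Proof.
move=> mf; have := mf measurableT `]t, +oo[%classic (measurable_itv _).
rewrite setTI; congr measurable.
by apply/seteqP; split => x /=; rewrite in_itv/= andbT.
Qed.

(** Integrate (f (x + y) - f x)^2 over all x and all y in the cube (0, r)^d. From
above the shift bound gives C r^2 (2 b). From below, for x in {f > 2 l}, the
integrand is at least l^2 when f (x + y) <= l, which holds for y in at least
half of the cube because {f > l} has measure at most b = r^d / 2. *)
Lemma level_step f (C l b r : R) : measurable_fun [set: E] f ->
  shift_bound C f -> 0 < l -> 0 < b -> 0 < r -> r ^+ d = 2 * b ->
  (mu (superlevel f l) <= b%:E)%E ->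
  (mu (superlevel f (2 * l)%R) <= (2 * C * r ^+ 2 / l ^+ 2)%:E)%E.
Proof.
move=> mf sb l0 b0 r0 rb lb.
set A := superlevel f (2 * l); set L := superlevel f l.
have mA : measurable A by exact: measurable_superlevel.
have mL : measurable L by exact: measurable_superlevel.
pose Y : set E := obox (fun=> 0) (fun=> r).
have mY : measurable Y by exact: measurable_obox.
have muY : mu Y = (2 * b)%:E by rewrite obox_volume// rb.
pose F (z : E * E) : \bar R := (((f (z.1 + z.2) - f z.1) ^+ 2) * \1_Y z.2)%:E.
have F0 z : (0 <= F z)%E by rewrite lee_fin mulr_ge0 ?sqr_ge0.
have mF : measurable_fun [set: E * E] F.
  apply/measurable_EFinP; apply: measurable_funM.
    apply: measurable_funX; apply: measurable_funB.
      exact: (measurableT_comp mf measurable_addrV).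
    exact: (measurableT_comp mf measurable_fst).
  exact: (measurableT_comp (measurable_indic mY) measurable_snd).
have up : (\int[mu]_x \int[mu]_y F (x, y) <= (C * r ^+ 2 * (2 * b))%:E)%E.
  rewrite (fubini_tonelli (m1 := mu) (m2 := mu) F mF F0).
  have -> : (C * r ^+ 2 * (2 * b))%:E = (\int[mu]_y (C * r ^+ 2 * \1_Y y)%:E)%E.
    rewrite (_ : (fun y => _) = (fun y => (C * r ^+ 2)%:E * (\1_Y y)%:E)%E)//.
    rewrite integralZl//; last first.
      have := @integrable_cst_indic _ E R mu 1 Y mY.
      under [X in integrable _ _ X]eq_fun do rewrite mul1r.
      by apply; exact: obox_fin.
    by rewrite integral_indic// setIT EFinM; congr (_ * _)%E; exact/esym.
  apply: ge0_le_integral => //.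
  - by move=> y _; exact: integral_ge0.
  - exact: (measurable_fun_fubini_tonelli_G F).
  - by apply/measurable_EFinP; apply: measurable_funM => //; exact: measurable_indic.
  move=> y _; rewrite /F /= indicE; have [yY|_] := boolP (y \in Y); last first.
    by under eq_integral do rewrite mulr0; rewrite integral0 mulr0.
  under eq_integral do rewrite mulr1; rewrite mulr1.
  by apply: sb => //; exact: set_mem yY.
have low x : A x -> ((l ^+ 2 * b)%:E <= \int[mu]_y F (x, y))%E.
  move=> Ax.
  have mFx : measurable_fun [set: E] (fun y => F (x, y)) by exact: measurableT_comp.
  have mLx : measurable_fun [set: E] (fun y => \1_L (x + y) : R).
    under eq_fun do rewrite addrC.
    exact: (measurableT_comp (measurable_indic mL) (measurable_shift x)).
  have : ((l ^+ 2 * (2 * b))%:E <= \int[mu]_y F (x, y) + (l ^+ 2 * b)%:E)%E.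
    have -> : (l ^+ 2 * (2 * b))%:E = (\int[mu]_y ((l ^+ 2)%:E * (\1_Y y)%:E))%E.
      rewrite ge0_integralZl ?lee_fin ?sqr_ge0//.
      - by rewrite integral_indic// setIT (EFinM (l ^+ 2)); congr (_ * _)%E; exact/esym.
      - by apply/measurable_EFinP; exact: measurable_indic.
    apply: (@le_trans _ _ (\int[mu]_y F (x, y) +
        \int[mu]_y ((l ^+ 2)%:E * (\1_L (x + y)%R)%:E))%E); last first.
      apply: leeD => //; rewrite ge0_integralZl ?lee_fin ?sqr_ge0//; last exact/measurable_EFinP.
      rewrite (EFinM (l ^+ 2) b); apply: lee_pmul => //.
        by rewrite lee_fin sqr_ge0.
        by apply: integral_ge0 => y _; rewrite lee_fin.
      under eq_integral do rewrite addrC.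
      rewrite (ge0_integral_shift x (f := fun y => (\1_L y)%:E))//.
      - by rewrite integral_indic// setIT.
      - by apply/measurable_EFinP; exact: measurable_indic.
    rewrite -ge0_integralD//.
    - apply: ge0_le_integral => //.
      + by move=> y _; rewrite -EFinM lee_fin mulr_ge0 ?sqr_ge0.
      + apply: emeasurable_funM => //; apply/measurable_EFinP; exact: measurable_indic.
      + by apply: emeasurable_funD => //; apply: emeasurable_funM => //; exact/measurable_EFinP.
      move=> y _; rewrite -!EFinM -EFinD lee_fin !indicE.
      have [_|_] := boolP (y \in Y); last first.
        by rewrite !mulr0 add0r mulr_ge0 ?sqr_ge0.
      have [_|] := boolP (x + y \in L).
        by rewrite !mulr1 lerDr sqr_ge0.
      rewrite notin_setE /L /superlevel/= => /negP; rewrite -leNgt => fl.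
      rewrite !mulr1 mulr0 addr0 -[leRHS]sqrrN opprB lerXn2r ?nnegrE//.
      + exact: ltW.
      + by move: Ax; rewrite /A /superlevel/=; lra.
      + by move: Ax; rewrite /A /superlevel/=; lra.
    - by move=> y _; rewrite -EFinM lee_fin mulr_ge0 ?sqr_ge0.
    - by apply: emeasurable_funM => //; exact/measurable_EFinP.
  have -> : (l ^+ 2 * (2 * b))%:E = ((l ^+ 2 * b)%:E + (l ^+ 2 * b)%:E)%E.
    by rewrite -EFinD; congr EFin; ring.
  by rewrite leeD2rE.
have : ((l ^+ 2 * b)%:E * mu A <= (C * r ^+ 2 * (2 * b))%:E)%E.
  apply: le_trans up.
  have -> : ((l ^+ 2 * b)%:E * mu A = \int[mu]_x ((l ^+ 2 * b)%:E * (\1_A x)%:E))%E.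
    rewrite ge0_integralZl ?lee_fin ?sqr_ge0//.
    - by rewrite integral_indic// setIT.
    - by apply/measurable_EFinP; exact: measurable_indic.
    - by rewrite mulr_ge0 ?sqr_ge0// ltW.
  apply: ge0_le_integral => //.
  - by move=> x _; rewrite -EFinM lee_fin !mulr_ge0 ?sqr_ge0// ltW.
  - apply: emeasurable_funM => //; apply/measurable_EFinP; exact: measurable_indic.
  - exact: (measurable_fun_fubini_tonelli_F F).
  move=> x _; rewrite indicE; have [/set_mem xA|_] := boolP (x \in A).
    by rewrite mule1; exact: low.
  by rewrite mule0; exact: integral_ge0.
have lb0 : 0 < l ^+ 2 * b by rewrite mulr_gt0 ?exprn_gt0.
have -> : C * r ^+ 2 * (2 * b) = (l ^+ 2 * b) * (2 * C * r ^+ 2 / l ^+ 2).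
  by field; rewrite gt_eqF.
by rewrite (EFinM (l ^+ 2 * b)) lee_pmul2l ?lte_fin.
Qed.

End level_sets.

Section moments.
Context {R : realType} {d : nat} (hd : (1 < d)%N).
Local Notation E := 'rV[R]_d.
Local Notation mu := (@lebesgue_rV R d).
Implicit Types (u g f w : E -> R).

Lemma powR2_gt1 (x : R) : 0 < x -> 1 < 2 `^ x.
Proof.
move=> x0; rewrite /powR pnatr_eq0/=.
by have := ltr_expR 0 (x * ln 2); rewrite expR0 => ->; rewrite mulr_gt0// ln_gt0 ?ltr1n.
Qed.

Lemma exprn_unbounded (x M : R) : 1 < x -> exists n, M <= x ^+ n.
Proof.
move=> x1; have x10 : 0 < x - 1 by rewrite subr_gt0.
have bern n : 1 + n%:R * (x - 1) <= x ^+ n.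
  elim: n => [|n IH]; first by rewrite mul0r addr0 expr0.
  rewrite exprS -natr1; have n0 : 0 <= n%:R :> R by [].
  apply: le_trans (ler_wpM2l (ltW (lt_trans ltr01 x1)) IH).
  have := mulr_ge0 n0 (sqr_ge0 (x - 1)); rewrite expr2; lra.
exists (Num.truncn (`|M| / (x - 1))).+1.
apply: le_trans (bern _); rewrite (le_trans (ler_norm M))//.
have := truncnS_gt (`|M| / (x - 1)); rewrite ltr_pdivrMr//; lra.
Qed.

(** Chebyshev's inequality, which starts the iteration. *)
Lemma superlevel1 f : measurable_fun [set: E] f ->
  (\int[mu]_x (f x ^+ 2)%:E <= 1)%E -> (mu (superlevel f 1) <= 1)%E.
Proof.
move=> mf; apply: le_trans.
have mS := measurable_superlevel 1 mf.
rewrite -[X in mu X]setIT -integral_indic//.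
apply: ge0_le_integral => //.
- by apply/measurable_EFinP; exact: measurable_indic.
- by apply/measurable_EFinP; exact: measurable_funX.
move=> x _; rewrite lee_fin indicE; case: (boolP (x \in _)) => [/set_mem|_].
  by rewrite /superlevel /= => fx; rewrite expr_ge1 ?ltW// (lt_trans ltr01 fx).
exact: sqr_ge0.
Qed.

Lemma superlevelS f (t t' : R) : t <= t' -> superlevel f t' `<=` superlevel f t.
Proof. by move=> tt x; exact: le_lt_trans. Qed.

(** With th = 2/d and measures at most B a^k, where a = 2^(-s), one step turns the
bound B a^k into a constant multiple of B^th (a^th / 4)^k. This is at most
B a^(k+1) for k large exactly because a > a^th / 4, the condition on s; B is taken
large enough to cover the first k0 steps by the trivial bound 1. *)
Lemma level_decay (C s : R) : 0 < C -> 0 < s -> s * (1 - 2 / d%:R) < 2 ->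
  exists2 B : R, 0 < B & forall f, measurable_fun [set: E] f ->
    (\int[mu]_x (f x ^+ 2)%:E <= 1)%E -> shift_bound C f ->
    forall k, (mu (superlevel f (2 ^+ k)%R) <= (B * (2 `^ (- s)) ^+ k)%:E)%E.
Proof.
move=> C0 s0 sd; set a := 2 `^ (- s); pose th : R := 2 / d%:R.
have d0 : 0 < d%:R :> R by rewrite ltr0n ltnW.
have th0 : 0 < th by rewrite divr_gt0.
have a0 : 0 < a by rewrite powR_gt0.
pose b := a `^ th; have b0 : 0 < b by rewrite powR_gt0.
have rho1 : 1 < 4 * a / b.
  have -> : 4 * a / b = 2 `^ (2 - s + s * th).
    have p (u v : R) : 2 `^ (u + v) = 2 `^ u * 2 `^ v.
      by rewrite powRD// pnatr_eq0 implybT.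
    rewrite /b /a -powRrM (p (2 - s)) (p 2).
    have -> : (2 : R) `^ 2 = 4 by rewrite (powR_mulrn 2)// -natrX.
    by rewrite -[in RHS](opprK (s * th)) (powRN _ (- (s * th))) mulNr.
  by apply: powR2_gt1; move: sd; rewrite /th; lra.
pose M := 2 * C * 2 `^ th / a.
have [k0 hk0] := exprn_unbounded M rho1.
have a1 : a < 1.
  by rewrite /a powRN invf_lt1 ?powR_gt0//; exact: powR2_gt1.
have [B [B1 Bk]] : exists B : R, 1 <= B /\ forall k, (k <= k0)%N -> 1 <= B * a ^+ k.
  exists (a ^+ k0)^-1; split=> [|k kk0].
    by rewrite invf_ge1 ?exprn_gt0// exprn_ile1// ltW.
  rewrite mulrC ler_pdivlMr ?exprn_gt0// mul1r.
  by rewrite ler_wiXn2l// ltW.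
have B0 : 0 < B := lt_le_trans ltr01 B1.
exists B => // f mf f2 sb.
have small k : (k <= k0)%N -> (mu (superlevel f (2 ^+ k)%R) <= (B * a ^+ k)%:E)%E.
  move=> kk0; apply: (@le_trans _ _ 1%E); last first.
    by rewrite lee_fin Bk.
  apply: le_trans (superlevel1 mf f2).
  apply: le_measure; rewrite ?inE; [exact: measurable_superlevel..|].
  by apply: superlevelS; rewrite exprn_ege1// ler1n.
elim=> [|k IH]; first exact: small.
have [kk|kk] := leqP k.+1 k0; first exact: small.
have be0 : 0 < B * a ^+ k by rewrite mulr_gt0// exprn_gt0.
pose r := (2 * (B * a ^+ k)) `^ (d%:R^-1).
have r0 : 0 < r by rewrite powR_gt0// mulr_gt0.
have rd : r ^+ d = 2 * (B * a ^+ k).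
  rewrite /r -powR_mulrn ?powR_ge0// -powRrM mulVf ?gt_eqF// powRr1//.
  by rewrite mulr_ge0// ltW.
have := level_step mf sb (exprn_gt0 k (ltr0n R 2)) be0 r0 rd IH.
rewrite -exprS => /le_trans; apply; rewrite lee_fin.
have r2 : r ^+ 2 = 2 `^ th * B `^ th * b ^+ k.
  rewrite /r -powR_mulrn ?powR_ge0// -powRrM (_ : d%:R^-1 * 2 = th); last by rewrite mulrC.
  rewrite !powRM ?mulr_ge0 ?exprn_ge0 ?(ltW a0) ?(ltW B0)// mulrA; congr (_ * _).
  by rewrite -(powR_mulrn k (ltW a0)) powRAC powR_mulrn ?powR_ge0.
have BB : B `^ th <= B.
  rewrite -[leRHS](powRr1 (ltW B0)); apply: ler_powR.
    by [].
  by rewrite /th ler_pdivrMr// mul1r ler_nat.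
have Mk : M <= (4 * a / b) ^+ k.
  by apply: (le_trans hk0); rewrite ler_eXn2l.
have bk0 : 0 < b ^+ k by rewrite exprn_gt0.
have e4 : (2 ^+ k) ^+ 2 = 4 ^+ k :> R by rewrite exprAC -natrX.
rewrite r2 e4.
apply: (@le_trans _ _ (2 * C * (2 `^ th * B * b ^+ k) / 4 ^+ k)).
  rewrite ler_wpM2r ?invr_ge0 ?exprn_ge0// ler_wpM2l ?mulr_ge0 ?(ltW C0)//.
  by rewrite ler_wpM2r ?(ltW bk0)// ler_wpM2l ?powR_ge0.
have -> : 2 * C * (2 `^ th * B * b ^+ k) / 4 ^+ k = M * (B * a * (b ^+ k / 4 ^+ k)).
  rewrite /M; field; rewrite ?expf_neq0 ?pnatr_eq0 ?gt_eqF//.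
have -> : B * a ^+ k.+1 = (4 * a / b) ^+ k * (B * a * (b ^+ k / 4 ^+ k)).
  rewrite expr_div_n exprMn exprS; field.
  by rewrite ?expf_neq0 ?pnatr_eq0 ?gt_eqF.
by rewrite ler_wpM2r// !mulr_ge0 ?invr_ge0 ?exprn_ge0 ?(ltW B0) ?(ltW a0) ?(ltW b0).
Qed.

(** For f > 1, f^q is at most (2^(k+1))^q for the k with 2^k < f <= 2^(k+1). Since
q is strictly subcritical there is room for s > q with the same property, and
the series of (2^(k+1))^q |{f > 2^k}| is dominated by a geometric one of ratio
2^(q - s). *)
Lemma moment_bound (C q : R) : 0 < C -> 2 < q -> q * (1 - 2 / d%:R) < 2 ->
  exists2 K : R, 0 < K & forall f, measurable_fun [set: E] f -> (forall x, 0 <= f x) ->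
    (\int[mu]_x (f x ^+ 2)%:E <= 1)%E -> shift_bound C f ->
    (\int[mu]_x (f x `^ q)%:E <= K%:E)%E.
Proof.
move=> C0 q2 qd.
have d0 : 0 < d%:R :> R by rewrite ltr0n ltnW.
have th1 : 0 <= 1 - 2 / d%:R :> R.
  by rewrite subr_ge0 ler_pdivrMr// mul1r ler_nat.
(* Half of the distance to the critical case, as 1 - 2 / d <= 1. *)
pose et := (2 - q * (1 - 2 / d%:R)) / 2.
have et0 : 0 < et by rewrite /et divr_gt0// subr_gt0.
have th2 : 1 - 2 / d%:R <= 1 :> R by rewrite gerBl divr_ge0// ltW.
pose s := q + et.
have s0 : 0 < s by rewrite /s; lra.
have sd : s * (1 - 2 / d%:R) < 2.
  rewrite /s mulrDl; have := ler_wpM2l (ltW et0) th2; rewrite {2}/et; lra.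
have [B B0 HB] := level_decay C0 s0 sd.
pose a := (2 : R) `^ (- s); pose x := 2 `^ q * a.
have x0 : 0 < x by rewrite mulr_gt0 ?powR_gt0.
have x1 : x < 1.
  rewrite /x /a -powRD ?pnatr_eq0 ?implybT// -[q - s]opprB powRN invf_lt1 ?powR_gt0//.
  by apply: powR2_gt1; rewrite /s; lra.
exists (1 + (B * 2 `^ q) / (1 - x)).
  by rewrite addr_gt0// divr_gt0 ?subr_gt0// mulr_gt0// powR_gt0.
move=> f mf f0 f2 sb.
pose G k (y : E) : \bar R := ((2 ^+ k.+1) `^ q * \1_(superlevel f (2 ^+ k)) y)%:E.
have G0 k y : (0 <= G k y)%E by rewrite lee_fin mulr_ge0 ?powR_ge0.
have mG k : measurable_fun [set: E] (G k).
  apply/measurable_EFinP; apply: measurable_funM => //; apply: measurable_indic.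
  exact: measurable_superlevel.
have mS : measurable_fun [set: E] (fun y => (\sum_(0 <= k <oo) G k y)%E).
  by apply: ge0_emeasurable_sum.
have pw y : ((f y `^ q)%:E <= (f y ^+ 2)%:E + \sum_(0 <= k <oo) G k y)%E.
  have [f1|f1] := leP (f y) 1.
    apply: (@le_trans _ _ (f y ^+ 2)%:E); last by rewrite leeDl// nneseries_ge0.
    rewrite lee_fin; have [->|fn0] := eqVneq (f y) 0.
      by rewrite powR0 ?expr0n// gt_eqF// (lt_trans _ q2).
    rewrite -powR_mulrn//; apply: ger_powR; last exact: ltW.
    by rewrite f1 lt_neqAle eq_sym fn0 f0.
  have ex : exists n, f y <= 2 ^+ n.
    by exists (Num.Def.archi_bound (f y)); apply/ltW/upper_nthrootP.
  case: (ex_minnP ex) => -[|n] fn nmin; first by move: fn; rewrite expr0 leNgt f1.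
  have fn' : 2 ^+ n < f y by rewrite ltNge; apply/negP => /nmin; rewrite ltnn.
  apply: (@le_trans _ _ (\sum_(0 <= k <oo) G k y)%E); last first.
    by rewrite leeDr// lee_fin sqr_ge0.
  apply: (@le_trans _ _ (G n y)).
    rewrite lee_fin indicE mem_set// mulr1; apply: ge0_ler_powR => //; rewrite ?nnegrE ?exprn_ge0//.
    by rewrite ltW// (lt_trans _ q2).
  apply: (@le_trans _ _ (\sum_(0 <= k < n.+1) G k y)%E); last first.
    exact: nneseries_lim_ge.
  by rewrite big_nat_recr//= leeDr// sume_ge0.
apply: (@le_trans _ _ (\int[mu]_y ((f y ^+ 2)%:E + \sum_(0 <= k <oo) G k y))%E).
  apply: ge0_le_integral => //.
  - by move=> y _; rewrite lee_fin powR_ge0.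
  - by apply/measurable_EFinP; apply: (measurableT_comp (measurable_powR q)).
  - by apply: emeasurable_funD => //; apply/measurable_EFinP; exact: measurable_funX.
rewrite ge0_integralD//; first last.
- by move=> y _; exact: nneseries_ge0.
- by apply/measurable_EFinP; exact: measurable_funX.
- by move=> y _; rewrite lee_fin sqr_ge0.
rewrite EFinD; apply: leeD => //.
rewrite integral_nneseries//.
apply: (@le_trans _ _ (\sum_(0 <= k <oo) (B * 2 `^ q * x ^+ k)%:E)%E).
  apply: lee_nneseries => k _; first by rewrite integral_ge0.
  rewrite /G; under eq_integral do rewrite EFinM.
  rewrite ge0_integralZl ?lee_fin ?powR_ge0//; last first.
    by apply/measurable_EFinP; apply: measurable_indic; exact: measurable_superlevel.
  rewrite integral_indic//; last exact: measurable_superlevel.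
  rewrite setIT.
  apply: (@le_trans _ _ (((2 ^+ k.+1) `^ q)%:E * (B * a ^+ k)%:E)%E).
    by apply: lee_pmul => //; rewrite ?lee_fin ?powR_ge0//; exact: HB.
  rewrite -EFinM lee_fin /x exprMn -(powR_mulrn k.+1)// -powRrM mulrC powRrM.
  rewrite powRAC powR_mulrn ?powR_ge0// exprS; rewrite le_eqVlt; apply/orP; left; apply/eqP; ring.
apply: lime_le.
  by apply: is_cvg_nneseries => k _ _; rewrite lee_fin !mulr_ge0 ?exprn_ge0 ?powR_ge0 ?ltW.
apply: nearW => n; rewrite sumEFin lee_fin.
apply: le_trans (geometric_le_lim n _ x0 _).
- by rewrite /series /geometric /=.
- by rewrite mulr_ge0 ?powR_ge0 ?ltW.
- by rewrite ger0_norm ?ltW.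
Qed.

End moments.

(** * Complex-valued functions and their weak derivatives *)

Section complex_valued.
Context {R : realType} {d : nat}.
Local Notation E := 'rV[R]_d.
Local Notation mu := (@lebesgue_rV R d).
Local Notation cmod := ComplexField.Normc.normc.
Local Notation Re := complex.Re.
Local Notation Im := complex.Im.
Implicit Types (phi psi g : E -> R[i]) (j : 'I_d).
Local Open Scope complex_scope.

Lemma cmodE (z : R[i]) : cmod z ^+ 2 = Re z ^+ 2 + Im z ^+ 2.
Proof. by case: z => a b /=; rewrite sqr_sqrtr// addr_ge0 ?sqr_ge0. Qed.

Lemma cmod_ge0 (z : R[i]) : 0 <= cmod z.
Proof. by case: z => a b /=; rewrite sqrtr_ge0. Qed.

Lemma Re_mulrC (z : R[i]) (r : R) : Re (z * r%:C) = Re z * r.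
Proof. by case: z => a b /=; rewrite mulr0 subr0. Qed.

Lemma Im_mulrC (z : R[i]) (r : R) : Im (z * r%:C) = Im z * r.
Proof. by case: z => a b /=; rewrite mulr0 add0r. Qed.

Lemma Re_mulCr (z : R[i]) (r : R) : Re (r%:C * z) = r * Re z.
Proof. by case: z => a b /=; rewrite mul0r subr0. Qed.

Lemma Im_mulCr (z : R[i]) (r : R) : Im (r%:C * z) = r * Im z.
Proof. by case: z => a b /=; rewrite mul0r addr0. Qed.

Lemma cmodMl (z : R[i]) (r : R) : 0 <= r -> cmod (r%:C * z) = r * cmod z.
Proof.
move=> r0; apply/eqP; rewrite -(eqrXn2 (n := 2))// ?cmod_ge0 ?mulr_ge0 ?cmod_ge0//.
by rewrite exprMn !cmodE Re_mulCr Im_mulCr; apply/eqP; ring.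
Qed.

Lemma measurable_cmod phi : Cmeasurable phi -> measurable_fun [set: E] (fun x => cmod (phi x)).
Proof.
move=> [mr mi].
rewrite (_ : (fun x => _) = (fun x => (Re (phi x) ^+ 2 + Im (phi x) ^+ 2) `^ (2^-1))).
  apply: (measurableT_comp (measurable_powR _)).
  by apply: measurable_funD; exact: measurable_funX.
apply/funext => x; rewrite powR12_sqrt ?addr_ge0 ?sqr_ge0// -cmodE sqrtr_sqr.
by rewrite ger0_norm// cmod_ge0.
Qed.

(** The norms of the statement enter only through these integrals. *)
Definition qmass (q : R) phi : \bar R := (\int[mu]_x (cmod (phi x) `^ q)%:E)%E.

Lemma qmass_ge0 q phi : (0 <= qmass q phi)%E.
Proof. by apply: integral_ge0 => x _; rewrite lee_fin powR_ge0. Qed.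

Lemma eLnormE q phi : eLnorm q phi = (qmass q phi `^ q^-1)%E.
Proof.
rewrite /eLnorm unlock /=; congr (_ `^ _)%E; apply: eq_integral => x _.
by rewrite /= ger0_norm ?cmod_ge0.
Qed.

Lemma eLnorm_lty q phi : 0 < q -> (eLnorm q phi < +oo)%E <-> (qmass q phi < +oo)%E.
Proof.
move=> q0; rewrite eLnormE; have := qmass_ge0 q phi.
case: (qmass q phi) => [r||]//=; first by rewrite !ltry.
by rewrite invr_eq0 gt_eqF.
Qed.

(** This holds even if the integral is infinite: both sides are then 0, since
fine sends +oo to 0. *)
Lemma Lqnorm_powR q phi : 0 < q -> Lqnorm q phi `^ q = fine (qmass q phi).
Proof.
move=> q0; rewrite /Lqnorm eLnormE; have := qmass_ge0 q phi.
case: (qmass q phi) => [r||]//=.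
  by rewrite lee_fin => r0; rewrite -powRrM mulVf ?gt_eqF// powRr1.
by move=> _; rewrite invr_eq0 gt_eqF//= powR0 ?gt_eqF.
Qed.

Definition sqmass phi : \bar R := (\int[mu]_x (cmod (phi x) ^+ 2)%:E)%E.

Lemma qmass2 phi : qmass 2 phi = sqmass phi.
Proof. by apply: eq_integral => x _; rewrite (powR_mulrn 2)// cmod_ge0. Qed.

Lemma Lqnorm2 phi : Lqnorm 2 phi ^+ 2 = fine (sqmass phi).
Proof.
rewrite -qmass2 -Lqnorm_powR// (powR_mulrn 2)//.
by rewrite /Lqnorm fine_ge0// eLnormE poweR_ge0.
Qed.

Lemma L2P phi : L2 phi <->
  sq_integrable (fun x => Re (phi x)) /\ sq_integrable (fun x => Im (phi x)).
Proof.
rewrite /L2 eLnorm_lty// qmass2; split.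
- move=> [[mr mi] fin].
  have ic : mu.-integrable [set: E] (EFin \o (fun x => cmod (phi x) ^+ 2)).
    apply/integrableP; split.
      by apply/measurable_EFinP; apply: measurable_funX; exact: measurable_cmod.
    by under eq_integral do rewrite gee0_abs ?lee_fin ?sqr_ge0//.
  split; split => //.
  + apply: (le_integrable_real _ ic); first exact: measurable_funX.
    by move=> x; rewrite ger0_norm ?sqr_ge0// cmodE lerDl sqr_ge0.
  + apply: (le_integrable_real _ ic); first exact: measurable_funX.
    by move=> x; rewrite ger0_norm ?sqr_ge0// cmodE lerDr sqr_ge0.
- move=> [[mr ir] [mi ii]]; split => //.
  have /integrableP[_] := integrableD measurableT ir ii.
  congr (_ < _)%E; apply: eq_integral => x _.
  by rewrite cmodE -EFinD gee0_abs// lee_fin addr_ge0 ?sqr_ge0.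
Qed.

Lemma L2_integrable phi : L2 phi ->
  mu.-integrable [set: E] (fun x => (cmod (phi x) ^+ 2)%:E).
Proof.
move=> /L2P[[mr ir] [mi ii]].
rewrite [X in integrable _ _ X](_ : _ =
  (fun x => (Re (phi x) ^+ 2)%R%:E + (Im (phi x) ^+ 2)%R%:E)%E); last first.
  by apply/funext => x; rewrite cmodE.
exact: integrableD.
Qed.

Lemma sqmass_fin phi : L2 phi -> (fine (sqmass phi))%:E = sqmass phi.
Proof.
by move=> /L2_integrable h; rewrite fineK//; exact: integrable_fin_num.
Qed.

Lemma L2Z (t : R) phi : L2 phi -> L2 (fun x => t%:C * phi x).
Proof.
move=> /L2P[r1 i1]; apply/L2P.
under [X in sq_integrable X /\ _]eq_fun do rewrite Re_mulCr.
under [X in _ /\ sq_integrable X]eq_fun do rewrite Im_mulCr.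
by split; exact: sq_integrableZ.
Qed.

(** Real and imaginary parts decouple because the test functions are real. The
values of the integrals in the definition are finite on both sides, so equality
of their finite parts is equality. *)
Lemma weak_partial_real j phi g : L2 phi -> L2 g -> weak_partial j phi g ->
  real_weak_partial j (fun x => Re (phi x)) (fun x => Re (g x)) /\
  real_weak_partial j (fun x => Im (phi x)) (fun x => Im (g x)).
Proof.
move=> /L2P[r1 i1] /L2P[r2 i2] w.
suff H h h' : (forall k, bump_fun (h k)) ->
    (forall t : R, is_derive t 1 (h j) (h' t)) ->
    (\int[mu]_x (Re (phi x) * tensor (set_factor h j h') x)%:E =
       - \int[mu]_x (Re (g x) * tensor h x)%:E)%E /\
    (\int[mu]_x (Im (phi x) * tensor (set_factor h j h') x)%:E =
       - \int[mu]_x (Im (g x) * tensor h x)%:E)%E.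
  by split => h h' bh dh; have [] := H h h' bh dh.
move=> bh dh.
have bh' : bump_fun h'.
  have [f df bf] := bump_fun_derive (bh j).
  rewrite (_ : h' = f)//; apply/funext => t.
  by rewrite -(@derive_val _ _ _ _ _ _ _ (dh t)) (@derive_val _ _ _ _ _ _ _ (df t)).
have bu := bump_fun_set_factor j bh bh'.
have := w _ (tensor_test bh); rewrite /Cintegral.
have Dt x : 'D_(basis_rV j) (tensor h) x = tensor (set_factor h j h') x.
  by rewrite (@derive_val _ _ _ _ _ _ _ (is_derive_tensor dh x)).
have fin (u : E -> R) (l : 'I_d -> R -> R) : sq_integrable u ->
    (forall k, bump_fun (l k)) -> (\int[mu]_x (u x * tensor l x)%:E)%E \is a fin_num.
  by move=> su bl; apply: integrable_fin_num => //; exact: sq_integrable_tensor.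
rewrite /Rintegral => -[hr hi]; split.
- rewrite -(fineK (fin _ _ r1 bu)) -(fineK (fin _ _ r2 bh)) -EFinN; congr EFin.
  rewrite (_ : fine (\int[mu]_x (Re (g x) * tensor h x)%:E)%E =
      fine (\int[mu]_x (Re (g x * (tensor h x)%:C))%:E)%E).
    rewrite -hr; congr fine; apply: eq_integral => x _.
    by rewrite Re_mulrC Dt.
  by congr fine; apply: eq_integral => x _; rewrite Re_mulrC.
- rewrite -(fineK (fin _ _ i1 bu)) -(fineK (fin _ _ i2 bh)) -EFinN; congr EFin.
  rewrite (_ : fine (\int[mu]_x (Im (g x) * tensor h x)%:E)%E =
      fine (\int[mu]_x (Im (g x * (tensor h x)%:C))%:E)%E).
    rewrite -hi; congr fine; apply: eq_integral => x _.
    by rewrite Im_mulrC Dt.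
  by congr fine; apply: eq_integral => x _; rewrite Im_mulrC.
Qed.

Lemma real_weak_partial_unique j (u g1 g2 : E -> R) :
  sq_integrable g1 -> sq_integrable g2 ->
  real_weak_partial j u g1 -> real_weak_partial j u g2 ->
  {ae mu, forall x, g1 x = g2 x}.
Proof.
move=> s1 s2 w1 w2.
suff : {ae mu, forall x, g1 x - g2 x = 0} by apply: filterS => x /subr0_eq.
apply: sq_integrable_ae0; first exact: sq_integrableB.
move=> h bh _; have [h' dh bh'] := bump_fun_derive (bh j).
rewrite integralB_tensor//.
have := w1 h h' bh dh; rewrite (w2 h h' bh dh) => /oppe_inj <-.
rewrite subee//; apply: integrable_fin_num => //; exact: sq_integrable_tensor.
Qed.

Lemma weak_partial_unique j phi g1 g2 : L2 phi -> L2 g1 -> L2 g2 ->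
  weak_partial j phi g1 -> weak_partial j phi g2 -> {ae mu, forall x, g1 x = g2 x}.
Proof.
move=> l l1 l2 w1 w2.
have [wr1 wi1] := weak_partial_real l l1 w1.
have [wr2 wi2] := weak_partial_real l l2 w2.
move/L2P : l1 => [r1 i1]; move/L2P : l2 => [r2 i2].
apply: filterS2 (real_weak_partial_unique r1 r2 wr1 wr2)
  (real_weak_partial_unique i1 i2 wi1 wi2) => x.
by case: (g1 x) => a b; case: (g2 x) => a' b' /= -> ->.
Qed.

(** The representative chosen by wD is a genuine weak derivative on H1. *)
Lemma wDP j phi : H1 phi -> L2 (wD j phi) /\ weak_partial j phi (wD j phi).
Proof.
move=> [_ /(_ j)[g lg wg]]; rewrite /wD; case: xgetP => [y _ //|].
by move=> /(_ g) /=; tauto.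
Qed.

End complex_valued.

Section integral_scaling.
Context dsp (T : measurableType dsp) {R : realType} (mu : {measure set T -> \bar R}).
Local Open Scope ereal_scope.
Import HBNNSimple.

Let ge0_integralZ_le (f : T -> \bar R) (t : R) : (0 < t)%R -> (forall x, 0 <= f x) ->
  \int[mu]_x (t%:E * f x) <= t%:E * \int[mu]_x f x.
Proof.
move=> t0 f0.
have tf0 x : 0 <= t%:E * f x by rewrite mule_ge0// lee_fin ltW.
rewrite !ge0_integralTE//; apply: ge_ereal_sup => _ [h /= hf <-].
have ti0 : (0 <= t^-1)%R by rewrite invr_ge0 ltW.
pose h' := scale_nnsfun h ti0.
have -> : sintegral mu h = t%:E * sintegral mu h'.
  have -> : sintegral mu h' = (t^-1)%:E * sintegral mu h.
    by rewrite -sintegralrM.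
  by rewrite muleA -EFinM divff ?gt_eqF// mul1e.
apply: lee_pmul => //; first by rewrite lee_fin ltW.
  exact: sintegral_ge0.
apply: ereal_sup_ubound; exists h' => //= x.
rewrite EFinM -[leRHS]mul1e -(mulVf (lt0r_neq0 t0)) EFinM -muleA.
by apply: lee_pmul => //; rewrite lee_fin// fun_ge0.
Qed.

(** Scaling by t > 0 maps the simple functions below f bijectively onto those below
t f, whether or not f is measurable. In this form it applies to the integrals
that define weak derivatives, where the test function is arbitrary. *)
Lemma ge0_integralZ_pos (f : T -> \bar R) (t : R) : (0 < t)%R -> (forall x, 0 <= f x) ->
  \int[mu]_x (t%:E * f x) = t%:E * \int[mu]_x f x.
Proof.
move=> t0 f0; apply/le_anti/andP; split; first exact: ge0_integralZ_le.
have ti0 : (0 < t^-1)%R by rewrite invr_gt0.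
have tf0 x : 0 <= t%:E * f x by rewrite mule_ge0// lee_fin ltW.
have := ge0_integralZ_le ti0 tf0.
under eq_integral do rewrite muleA -EFinM mulVf ?gt_eqF// mul1e.
move=> h; apply: (@le_trans _ _ (t%:E * (t^-1%:E * \int[mu]_x (t%:E * f x)))).
  by apply: lee_pmul => //; [rewrite lee_fin ltW|exact: integral_ge0].
by rewrite muleA -EFinM divff ?gt_eqF// mul1e.
Qed.

(** The identity also holds when f is not integrable, since scaling by t > 0 does
not change which of the two parts of the integral are infinite. *)
Lemma RintegralZ_pos (f : T -> R) (t : R) : (0 < t)%R ->
  (\int[mu]_x (t * f x) = t * \int[mu]_x f x)%R.
Proof.
move=> t0; rewrite /Rintegral.
have key (P N : \bar R) : 0 <= P -> 0 <= N ->
    (fine (t%:E * P - t%:E * N) = t * fine (P - N))%R.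
  have ty : t%:E * +oo = +oo :> \bar R by rewrite gt0_muley ?lte_fin.
  by case: P => [a||] //; case: N => [b||] // _ _; rewrite ?ty -?EFinM ?EFinN /= ?mulr0 ?mulrBr.
have mE (x : T) : (t * f x)%R%:E = t%:E * (EFin \o f) x by [].
rewrite [in LHS]integralE [in RHS]integralE.
have -> : (fun x => (t * f x)%R%:E)^\+ = (fun x => t%:E * (EFin \o f)^\+ x).
  by rewrite -ge0_funeposM ?ltW.
have -> : (fun x => (t * f x)%R%:E)^\- = (fun x => t%:E * (EFin \o f)^\- x).
  by rewrite -ge0_funenegM ?ltW.
rewrite !ge0_integralZ_pos//.
by apply: key; apply: integral_ge0 => x _; [exact: funepos_ge0|exact: funeneg_ge0].
Qed.

End integral_scaling.

Section H1_facts.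
Context {R : realType} {d : nat}.
Local Notation E := 'rV[R]_d.
Local Notation mu := (@lebesgue_rV R d).
Local Notation cmod := ComplexField.Normc.normc.
Local Notation Re := complex.Re.
Local Notation Im := complex.Im.
Implicit Types (phi psi g : E -> R[i]) (j : 'I_d).
Local Open Scope complex_scope.

Lemma CintegralZ (t : R) (phi : E -> R[i]) : 0 < t ->
  Cintegral (fun x => t%:C * phi x) = t%:C * Cintegral phi.
Proof.
move=> t0; rewrite /Cintegral.
have hr : \int[mu]_x Re (t%:C * phi x) = t * \int[mu]_x Re (phi x).
  by rewrite -RintegralZ_pos//; apply: eq_Rintegral => x _; exact: Re_mulCr.
have hi : \int[mu]_x Im (t%:C * phi x) = t * \int[mu]_x Im (phi x).
  by rewrite -RintegralZ_pos//; apply: eq_Rintegral => x _; exact: Im_mulCr.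
by rewrite hr hi; apply/eqP; rewrite eq_complex/= !mul0r subr0 addr0 !eqxx.
Qed.

Lemma weak_partialZ (t : R) j phi g : 0 < t -> weak_partial j phi g ->
  weak_partial j (fun x => t%:C * phi x) (fun x => t%:C * g x).
Proof.
move=> t0 w eta te.
have e1 : (fun x => t%:C * phi x * ('D_(basis_rV j) eta x)%:C) =
   (fun x => t%:C * (phi x * ('D_(basis_rV j) eta x)%:C)).
  by apply/funext => x; rewrite mulrA.
have e2 : (fun x => t%:C * g x * (eta x)%:C) = (fun x => t%:C * (g x * (eta x)%:C)).
  by apply/funext => x; rewrite mulrA.
by rewrite e1 e2 !CintegralZ// (w _ te) mulrN.
Qed.

Lemma H1Z (t : R) phi : 0 < t -> H1 phi -> H1 (fun x => t%:C * phi x).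
Proof.
move=> t0 [l2 hw]; split; first exact: L2Z.
move=> j; have [g lg wg] := hw j.
by exists (fun x => t%:C * g x); [exact: L2Z|exact: weak_partialZ].
Qed.

(** The chosen representatives of the two derivatives are unrelated; they agree
almost everywhere by uniqueness of weak derivatives. *)
Lemma wDZ (t : R) j phi : 0 < t -> H1 phi ->
  {ae mu, forall x, wD j (fun x => t%:C * phi x) x = t%:C * wD j phi x}.
Proof.
move=> t0 h1; have [l2 _] := h1.
have [l w] := wDP j h1; have [l' w'] := wDP j (H1Z t0 h1).
apply: weak_partial_unique l' (L2Z t l) w' (weak_partialZ t0 w).
exact: L2Z.
Qed.

Definition grad_mass phi : \bar R := (\int[mu]_x (grad_sqr phi x)%:E)%E.

Lemma grad_integrable phi : H1 phi ->
  mu.-integrable [set: E] (fun x => (grad_sqr phi x)%:E).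
Proof.
move=> h1; rewrite /grad_sqr.
under eq_fun do rewrite -sumEFin.
by apply: integrable_sum => // j _; apply: L2_integrable; have [] := wDP j h1.
Qed.

End H1_facts.

(** * Sobolev inequality on H1 *)

Section H1_shift.
Context {R : realType} {d : nat}.
Local Notation E := 'rV[R]_d.
Local Notation mu := (@lebesgue_rV R d).
Local Notation cmod := ComplexField.Normc.normc.
Local Notation Re := complex.Re.
Local Notation Im := complex.Im.
Implicit Types (u : E -> R) (phi psi g : E -> R[i]) (j : 'I_d).

(** The constant 2^n instead of the optimal n keeps the induction elementary. *)
Lemma sqr_sum_le n (a : nat -> R) :
  (\sum_(0 <= k < n) a k) ^+ 2 <= 2 ^+ n * \sum_(0 <= k < n) a k ^+ 2.
Proof.
elim: n => [|n IH]; first by rewrite !big_nil expr0n mulr0.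
rewrite !big_nat_recr//=; set S := \sum_(0 <= k < n) a k.
have Q0 : 0 <= \sum_(0 <= k < n) a k ^+ 2 by apply: sumr_ge0 => k _; exact: sqr_ge0.
have p1 : 1 <= 2 ^+ n :> R by rewrite exprn_ege1// ler1n.
have : (S + a n) ^+ 2 <= 2 * S ^+ 2 + 2 * a n ^+ 2.
  have : 0 <= (S - a n) ^+ 2 by exact: sqr_ge0.
  by rewrite sqrrB sqrrD; lra.
move/le_trans; apply; rewrite (exprS _ n).
have := ler_wpM2r (sqr_ge0 (a n)) p1; rewrite mul1r.
move: IH; rewrite -/S => IH h.
rewrite -mulrA -mulrDr ler_pM2l//; apply: (le_trans (lerD IH h)).
by rewrite -mulrDr.
Qed.

(** Interpolates between 0 and y one coordinate at a time. *)
Definition partial_shift (y : E) (n : nat) : E :=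
  \sum_(i < d | (i < n)%N) y ord0 i *: basis_rV i.

Lemma partial_shift0 y : partial_shift y 0 = 0.
Proof. by rewrite /partial_shift big1. Qed.

Lemma partial_shiftS y j :
  partial_shift y j.+1 = partial_shift y j + y ord0 j *: basis_rV j.
Proof.
rewrite /partial_shift (bigD1 j)//= addrC; congr (_ + _).
apply: eq_bigl => i; rewrite ltnS ltn_neqAle andbC.
by congr (_ && _).
Qed.

Lemma partial_shift_full y : partial_shift y d = y.
Proof.
rewrite /partial_shift; apply/rowP => k; rewrite summxE (bigD1 k)//= big1.
  by rewrite addr0 !mxE !eqxx mulr1.
by move=> i /andP[_ /negbTE ik]; rewrite !mxE eqxx/= eq_sym ik mulr0.
Qed.

(** Telescope u (x + y) - u x along the partial shifts: each term is a translate of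
a difference in a single coordinate direction. *)
Lemma shift_estimate_all u (g : 'I_d -> E -> R) (r : R) (y : E) :
  sq_integrable u -> (forall j, sq_integrable (g j)) ->
  (forall j, real_weak_partial j u (g j)) -> obox (fun=> 0) (fun=> r) y ->
  (\int[mu]_x ((u (x + y)%R - u x) ^+ 2)%:E <=
   (2 ^+ d * r ^+ 2)%:E * \sum_(j < d) \int[mu]_x (g j x ^+ 2)%:E)%E.
Proof.
move=> su sg w yr.
pose D (k : nat) x := u (x + partial_shift y k.+1) - u (x + partial_shift y k).
have sD k : sq_integrable (D k).
  by apply: sq_integrableB; exact: sq_integrable_shift.
have mD k : measurable_fun [set: E] (fun x => (D k x ^+ 2)%:E).
  by apply/measurable_EFinP; apply: measurable_funX; case: (sD k).
apply: (@le_trans _ _ (\int[mu]_x ((2 ^+ d)%:E * \sum_(j < d) (D j x ^+ 2)%:E))%E).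
  apply: ge0_le_integral => //.
  - by move=> x _; rewrite lee_fin sqr_ge0.
  - apply/measurable_EFinP; apply: measurable_funX.
    by apply: measurable_funB; [have [] := sq_integrable_shift y su|case: su].
  - by apply: emeasurable_funM => //; exact: emeasurable_sum.
  move=> x _; rewrite sumEFin -EFinM lee_fin.
  have -> : u (x + y) - u x = \sum_(0 <= k < d) D k x.
    by rewrite telescope_sumr// partial_shift_full partial_shift0 addr0.
  by apply: le_trans (sqr_sum_le _ _) _; rewrite big_mkord.
rewrite ge0_integralZl ?lee_fin//; first last.
- by move=> x _; rewrite sume_ge0// => j _; rewrite lee_fin sqr_ge0.
- exact: emeasurable_sum.
rewrite ge0_integral_sum//; last by move=> j x _; rewrite lee_fin sqr_ge0.
rewrite EFinM -muleA; apply: lee_pmul => //; first by apply: sume_ge0 => j _; apply: integral_ge0 => x _; rewrite lee_fin sqr_ge0.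
rewrite ge0_sume_distrr; last first.
  by move=> j _; apply: integral_ge0 => x _; rewrite lee_fin sqr_ge0.
apply: lee_sum => j _.
have := yr j; rewrite /= in_itv/= => /andP[y0 y1].
apply: (@le_trans _ _ ((y ord0 j ^+ 2)%:E * \int[mu]_x (g j x ^+ 2)%:E)%E); last first.
  apply: lee_pmul => //; rewrite ?lee_fin ?sqr_ge0//.
    by apply: integral_ge0 => x _; rewrite lee_fin sqr_ge0.
  by rewrite lerXn2r ?nnegrE ?(ltW y0) ?ltW// (lt_trans y0).
apply: le_trans (shift_estimate y0 su (sg j) (w j)).
rewrite le_eqVlt; apply/orP; left; apply/eqP.
have mf : measurable_fun [set: E]
    (fun x => ((u (x + y ord0 j *: basis_rV j) - u x) ^+ 2)%:E).
  apply/measurable_EFinP; apply: measurable_funX; apply: measurable_funB.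
    by have [] := sq_integrable_shift (y ord0 j *: basis_rV j) su.
  by case: su.
rewrite -(ge0_integral_shift (partial_shift y j) mf); last first.
  by move=> x; rewrite lee_fin sqr_ge0.
by apply: eq_integral => x _; rewrite /D partial_shiftS addrA.
Qed.

Lemma cmod_reverse_triangle (z w : R[i]) :
  (cmod z - cmod w) ^+ 2 <= (Re z - Re w) ^+ 2 + (Im z - Im w) ^+ 2.
Proof.
have h : Re z * Re w + Im z * Im w <= cmod z * cmod w.
  have [h0|h0] := leP (Re z * Re w + Im z * Im w) 0.
    by rewrite (le_trans h0)// mulr_ge0 ?cmod_ge0.
  rewrite -(@ler_pXn2r _ 2) ?nnegrE ?(ltW h0) ?mulr_ge0 ?cmod_ge0//.
  rewrite exprMn !cmodE.
  have : 0 <= (Re z * Im w - Im z * Re w) ^+ 2 by exact: sqr_ge0.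
  by rewrite !expr2; lra.
by rewrite sqrrB !cmodE [leRHS](_ : _ = Re z ^+ 2 + Im z ^+ 2 + (Re w ^+ 2 + Im w ^+ 2)
   - (Re z * Re w + Im z * Im w) *+ 2); [lra|ring].
Qed.

(** The modulus is 1-Lipschitz, so the translation estimates for the real and
imaginary parts add up to one for the modulus. *)
Lemma H1_shift_bound phi (G : R) : H1 phi -> (grad_mass phi <= G%:E)%E ->
  shift_bound (2 ^+ d * G) (fun x => cmod (phi x)).
Proof.
move=> h1 hG r y r0 yr; have [l2 _] := h1.
have [sr si] := (L2P phi).1 l2.
have wd j := wDP j h1.
have sgr j : sq_integrable (fun x => Re (wD j phi x)).
  by have [lj _] := wd j; have [] := (L2P _).1 lj.
have sgi j : sq_integrable (fun x => Im (wD j phi x)).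
  by have [lj _] := wd j; have [] := (L2P _).1 lj.
have wr j : real_weak_partial j (fun x => Re (phi x)) (fun x => Re (wD j phi x)).
  by have [lj wj] := wd j; have [] := weak_partial_real l2 lj wj.
have wi j : real_weak_partial j (fun x => Im (phi x)) (fun x => Im (wD j phi x)).
  by have [lj wj] := wd j; have [] := weak_partial_real l2 lj wj.
have er := shift_estimate_all sr sgr wr yr.
have ei := shift_estimate_all si sgi wi yr.
have msq (u : E -> R) : sq_integrable u -> measurable_fun [set: E] (fun x => (u x ^+ 2)%:E).
  by move=> [m _]; apply/measurable_EFinP; exact: measurable_funX.
have sdr : sq_integrable (fun x => Re (phi (x + y)) - Re (phi x)).
  by apply: sq_integrableB => //; exact: (sq_integrable_shift y sr).
have sdi : sq_integrable (fun x => Im (phi (x + y)) - Im (phi x)).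
  by apply: sq_integrableB => //; exact: (sq_integrable_shift y si).
have mc := measurable_cmod l2.1.
apply: (@le_trans _ _ (\int[mu]_x (((Re (phi (x + y)) - Re (phi x)) ^+ 2)%:E +
   ((Im (phi (x + y)) - Im (phi x)) ^+ 2)%:E)%E)%E).
  apply: ge0_le_integral => //.
  - by move=> x _; rewrite lee_fin sqr_ge0.
  - apply/measurable_EFinP; apply: measurable_funX; apply: measurable_funB => //.
    exact: (measurableT_comp mc (measurable_shift y)).
  - by apply: emeasurable_funD; [exact: msq sdr|exact: msq sdi].
  by move=> x _; rewrite -EFinD lee_fin; exact: cmod_reverse_triangle.
rewrite ge0_integralD//; [|by move=> x _; rewrite lee_fin sqr_ge0|exact: msq sdr
  |by move=> x _; rewrite lee_fin sqr_ge0|exact: msq sdi].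
apply: (le_trans (leeD er ei)).
rewrite -ge0_muleDr; [|by apply: sume_ge0 => j _; apply: integral_ge0 => x _;
   rewrite lee_fin sqr_ge0..].
rewrite mulrAC (EFinM (2 ^+ d * r ^+ 2)); apply: lee_pmul => //.
- by rewrite lee_fin mulr_ge0 ?sqr_ge0.
- by apply: adde_ge0; apply: sume_ge0 => j _; apply: integral_ge0 => x _;
    rewrite lee_fin sqr_ge0.
apply: le_trans hG; rewrite /grad_mass /grad_sqr.
under [leRHS]eq_integral do rewrite -sumEFin.
rewrite ge0_integral_sum//; first last.
- by move=> j x _; rewrite lee_fin sqr_ge0.
- move=> j; apply/measurable_EFinP; apply: measurable_funX; apply: measurable_cmod.
  by have [[]] := wd j.
rewrite -big_split/=; apply: lee_sum => j _.
rewrite -ge0_integralD//; [|by move=> x _; rewrite lee_fin sqr_ge0|exact: msq (sgr j)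
  |by move=> x _; rewrite lee_fin sqr_ge0|exact: msq (sgi j)].
rewrite le_eqVlt; apply/orP; left; apply/eqP; apply: eq_integral => x _.
by rewrite -EFinD cmodE.
Qed.

Lemma sobolev_subcritical (q G : R) : (1 < d)%N -> 2 < q ->
  q * (1 - 2 / d%:R) < 2 -> 0 < G ->
  exists2 K : R, 0 < K & forall phi, H1 phi -> (sqmass phi <= 1)%E ->
    (grad_mass phi <= G%:E)%E -> (qmass q phi <= K%:E)%E.
Proof.
move=> hd q2 qd G0.
have C0 : 0 < 2 ^+ d * G by rewrite mulr_gt0// exprn_gt0.
have [K K0 HK] := moment_bound hd C0 q2 qd.
exists K => // phi h1 m1 gG; apply: HK => //.
- by apply: measurable_cmod; have [[]] := h1.
- by move=> x; exact: cmod_ge0.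
- exact: H1_shift_bound.
Qed.

End H1_shift.

(** * The rotating energy *)

Section energy.
Context {R : realType} {d : nat} (hd : (1 < d)%N).
Local Notation E := 'rV[R]_d.
Local Notation mu := (@lebesgue_rV R d).
Local Notation cmod := ComplexField.Normc.normc.
Local Notation Re := complex.Re.
Local Notation Im := complex.Im.
Implicit Types (phi psi g : E -> R[i]) (x : E).
Local Open Scope complex_scope.
Local Notation a1 := (axis1 hd).
Local Notation a2 := (axis2 hd).

Definition rho2 x : R := x ord0 a1 ^+ 2 + x ord0 a2 ^+ 2.

Definition rotation_density phi x : R := Re (conjc (phi x) * Lz hd phi x).

Lemma rotation_densityE phi x : rotation_density phi x =
  Im (phi x) * (x ord0 a2 * Re (wD a1 phi x) - x ord0 a1 * Re (wD a2 phi x))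
  - Re (phi x) * (x ord0 a2 * Im (wD a1 phi x) - x ord0 a1 * Im (wD a2 phi x)).
Proof.
rewrite /rotation_density /Lz.
by case: (phi x) => a b; case: (wD a1 phi x) => c1 e1; case: (wD a2 phi x) => c2 e2 /=; ring.
Qed.

Lemma grad_sqr_axes phi x :
  cmod (wD a1 phi x) ^+ 2 + cmod (wD a2 phi x) ^+ 2 <= grad_sqr phi x.
Proof.
rewrite /grad_sqr (bigD1 a1)//= (bigD1 a2)//= addrA lerDl.
by apply: sumr_ge0 => j _; exact: sqr_ge0.
Qed.

Lemma grad_sqr_ge0 phi x : 0 <= grad_sqr phi x.
Proof. by apply: sumr_ge0 => j _; exact: sqr_ge0. Qed.

(** The difference of the two sides is half the sum of the squares
(t c1 - ga b x2)^2, (t c2 + ga b x1)^2, (t e1 + ga a x2)^2, (t e2 - ga a x1)^2,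
plus a nonnegative multiple of the slack in the hypothesis on G, where t = Om / ga,
z = a + i b, w1 = c1 + i e1 and w2 = c2 + i e2. *)
Lemma rotation_young (Om ga G x1 x2 : R) (z w1 w2 : R[i]) : 0 < ga ->
  cmod w1 ^+ 2 + cmod w2 ^+ 2 <= G ->
  Om * (Im z * (x2 * Re w1 - x1 * Re w2) - Re z * (x2 * Im w1 - x1 * Im w2)) <=
  1 / 2 * (Om / ga) ^+ 2 * G + ga ^+ 2 / 2 * (x1 ^+ 2 + x2 ^+ 2) * cmod z ^+ 2.
Proof.
move=> ga0; rewrite (cmodE w1) (cmodE w2) (cmodE z).
move: (Re z) (Im z) (Re w1) (Im w1) (Re w2) (Im w2) => a b c1 e1 c2 e2 hG.
move tE : (Om / ga) => t; have -> : Om = t * ga by rewrite -tE divfK// gt_eqF.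
have h : t ^+ 2 * (c1 ^+ 2 + e1 ^+ 2 + (c2 ^+ 2 + e2 ^+ 2)) <= t ^+ 2 * G.
  by rewrite ler_wpM2l ?sqr_ge0.
have : 0 <= (t * c1 - ga * (b * x2)) ^+ 2 + (t * c2 + ga * (b * x1)) ^+ 2
   + (t * e1 + ga * (a * x2)) ^+ 2 + (t * e2 - ga * (a * x1)) ^+ 2.
  by rewrite !addr_ge0 ?sqr_ge0.
have -> : (t * c1 - ga * (b * x2)) ^+ 2 + (t * c2 + ga * (b * x1)) ^+ 2
   + (t * e1 + ga * (a * x2)) ^+ 2 + (t * e2 - ga * (a * x1)) ^+ 2 =
  t ^+ 2 * (c1 ^+ 2 + e1 ^+ 2 + (c2 ^+ 2 + e2 ^+ 2)) +
  ga ^+ 2 * (x1 ^+ 2 + x2 ^+ 2) * (a ^+ 2 + b ^+ 2) -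
  2 * (t * ga * (b * (x2 * c1 - x1 * c2) - a * (x2 * e1 - x1 * e2))) by ring.
set A := t ^+ 2 * (_ + _) in h *; set B := ga ^+ 2 * _ * _.
set D := t * ga * _ => hABD.
rewrite (_ : ga ^+ 2 / 2 * _ * _ = B / 2); last by rewrite /B; ring.
by rewrite -mulrA; set T := t ^+ 2 * G in h *; lra.
Qed.

Lemma rotation_le (Om ga : R) phi x : 0 < ga ->
  Om * rotation_density phi x <=
  1 / 2 * (Om / ga) ^+ 2 * grad_sqr phi x +
  ga ^+ 2 / 2 * rho2 x * cmod (phi x) ^+ 2.
Proof.
move=> ga0; rewrite rotation_densityE.
exact: rotation_young ga0 (grad_sqr_axes phi x).
Qed.

Variables (V : E -> R) (Om ga : R).
Hypotheses (mV : measurable_fun [set: E] V) (V0 : forall x, 0 <= V x).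
Hypotheses (Om0 : 0 < Om) (Omga : Om < ga).

(** The potential that remains once the rotation has been absorbed into a part of
the kinetic energy. It tends to infinity for some ga > Om, by definition of the
maximal rotation speed. *)
Definition reduced_potential x : R := V x - ga ^+ 2 / 2 * rho2 x.
Local Notation U := reduced_potential.
Hypothesis Uoo : cvg_pinfty_at_infinity U.

Let ga0 : 0 < ga. Proof. exact: lt_trans Om0 Omga. Qed.

Lemma rho2_le x : rho2 x <= enorm x ^+ 2.
Proof.
rewrite /enorm sqr_sqrtr; last by apply: sumr_ge0 => j _; exact: sqr_ge0.
rewrite (bigD1 a1)//= (bigD1 a2)//= addrA lerDl.
by apply: sumr_ge0 => j _; exact: sqr_ge0.
Qed.

Lemma reduced_potential_bounded_below : exists2 K : R, 0 <= K & forall x, 0 <= U x + K.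
Proof.
have [r hr] := Uoo 0; exists (ga ^+ 2 / 2 * r ^+ 2).
  by rewrite mulr_ge0 ?sqr_ge0// divr_ge0 ?sqr_ge0.
move=> x; have [/hr Ux|xr] := leP r (enorm x).
  by rewrite addr_ge0// mulr_ge0 ?sqr_ge0// divr_ge0 ?sqr_ge0.
rewrite /U -addrA addr_ge0//; have g0 : 0 <= ga ^+ 2 / 2 by rewrite divr_ge0 ?sqr_ge0.
rewrite addrC -mulrBr mulr_ge0// subr_ge0 (le_trans (rho2_le x))//.
by rewrite lerXn2r ?nnegrE ?sqrtr_ge0 ?(ltW xr)// (le_trans (sqrtr_ge0 _) (ltW xr)).
Qed.

Lemma reduced_potential_large (A : R) : exists n, forall x, ~ cube n x -> A <= U x.
Proof.
have [r hr] := Uoo A; exists (Num.truncn `|r|).+1 => x xc; apply: hr.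
move: xc => /existsNP[k]; rewrite /= in_itv/= -ltr_norml => /negP; rewrite -leNgt => xk.
apply: (le_trans (ler_norm r)); apply: (le_trans (ltW (truncnS_gt _))).
apply: (le_trans xk); rewrite -(@ler_pXn2r _ 2) ?nnegrE ?sqrtr_ge0//.
rewrite /enorm sqr_sqrtr; last by apply: sumr_ge0 => j _; exact: sqr_ge0.
rewrite real_normK ?num_real// (bigD1 k)//= lerDl.
by apply: sumr_ge0 => j _; exact: sqr_ge0.
Qed.

Lemma measurable_rho2 : measurable_fun [set: E] rho2.
Proof. by apply: measurable_funD; apply: measurable_funX; exact: measurable_coord. Qed.

Section fixed_phi.
Variables (phi : E -> R[i]) (Xphi : Xspace V phi).

Let h1 : H1 phi. Proof. by have [] := Xphi. Qed.
Let l2 : L2 phi. Proof. by have [] := h1. Qed.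
Let mc : measurable_fun [set: E] (fun x => cmod (phi x)).
Proof. by apply: measurable_cmod; have [] := l2. Qed.

Lemma integrable_mass : mu.-integrable [set: E] (EFin \o (fun x => cmod (phi x) ^+ 2)).
Proof. exact: L2_integrable. Qed.

Lemma integrable_potential :
  mu.-integrable [set: E] (EFin \o (fun x => V x * cmod (phi x) ^+ 2)).
Proof.
apply/integrableP; split.
  by apply/measurable_EFinP; apply: measurable_funM => //; exact: measurable_funX.
have [_] := Xphi; congr (_ < _)%E; apply: eq_integral => x _.
by rewrite /= ger0_norm// mulr_ge0 ?sqr_ge0.
Qed.

Lemma integrable_grad : mu.-integrable [set: E] (EFin \o grad_sqr phi).
Proof. exact: grad_integrable. Qed.

(** The potential controls rho2 up to a constant, since U is bounded below. *)
Lemma integrable_rho2 :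
  mu.-integrable [set: E] (EFin \o (fun x => rho2 x * cmod (phi x) ^+ 2)).
Proof.
have [K K0 UK] := reduced_potential_bounded_below.
have g2 : 0 < ga ^+ 2 / 2 by rewrite divr_gt0 ?exprn_gt0.
apply: (le_integrable_real (g := fun x =>
   (ga ^+ 2 / 2)^-1 * (V x * cmod (phi x) ^+ 2) + (ga ^+ 2 / 2)^-1 * K * cmod (phi x) ^+ 2)).
- by apply: measurable_funM; [exact: measurable_rho2|exact: measurable_funX].
- rewrite [X in integrable _ _ X](_ : _ = (fun x =>
    ((ga ^+ 2 / 2)^-1)%:E * (V x * cmod (phi x) ^+ 2)%R%:E
    + ((ga ^+ 2 / 2)^-1 * K)%:E * (cmod (phi x) ^+ 2)%R%:E)%E)//.
  apply: integrableD => //; apply: integrableZl => //.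
    exact: integrable_potential.
  exact: integrable_mass.
- move=> x; rewrite ger0_norm; last by rewrite mulr_ge0 ?addr_ge0 ?sqr_ge0.
  rewrite [leRHS](_ : _ = (ga ^+ 2 / 2)^-1 * (V x + K) * cmod (phi x) ^+ 2); last by ring.
  rewrite ler_wpM2r ?sqr_ge0// ler_pdivlMl//.
  by have := UK x; rewrite /U; lra.
Qed.

(** Dominate by [rotation_le] with ga = 1 and Om = 1 or Om = -1. *)
Lemma integrable_rotation :
  mu.-integrable [set: E] (EFin \o rotation_density phi).
Proof.
have wd j := wDP j h1.
have mwr j : measurable_fun [set: E] (fun x => Re (wD j phi x)).
  by have [[[]]] := wd j.
have mwi j : measurable_fun [set: E] (fun x => Im (wD j phi x)).
  by have [[[]]] := wd j.
have [[mr mi] _] := l2.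
have mrot : measurable_fun [set: E] (rotation_density phi).
  rewrite (funext (rotation_densityE phi)).
  apply: measurable_funB; apply: measurable_funM => //; apply: measurable_funB;
    apply: measurable_funM => //; exact: measurable_coord.
apply: (le_integrable_real (g := fun x =>
   1 / 2 * grad_sqr phi x + 1 / 2 * (rho2 x * cmod (phi x) ^+ 2))) => //.
- rewrite [X in integrable _ _ X](_ : _ = (fun x =>
    (1 / 2)%:E * (grad_sqr phi x)%:E
    + (1 / 2)%:E * (rho2 x * cmod (phi x) ^+ 2)%R%:E)%E)//.
  apply: integrableD => //; apply: integrableZl => //.
    exact: integrable_grad.
  exact: integrable_rho2.
- move=> x; have h := rotation_le 1 phi x ltr01.
  have h' := rotation_le (-1) phi x ltr01.
  rewrite ler_norml; apply/andP; split; [move: h'|move: h];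
    by rewrite ?divr1 ?sqrrN ?expr1n; lra.
Qed.

Definition energy_density x : R :=
  1 / 2 * grad_sqr phi x + V x * cmod (phi x) ^+ 2 - Om * rotation_density phi x.

Lemma integrable_energy : mu.-integrable [set: E] (EFin \o energy_density).
Proof.
rewrite [X in integrable _ _ X](_ : _ = (fun x =>
    (1 / 2)%:E * (grad_sqr phi x)%:E + (V x * cmod (phi x) ^+ 2)%R%:E
    - Om%:E * (rotation_density phi x)%:E)%E)//.
apply: integrableB => //; last by apply: integrableZl => //; exact: integrable_rotation.
apply: integrableD => //; last exact: integrable_potential.
by apply: integrableZl => //; exact: integrable_grad.
Qed.

Lemma linear_energyE : linear_energy hd V Om phi = \int[mu]_x energy_density x.
Proof.
rewrite /linear_energy /Cintegral /=; apply: eq_Rintegral => x _.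
rewrite /energy_density /rotation_density.
by case: (conjc (phi x) * Lz hd phi x) => a b /=; rewrite mul0r subr0.
Qed.

Lemma energy_split : \int[mu]_x energy_density x =
  1 / 2 * (\int[mu]_x grad_sqr phi x) + (\int[mu]_x (V x * cmod (phi x) ^+ 2))
  - Om * \int[mu]_x rotation_density phi x.
Proof.
have ig := integrable_grad; have iv := integrable_potential; have ir := integrable_rotation.
have i1 : mu.-integrable [set: E] (EFin \o (fun x => 1 / 2 * grad_sqr phi x)).
  exact: (integrableZl measurableT (1 / 2) ig).
have i2 : mu.-integrable [set: E] (EFin \o (fun x => Om * rotation_density phi x)).
  exact: (integrableZl measurableT Om ir).
have i3 : mu.-integrable [set: E]
    (EFin \o (fun x => 1 / 2 * grad_sqr phi x + V x * cmod (phi x) ^+ 2)).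
  exact: (integrableD measurableT i1 iv).
by rewrite /energy_density RintegralB// RintegralD// !RintegralZl.
Qed.

Definition mass : R := fine (sqmass phi).

Lemma actionE (p om : R) : 0 < p + 1 -> action hd p V Om om phi =
  linear_energy hd V Om phi + 2 / (p + 1) * fine (qmass (p + 1) phi) + om * mass.
Proof.
move=> p0; rewrite /action linear_energyE energy_split Lqnorm_powR// Lqnorm2.
have -> : Re (angular_momentum hd phi) = \int[mu]_x rotation_density phi x by [].
rewrite -/mass; ring.
Qed.

Lemma mass_ge0 : 0 <= mass.
Proof. by rewrite fine_ge0// integral_ge0// => x _; rewrite lee_fin sqr_ge0. Qed.

(** The coefficient kappa is positive because the part (Om / ga)^2 / 2 of the
kinetic energy that absorbs the rotation is less than 1/2. *)
Lemma energy_ge (kappa K : R) : kappa = (1 - (Om / ga) ^+ 2) / 2 ->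
  forall x, kappa * grad_sqr phi x + (U x + K) * cmod (phi x) ^+ 2 <=
    energy_density x + K * cmod (phi x) ^+ 2.
Proof.
move=> -> x; have := rotation_le Om phi x ga0.
by rewrite /energy_density /U; lra.
Qed.

Lemma integrable_energyK (K : R) : mu.-integrable [set: E]
  (EFin \o (fun x => energy_density x + K * cmod (phi x) ^+ 2)).
Proof.
exact: (integrableD measurableT integrable_energy
  (integrableZl measurableT K integrable_mass)).
Qed.

Lemma RintegralK (K : R) : \int[mu]_x (energy_density x + K * cmod (phi x) ^+ 2) =
  linear_energy hd V Om phi + K * mass.
Proof.
rewrite RintegralD//; last 2 first.
- exact: integrable_energy.
- exact: (integrableZl measurableT K integrable_mass).
rewrite -linear_energyE RintegralZl//; exact: integrable_mass.
Qed.

Lemma grad_le_energy (K : R) : (forall x, 0 <= U x + K) ->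
  (1 - (Om / ga) ^+ 2) / 2 * fine (grad_mass phi) <=
  linear_energy hd V Om phi + K * mass.
Proof.
move=> UK; rewrite -RintegralK.
rewrite (_ : fine _ = \int[mu]_x grad_sqr phi x)// -RintegralZl//; last exact: integrable_grad.
apply: le_Rintegral_setT; [exact: (integrableZl measurableT _ integrable_grad)
  |exact: integrable_energyK|].
move=> x; apply: le_trans (energy_ge K erefl x).
by rewrite lerDl mulr_ge0 ?sqr_ge0.
Qed.

(** Confinement: outside the cube U + K is at least A, so the mass there is at most
(Q + K M) / A. *)
Lemma tail_le_energy (K A : R) n : 0 <= A -> (forall x, 0 <= U x + K) ->
  (forall x, ~ cube n x -> A <= U x + K) ->
  A * (mass - \int[mu]_x (\1_(cube n) x * cmod (phi x) ^+ 2)) <=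
  linear_energy hd V Om phi + K * mass.
Proof.
move=> A0 UK UA; rewrite -RintegralK.
have ic : mu.-integrable [set: E] (EFin \o (fun x => \1_(cube n) x * cmod (phi x) ^+ 2)).
  apply: (le_integrable_real _ integrable_mass).
    apply: measurable_funM; last exact: measurable_funX.
    by apply: measurable_indic; exact: measurable_cube.
  move=> x; rewrite indicE; case: (_ \in _); rewrite ?mul1r ?mul0r ?normr0 ?sqr_ge0//.
  by rewrite ger0_norm ?sqr_ge0.
have -> : mass = \int[mu]_x (cmod (phi x) ^+ 2) by [].
have ib : mu.-integrable [set: E]
    (EFin \o (fun x => cmod (phi x) ^+ 2 - \1_(cube n) x * cmod (phi x) ^+ 2)).
  exact: (integrableB measurableT integrable_mass ic).
rewrite -RintegralB//; last exact: integrable_mass.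
rewrite -RintegralZl//.
apply: le_Rintegral_setT; [exact: (integrableZl measurableT A ib)|exact: integrable_energyK|].
move=> x; apply: le_trans (energy_ge K erefl x).
have k0 : 0 <= (1 - (Om / ga) ^+ 2) / 2.
  rewrite divr_ge0// subr_ge0 expr_le1// ?divr_ge0 ?ltW//.
  by rewrite ltr_pdivrMr// mul1r.
apply: (@le_trans _ _ ((U x + K) * cmod (phi x) ^+ 2)); last first.
  by rewrite lerDr mulr_ge0// grad_sqr_ge0.
rewrite indicE; have [_|] := boolP (x \in _).
  by rewrite mul1r subrr mulr0 mulr_ge0 ?sqr_ge0.
by rewrite notin_setE => /UA h; rewrite mul0r subr0 ler_wpM2r ?sqr_ge0.
Qed.

(** Where |phi| <= tau use |phi|^2 <= tau^2, elsewhere use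
|phi|^2 <= tau^(2 - q) |phi|^q. This replaces Hoelder's inequality on the
cube. *)
Lemma local_mass_le (q tau : R) n : 2 < q -> 0 < tau -> (qmass q phi < +oo)%E ->
  \int[mu]_x (\1_(cube n) x * cmod (phi x) ^+ 2) <=
  tau ^+ 2 * fine (mu (cube n)) + tau `^ (2 - q) * fine (qmass q phi).
Proof.
move=> q2 tau0 fq.
have iq : mu.-integrable [set: E] (EFin \o (fun x => cmod (phi x) `^ q)).
  apply/integrableP; split.
    by apply/measurable_EFinP; exact: (measurableT_comp (measurable_powR q)).
  by under eq_integral do rewrite /= ger0_norm ?powR_ge0//.
have i1 : mu.-integrable [set: E] (EFin \o (fun x => tau ^+ 2 * \1_(cube n) x)).
  by apply: integrable_cst_indic; [exact: measurable_cube|exact: cube_fin].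
have i2 : mu.-integrable [set: E] (EFin \o (fun x => tau `^ (2 - q) * cmod (phi x) `^ q)).
  exact: (integrableZl measurableT _ iq).
have i12 : mu.-integrable [set: E]
    (EFin \o (fun x => tau ^+ 2 * \1_(cube n) x + tau `^ (2 - q) * cmod (phi x) `^ q)).
  exact: (integrableD measurableT i1 i2).
apply: (@le_trans _ _ (\int[mu]_x
    (tau ^+ 2 * \1_(cube n) x + tau `^ (2 - q) * cmod (phi x) `^ q))); last first.
  rewrite RintegralD//; apply: lerD; last by rewrite RintegralZl.
  have -> : \int[mu]_x (tau ^+ 2 * \1_(cube n) x) = tau ^+ 2 * fine (mu (cube n)).
    rewrite RintegralZl//; last first.
      have := @integrable_cst_indic _ E R mu 1 (cube n) (@measurable_cube R d n) (cube_fin n).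
      by under [X in integrable _ _ X]eq_fun do rewrite mul1r.
    rewrite /Rintegral integral_indic ?setIT//; exact: measurable_cube.
  by [].
apply: le_Rintegral_setT => //.
  apply: (le_integrable_real _ integrable_mass).
    apply: measurable_funM; last exact: measurable_funX.
    by apply: measurable_indic; exact: measurable_cube.
  move=> x; rewrite indicE; case: (_ \in _); rewrite ?mul1r ?mul0r ?normr0 ?sqr_ge0//.
  by rewrite ger0_norm ?sqr_ge0.
move=> x; rewrite indicE; case: (_ \in _); rewrite ?mul1r ?mul0r ?mulr0 ?mulr1; last first.
  by rewrite add0r mulr_ge0 ?powR_ge0.
have [ct|ct] := leP (cmod (phi x)) tau.
  rewrite (@le_trans _ _ (tau ^+ 2))//; last by rewrite lerDl mulr_ge0 ?powR_ge0.
  by rewrite lerXn2r ?nnegrE ?cmod_ge0// ltW.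
have c0 : 0 < cmod (phi x) := lt_trans tau0 ct.
rewrite (@le_trans _ _ (tau `^ (2 - q) * cmod (phi x) `^ q))//; last by rewrite lerDr sqr_ge0.
have -> : cmod (phi x) ^+ 2 = cmod (phi x) `^ (2 - q) * cmod (phi x) `^ q.
  rewrite -powRD ?subrK; first by rewrite (powR_mulrn 2)// cmod_ge0.
  by rewrite gt_eqF ?implybT.
rewrite ler_wpM2r ?powR_ge0//.
rewrite -[2 - q]opprB !powRN lef_pV2 ?posrE ?powR_gt0//.
by apply: ge0_ler_powR; rewrite ?nnegrE ?subr_ge0 ltW.
Qed.

End fixed_phi.
End energy.

(** * Scaling *)

Section scaling.
Context {R : realType} {d : nat} (hd : (1 < d)%N).
Local Notation E := 'rV[R]_d.
Local Notation mu := (@lebesgue_rV R d).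
Local Notation cmod := ComplexField.Normc.normc.
Local Notation Re := complex.Re.
Local Notation Im := complex.Im.
Implicit Types (phi psi g : E -> R[i]) (x : E).
Local Open Scope complex_scope.

Definition scaled (t : R) phi : E -> R[i] := fun x => t%:C * phi x.

Lemma sqmassZ t phi : 0 < t -> sqmass (scaled t phi) = ((t ^+ 2)%:E * sqmass phi)%E.
Proof.
move=> t0; rewrite /sqmass -ge0_integralZ_pos ?exprn_gt0//.
- by apply: eq_integral => x _; rewrite cmodMl ?ltW// exprMn EFinM.
- by move=> x; rewrite lee_fin sqr_ge0.
Qed.

Lemma massZ t phi : 0 < t -> L2 phi -> mass (scaled t phi) = t ^+ 2 * mass phi.
Proof. by move=> t0 l2; rewrite /mass sqmassZ// -(sqmass_fin l2) -EFinM. Qed.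

Lemma qmassZ t q phi : 0 < t -> qmass q (scaled t phi) = ((t `^ q)%:E * qmass q phi)%E.
Proof.
move=> t0; rewrite /qmass -ge0_integralZ_pos ?powR_gt0//.
- apply: eq_integral => x _; rewrite cmodMl ?ltW// powRM ?EFinM// ?cmod_ge0//.
  exact: ltW.
- by move=> x; rewrite lee_fin powR_ge0.
Qed.

Lemma fine_qmassZ t q phi : 0 < t ->
  fine (qmass q (scaled t phi)) = t `^ q * fine (qmass q phi).
Proof.
move=> t0; rewrite qmassZ//; have := qmass_ge0 q phi.
case: (qmass q phi) => [r||]//= _.
by rewrite gt0_muley ?lte_fin ?powR_gt0//= mulr0.
Qed.

Variables (V : E -> R) (Om ga : R).
Hypotheses (mV : measurable_fun [set: E] V) (V0 : forall x, 0 <= V x).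

Lemma XspaceZ t phi : 0 < t -> Xspace V phi -> Xspace V (scaled t phi).
Proof.
move=> t0 [h1 vf]; split; first exact: H1Z.
rewrite (_ : (\int[mu]_x _)%E =
    ((t ^+ 2)%:E * \int[mu]_x (V x * cmod (phi x) ^+ 2)%:E)%E); last first.
  rewrite -ge0_integralZ_pos ?exprn_gt0//.
  - by apply: eq_integral => x _; rewrite cmodMl ?ltW// exprMn -EFinM mulrCA.
  - by move=> x; rewrite lee_fin mulr_ge0 ?sqr_ge0.
rewrite lte_mul_pinfty ?lee_fin ?sqr_ge0//.
Qed.

Hypotheses (Om0 : 0 < Om) (Omga : Om < ga).
Hypothesis Uoo : cvg_pinfty_at_infinity (reduced_potential hd V ga).

(** The energy densities are proportional almost everywhere only, because the
weak derivatives are. *)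
Lemma linear_energyZ t phi : 0 < t -> Xspace V phi ->
  linear_energy hd V Om (scaled t phi) = t ^+ 2 * linear_energy hd V Om phi.
Proof.
move=> t0 X; have X' := XspaceZ t0 X; have [h1 _] := X.
have ie := integrable_energy mV V0 Om0 Omga Uoo X.
have ie' := integrable_energy mV V0 Om0 Omga Uoo X'.
rewrite !linear_energyE -RintegralZl//; congr fine.
apply: ae_eq_integral => //.
- by have /integrableP[] := ie'.
- apply/measurable_EFinP; apply: measurable_funM => //.
  by have /integrableP[/measurable_EFinP] := ie.
have : {ae mu, forall x, forall j : 'I_d, wD j (scaled t phi) x = t%:C * wD j phi x}.
  by apply: filter_forall => j; exact: wDZ.
apply: filterS => x wx _; congr EFin.
have gE : grad_sqr (scaled t phi) x = t ^+ 2 * grad_sqr phi x.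
  rewrite /grad_sqr mulr_sumr; apply: eq_bigr => j _.
  by rewrite wx (cmodMl _ (ltW t0)) exprMn.
have cE : cmod (scaled t phi x) = t * cmod (phi x) := cmodMl (phi x) (ltW t0).
have rE : rotation_density hd (scaled t phi) x = t ^+ 2 * rotation_density hd phi x.
  rewrite (rotation_densityE hd (scaled t phi)) (rotation_densityE hd phi).
  rewrite (wx (axis1 hd)) (wx (axis2 hd)) /scaled.
  move: (wD (axis1 hd) phi x) (wD (axis2 hd) phi x) (phi x) => w1 w2 z.
  by rewrite !Re_mulCr !Im_mulCr; ring.
rewrite /energy_density gE cE rE.
move: (grad_sqr phi x) (cmod (phi x)) (rotation_density hd phi x) => G c r.
by ring.
Qed.

Lemma mass_gt0 phi : L2 phi -> ~ {ae mu, forall x, phi x = 0} -> 0 < mass phi.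
Proof.
move=> l2 nz; rewrite lt_neqAle mass_ge0 andbT eq_sym; apply/eqP => m0; apply: nz.
have mc := measurable_cmod l2.1.
have : ae_eq mu [set: E] (fun x => (cmod (phi x) ^+ 2)%:E) (cst 0%E).
  apply/ae_eq_integral_abs => //.
    by apply/measurable_EFinP; exact: measurable_funX.
  under eq_integral do rewrite gee0_abs ?lee_fin ?sqr_ge0//.
  by rewrite -/(sqmass phi) -(sqmass_fin l2) -/(mass phi) m0.
apply: filterS => x /(_ I)[] /eqP; rewrite sqrf_eq0 => /eqP.
exact: ComplexField.Normc.eq0_normc.
Qed.

End scaling.

(** * Action ground states *)

(** The derivative of the right-hand side vanishes at its minimum s = 1. *)
Lemma stationary_at_1 (R : realType) (a b r : R) :
  (forall s, 0 < s -> a + b <= s ^+ 2 * a + s `^ r * b) -> 2 * a + r * b = 0.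
Proof.
move=> h; pose f (s : R) := s ^+ 2 * a + s `^ r * b.
have df (s : R) : 0 < s -> is_derive s 1 f (2 * s * a + r * s `^ (r - 1) * b).
  move=> s0; have d1 := is_derive1_powR r s0.
  have d2 : is_derive s 1 (fun s : R => s `^ r * b) (r * s `^ (r - 1) * b).
    have h1 := is_deriveM d1 (is_derive_cst b s 1).
    by apply: (@is_derive_eq _ _ _ _ _ _ _ _ h1); rewrite /GRing.scale/=; ring.
  have d3 : is_derive s 1 (fun s : R => s ^+ 2 * a) (2 * s * a).
    have h0 := is_deriveM (is_derive_id s (1 : R)) (is_derive_id s (1 : R)).
    have h1 := is_deriveM h0 (is_derive_cst a s 1).
    by apply: (@is_derive_eq _ _ _ _ _ _ _ _ h1); rewrite /GRing.scale/= /cst; ring.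
  exact: is_deriveD d3 d2.
have i1 : (1 : R) \in `]0, 2[ by rewrite in_itv/= ltr01 ltr1n.
have := @derive1_at_min R f 0 2 1 (ler0n _ _) _ i1.
move=> /(_ _ _)[].
- by move=> t; rewrite in_itv/= => /andP[/df[]].
- move=> t; rewrite in_itv/= => /andP[t0 _].
  by rewrite /f expr1n powR1 !mul1r; exact: h.
move=> _ d0; rewrite -[RHS]d0 (@derive_val _ _ _ _ _ _ _ (df 1 ltr01)).
by rewrite powR1 !mulr1.
Qed.

Section ground_states.
Context {R : realType} {d : nat} (hd : (1 < d)%N).
Local Notation E := 'rV[R]_d.
Local Notation mu := (@lebesgue_rV R d).
Variables (V : E -> R) (Om ga l : R).
Hypotheses (mV : measurable_fun [set: E] V) (V0 : forall x, 0 <= V x).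
Hypotheses (Om0 : 0 < Om) (Omga : Om < ga).
Hypothesis Uoo : cvg_pinfty_at_infinity (reduced_potential hd V ga).
Hypothesis lE : lambda0 hd V Om = l%:E.
Implicit Types (phi psi : E -> R[i]).
Local Notation Q := (linear_energy hd V Om).

Let kappa := (1 - (Om / ga) ^+ 2) / 2.

Let kappa0 : 0 < kappa.
Proof.
have ga0 := lt_trans Om0 Omga.
rewrite divr_gt0// subr_gt0 exprn_ilt1 ?divr_ge0 ?ltW//.
by rewrite ltr_pdivrMr// mul1r.
Qed.

Lemma mass_ae0 phi : L2 phi -> {ae mu, forall x, phi x = 0} -> mass phi = 0.
Proof.
move=> l2 z; have mc := measurable_cmod l2.1.
rewrite /mass /sqmass (ae_eq_integral (cst 0%E))//; first by rewrite integral0.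
  by apply/measurable_EFinP; exact: measurable_funX.
apply: filterS z => x -> _.
by rewrite ComplexField.Normc.normc0 expr0n.
Qed.

Lemma grad_mass_ge0 phi : 0 <= fine (grad_mass phi).
Proof. by rewrite fine_ge0// integral_ge0// => x _; rewrite lee_fin grad_sqr_ge0. Qed.

(** The definition of lambda0 covers the functions that are not almost everywhere 0;
for the others the mass is 0 and the energy is nonnegative. *)
Lemma lambda0_le phi : Xspace V phi -> l * mass phi <= Q phi.
Proof.
move=> X; have [h1 _] := X; have [l2 _] := h1.
have [K K0 UK] := reduced_potential_bounded_below V0 Uoo.
have [m0|m0] := eqVneq (mass phi) 0.
  have := grad_le_energy mV V0 Om0 Omga Uoo X UK.
  rewrite m0 !mulr0 addr0; apply: le_trans.
  by rewrite mulr_ge0 ?grad_mass_ge0// ltW.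
have mp : 0 < mass phi by rewrite lt_neqAle eq_sym m0 mass_ge0.
rewrite -ler_pdivlMr// -lee_fin -lE; apply: ereal_inf_lbound.
exists phi; last by rewrite Lqnorm2.
by split => // z; move/eqP : m0; apply; exact: mass_ae0.
Qed.

Lemma near_minimiser (e : R) : 0 < e ->
  exists psi, [/\ Xspace V psi, mass psi = 1 & Q psi < l + e].
Proof.
move=> e0; have : (lambda0 hd V Om < (l + e)%:E)%E by rewrite lE lte_fin ltrDl.
move=> /ereal_inf_lt[_ [psi [X nz] <-]]; rewrite lte_fin Lqnorm2 -/(mass psi) => lt.
have [h1 _] := X; have [l2 _] := h1.
have mp := mass_gt0 l2 nz.
pose t := Num.sqrt (mass psi)^-1.
have t0 : 0 < t by rewrite sqrtr_gt0 invr_gt0.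
have t2 : t ^+ 2 = (mass psi)^-1 by rewrite sqr_sqrtr// invr_ge0 ltW.
exists (scaled t psi); split.
- exact: XspaceZ.
- by rewrite massZ// t2 mulVf// gt_eqF.
- by rewrite (linear_energyZ mV V0 Om0 Omga Uoo)// t2 mulrC.
Qed.

Variable p : R.
Hypotheses (p1 : 1 < p) (psub : (p + 1) * (1 - 2 / d%:R) < 2).

(** For unit mass, the energy bounds the gradient uniformly in e < 1, so the Sobolev
inequality bounds the moment of order p + 1 uniformly. *)
Lemma trial_functions : exists2 C : R, 1 <= C & forall e : R, 0 < e -> e < 1 ->
  exists psi, [/\ Xspace V psi, mass psi = 1, Q psi < l + e &
    fine (qmass (p + 1) psi) <= C].
Proof.
have [K K0 UK] := reduced_potential_bounded_below V0 Uoo.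
pose G := (`|l| + 1 + K) / kappa.
have G0 : 0 < G by rewrite divr_gt0// ltr_wpDr// ltr_wpDl.
have q2 : 2 < p + 1 by move: p1; lra.
have [C C0 HC] := sobolev_subcritical hd q2 psub G0.
exists (C + 1); first by rewrite lerDr ltW.
move=> e e0 e1; have [psi [X m1 Qe]] := near_minimiser e0.
exists psi; split => //; have [h1 _] := X; have [l2 _] := h1.
have : (qmass (p + 1) psi <= C%:E)%E.
  apply: HC => //; first by rewrite -(sqmass_fin l2) -/(mass psi) m1.
  have gfin : grad_mass psi \is a fin_num.
    by apply: integrable_fin_num => //; exact: grad_integrable.
  rewrite -(fineK gfin) lee_fin /G ler_pdivlMr// mulrC.
  apply: (le_trans (grad_le_energy mV V0 Om0 Omga Uoo X UK)).
  by rewrite m1 mulr1; have := ler_norm l; lra.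
move=> h; have := qmass_ge0 (p + 1) psi; move: h.
by case: (qmass _ _) => [r||]//=; rewrite lee_fin => h _; lra.
Qed.

Local Notation S := (action hd p V Om).

Let p10 : 0 < p + 1. Proof. by move: p1; lra. Qed.

Lemma actionZ om (s : R) phi : 0 < s -> Xspace V phi ->
  S om (scaled s phi) = s ^+ 2 * (Q phi + om * mass phi) +
    s `^ (p + 1) * (2 / (p + 1) * fine (qmass (p + 1) phi)).
Proof.
move=> s0 X; have X' := XspaceZ V0 s0 X; have [[l2 _] _] := X.
rewrite (actionE mV V0 Om0 Omga Uoo X')//.
rewrite (linear_energyZ mV V0 Om0 Omga Uoo)// massZ// fine_qmassZ//; ring.
Qed.

Lemma action1 om phi : Xspace V phi ->
  S om phi = (Q phi + om * mass phi) + 2 / (p + 1) * fine (qmass (p + 1) phi).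
Proof. by move=> X; rewrite (actionE mV V0 Om0 Omga Uoo X)//; ring. Qed.

(** The competitor t psi has action at most
t^2 (- e / 2) + t^(p+1) C = - t^2 e / 4 when t^(p-1) = e / (4 C); the action of phi
is at least - e times its mass. The negativity of the action of phi is recorded
because it excludes an infinite moment of order p + 1. *)
Lemma mass_lower_bound : exists2 c : R, 0 < c & forall e phi, 0 < e -> e < 1 ->
  action_ground_states hd p V Om (- l - e) phi ->
  c * e `^ (2 / (p - 1)) <= mass phi /\ S (- l - e) phi < 0.
Proof.
have [C C1 HC] := trial_functions.
have C0 : 0 < C := lt_le_trans ltr01 C1.
have p10' : 0 < p - 1 by rewrite subr_gt0.
exists (4^-1 * (4 * C)^-1 `^ (2 / (p - 1))).
  by rewrite mulr_gt0 ?invr_gt0// powR_gt0// invr_gt0 mulr_gt0.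
move=> e phi e0 e1 [X mini].
have e20 : 0 < e / 2 by rewrite divr_gt0.
have e21 : e / 2 < 1 by lra.
have [psi [Xpsi m1 Qpsi Npsi]] := HC _ e20 e21.
pose b := e * (4 * C)^-1.
have b0 : 0 < b by rewrite mulr_gt0// invr_gt0 mulr_gt0.
pose t := b `^ ((p - 1)^-1).
have t0 : 0 < t by exact: powR_gt0.
have t2 : t ^+ 2 = (4 * C)^-1 `^ (2 / (p - 1)) * e `^ (2 / (p - 1)).
  rewrite -(powR_mulrn 2) ?(ltW t0)// /t -powRrM.
  rewrite (_ : (p - 1)^-1 * 2%:R = 2 / (p - 1)); last by rewrite mulrC.
  by rewrite /b powRM ?invr_ge0 ?mulr_ge0 ?(ltW C0) ?(ltW e0)// mulrC.
have tp : t `^ (p + 1) = t ^+ 2 * b.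
  have -> : p + 1 = 2%:R + (p - 1) by ring.
  rewrite powRD; last by rewrite (gt_eqF t0) implybT.
  rewrite (powR_mulrn 2) ?(ltW t0)//; congr (_ * _).
  by rewrite /t -powRrM mulVf ?gt_eqF// powRr1// ltW.
have t20 : 0 < t ^+ 2 by rewrite exprn_gt0.
have St : S (- l - e) (scaled t psi) <= - (t ^+ 2 * (e / 4)).
  rewrite actionZ// m1 mulr1 tp.
  have h1 : 2 / (p + 1) * fine (qmass (p + 1) psi) <= C.
    have n0 : 0 <= fine (qmass (p + 1) psi) by rewrite fine_ge0// qmass_ge0.
    apply: le_trans Npsi; rewrite ler_piMl// ler_pdivrMr// mul1r.
    by move: p1; lra.
  have h2 : t ^+ 2 * b * (2 / (p + 1) * fine (qmass (p + 1) psi)) <= t ^+ 2 * b * C.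
    by rewrite ler_wpM2l// mulr_ge0 ?ltW.
  have h3 : t ^+ 2 * (Q psi + (- l - e)) <= t ^+ 2 * (- (e / 2)).
    by rewrite ler_wpM2l ?ltW//; lra.
  have h4 : t ^+ 2 * b * C = t ^+ 2 * (e / 4).
    by rewrite /b; field; rewrite gt_eqF.
  apply: (le_trans (lerD h3 h2)); rewrite h4.
  by lra.
have Sphi := le_trans (mini _ (XspaceZ V0 t0 Xpsi)) St.
split; last first.
  by apply: (le_lt_trans Sphi); rewrite oppr_lt0 mulr_gt0// divr_gt0.
have Slow : - (e * mass phi) <= S (- l - e) phi.
  rewrite action1//.
  have n0 : 0 <= 2 / (p + 1) * fine (qmass (p + 1) phi).
    by rewrite mulr_ge0 ?divr_ge0 ?(ltW p10)// fine_ge0// qmass_ge0.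
  move: n0 (lambda0_le X); set N := 2 / (p + 1) * _.
  by move: (mass phi) (Q phi) N => m q N ? ?; lra.
have : e * (t ^+ 2 / 4) <= e * mass phi by lra.
rewrite (ler_pM2l e0); apply: le_trans; rewrite t2.
by rewrite -[leLHS]mulrA [leLHS]mulrC.
Qed.

(** Half of the mass lies in a fixed cube, and on this cube the mass is at most
M / 4 + tau^(1-p) N when tau^2 = M / (4 w), where w bounds the volume of the
cube. With N <= e M this leaves tau^(p-1) <= 4 e. *)
Lemma mass_upper_bound : exists2 C : R, 0 < C & forall e phi, 0 < e -> e < 1 ->
  action_ground_states hd p V Om (- l - e) phi -> S (- l - e) phi < 0 ->
  mass phi <= C * e `^ (2 / (p - 1)).
Proof.
have [K K0 UK] := reduced_potential_bounded_below V0 Uoo.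
(* The factor 2 leaves at most half of the mass outside the cube, as
   Q + K M <= (l + e + K) M <= A M / 2. *)
pose A := 2 * (`|l| + 1 + K).
have A0 : 0 < A by rewrite mulr_gt0// ltr_wpDr// ltr_wpDl.
have [n Un] := reduced_potential_large Uoo A.
pose w := fine (mu (cube n)) + 1.
have w0 : 0 < w by rewrite ltr_wpDl// fine_ge0.
have p10' : 0 < p - 1 by rewrite subr_gt0.
exists (4 * w * 4 `^ (2 / (p - 1))).
  by rewrite mulr_gt0 ?powR_gt0// mulr_gt0.
move=> e phi e0 e1 [X mini] S0; have [h1 _] := X; have [l2 _] := h1.
set om := - l - e in mini S0.
set q0 := Q phi + om * mass phi; set N := fine (qmass (p + 1) phi).
have N0 : 0 <= N by rewrite fine_ge0// qmass_ge0.
have SE : S om phi = q0 + 2 / (p + 1) * N by exact: action1.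
have st : 2 * q0 + (p + 1) * (2 / (p + 1) * N) = 0.
  apply: stationary_at_1 => s s0; rewrite -SE -(actionZ _ s0 X).
  by apply: mini; exact: XspaceZ.
have Nq : N = - q0.
  have : (p + 1) * (2 / (p + 1) * N) = 2 * N by field; rewrite gt_eqF.
  by lra.
have lQ := lambda0_le X.
have N_le : N <= e * mass phi.
  by rewrite Nq /q0 /om; lra.
have qfin : (qmass (p + 1) phi < +oo)%E.
  (* An infinite moment would enter the action as 0, so that stationarity
     would force the action to vanish. *)
  rewrite ltey; apply/eqP => qoo; have N00 : N = 0 by rewrite /N qoo.
  by move: S0; rewrite SE N00 mulr0 addr0; lra.
have [m0|m0] := eqVneq (mass phi) 0.
  by rewrite m0 mulr_ge0 ?powR_ge0// mulr_ge0 ?powR_ge0// mulr_ge0 ?ltW.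
have mp : 0 < mass phi by rewrite lt_neqAle eq_sym m0 mass_ge0.
set Mloc := \int[mu]_x (\1_(cube n) x * ComplexField.Normc.normc (phi x) ^+ 2).
have half : mass phi / 2 <= Mloc.
  have UA x : ~ cube n x -> A <= reduced_potential hd V ga x + K.
    by move=> /Un h; rewrite ler_wpDr.
  have := tail_le_energy mV V0 Om0 Omga Uoo X (ltW A0) UK UA; rewrite -/Mloc => h.
  have : Q phi + K * mass phi <= A * (mass phi / 2).
    have h2 : (l + e + K) * mass phi <= (A / 2) * mass phi.
      by rewrite ler_wpM2r ?(ltW mp)// /A; have := ler_norm l; lra.
    have : Q phi <= (l + e) * mass phi by move: N0; rewrite Nq /q0 /om; lra.
    by move: h2; rewrite mulrDl; lra.
  by move/(le_trans h); rewrite ler_pM2l//; lra.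
pose tau := Num.sqrt (mass phi / (4 * w)).
have tau0 : 0 < tau by rewrite sqrtr_gt0 divr_gt0// mulr_gt0.
have tau2 : tau ^+ 2 = mass phi / (4 * w).
  by rewrite sqr_sqrtr// divr_ge0 ?(ltW mp)// mulr_ge0 ?ltW.
have q2 : 2 < p + 1 by move: p1; lra.
have := local_mass_le X n q2 tau0 qfin; rewrite -/Mloc -/N => loc.
have c1 : tau ^+ 2 * fine (mu (cube n)) <= mass phi / 4.
  apply: (@le_trans _ _ (tau ^+ 2 * w)).
    by rewrite ler_wpM2l ?sqr_ge0// /w lerDl.
  by rewrite tau2 le_eqVlt; apply/orP; left; apply/eqP; field; rewrite gt_eqF.
have c2 : mass phi / 4 <= tau `^ (2 - (p + 1)) * (e * mass phi).
  have : tau `^ (2 - (p + 1)) * N <= tau `^ (2 - (p + 1)) * (e * mass phi).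
    by rewrite ler_wpM2l ?powR_ge0.
  lra.
have taue : tau `^ (p - 1) <= 4 * e.
  move: c2; have -> : 2 - (p + 1) = - (p - 1) by ring.
  have tp : 0 < tau `^ (p - 1) by exact: powR_gt0.
  rewrite powRN ler_pdivlMl// => c2; rewrite -(ler_pM2r mp).
  by move: c2; move: (mass phi) (tau `^ (p - 1)) => m T ?; lra.
have tau_le : tau ^+ 2 <= 4 `^ (2 / (p - 1)) * e `^ (2 / (p - 1)).
  rewrite -powRM ?(ltW e0)//.
  have -> : tau ^+ 2 = (tau `^ (p - 1)) `^ (2 / (p - 1)).
    by rewrite -powRrM mulrCA divff ?gt_eqF// mulr1 (powR_mulrn 2)// ltW.
  by apply: ge0_ler_powR; rewrite ?nnegrE ?powR_ge0 ?divr_ge0 ?mulr_ge0 ?(ltW e0) ?(ltW p10').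
have -> : mass phi = 4 * w * tau ^+ 2 by rewrite tau2; field; rewrite gt_eqF.
by rewrite -[leRHS]mulrA ler_wpM2l// mulr_ge0// ltW.
Qed.

End ground_states.

Theorem theorem4p6 (R : realType) (d : nat) (hd : (1 < d)%N) (p : R)
    (V : 'rV[R]_d -> R) (Omega : R) :
  1 < p ->
  ((2 < d)%N -> p < (d%:R + 2) / (d%:R - 2)) ->
  measurable_fun [set: 'rV[R]_d] V ->
  (forall x, 0 <= V x) ->
  cvg_pinfty_at_infinity V ->
  (0 < Omega_max hd V)%E ->
  0 < Omega ->
  (Omega%:E < Omega_max hd V)%E ->
  exists delta c C : R,
    [/\ 0 < delta, 0 < c, 0 < C &
      forall omega : R,
        (- lambda0 hd V Omega - delta%:E < omega%:E)%E ->
        (omega%:E < - lambda0 hd V Omega)%E ->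
        forall phi, action_ground_states hd p V Omega omega phi ->
          c * `|omega + fine (lambda0 hd V Omega)| `^ (2 / (p - 1))
            <= Lqnorm 2 phi ^+ 2
          /\ Lqnorm 2 phi ^+ 2
            <= C * `|omega + fine (lambda0 hd V Omega)| `^ (2 / (p - 1))].
Proof.
move=> p1 psub mV V0 _ _ Om0 /ereal_sup_gt[_ [ga [ga0 Uoo] <-]].
rewrite lte_fin => Omga.
have qsub : (p + 1) * (1 - 2 / d%:R) < 2.
  have d0 : 0 < d%:R :> R by rewrite ltr0n ltnW.
  have := hd; rewrite leq_eqVlt => /orP[/eqP d2|d2].
    by rewrite -d2 divff ?pnatr_eq0// subrr mulr0.
  have dd : 0 < d%:R - 2 :> R by rewrite subr_gt0 ltr_nat.
  have := psub d2; rewrite ltr_pdivlMr// => h.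
  rewrite -(ltr_pM2r d0).
  have -> : (p + 1) * (1 - 2 / d%:R) * d%:R = (p + 1) * (d%:R - 2).
    by field; rewrite gt_eqF.
  by lra.
case lE : (lambda0 hd V Omega) => [l||].
- have [c c0 Hc] := mass_lower_bound mV V0 Om0 Omga Uoo lE p1 qsub.
  have [C C0 HC] := mass_upper_bound mV V0 Om0 Omga Uoo lE p1.
  exists 1, c, C; split => // om.
  rewrite -EFinN -EFinB !lte_fin /= => om1 om2 phi.
  pose e := - l - om.
  have e0 : 0 < e by rewrite subr_gt0.
  have e1 : e < 1 by rewrite /e; lra.
  have -> : om = - l - e by rewrite /e; ring.
  have -> : `|- l - e + l| = e.
    by rewrite (_ : - l - e + l = - e) ?normrN ?gtr0_norm//; ring.
  move=> gs; rewrite Lqnorm2; have [low neg] := Hc e phi e0 e1 gs.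
  by split => //; exact: (HC e phi e0 e1 gs neg).
(* If lambda0 is infinite, no omega satisfies both strict inequalities. *)
- by exists 1, 1, 1; split => // om; rewrite /= ltNge leNye.
- by exists 1, 1, 1; split => // om; rewrite /= ltNge leey.
Qed.
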